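(* Let $N \geq 2$ be an integer, and let $\mathbb{P}$ denote the set of prime numbers. Then $$\operatorname{doa}\left(\bigcup_{t=1}^{N-1} t\mathbb{P}\right) = N,$$ where $t\mathbb{P} = \{tp : p \in \mathbb{P}\}$.
   Context: $\mathbb{N}$ denotes the set of positive integers. An $r$-coloring of $\mathbb{N}$ is a function from $\mathbb{N}$ to a set with $r$ elements (usually $\{1,\dots,r\}$). A set $A \subseteq \mathbb{N}$ is monochromatic with respect to a coloring $\chi$ if $\chi$ is constant on $A$. For $D \subseteq \mathbb{N}$, a $k$-term $D$-diffsequence is a sequence of positive integers $x_1, x_2, \dots, x_k$ with $x_{i+1} - x_i \in D$ for all $1 \leq i \leq k-1$. A set $D \subseteq \mathbb{N}$ is $r$-accessible if, for every $r$-coloring of $\mathbb{N}$ and every $k \geq 1$, there exists a monochromatic $k$-term $D$-diffsequence. The degree of accessibility $\operatorname{doa}(D)$ is the greatest positive integer $r$ for which $D$ is $r$-accessible; if $D$ is $r$-accessible for every $r \in \mathbb{N}$, then $\operatorname{doa}(D) = \infty$. *)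

(* Defs.v *)
From mathcomp Require Import all_boot.
From mathcomp Require Import boolp classical_sets.

Set Implicit Arguments.
Unset Strict Implicit.
Unset Printing Implicit Defensive.

Local Open Scope classical_set_scope.
Local Open Scope nat_scope.

(* The positive integers are represented by [nat] with explicit
   positivity conditions. *)

(* The strict inequality makes the truncated subtraction the true difference,
   and makes the element 0 of [D], if present, irrelevant. *)
Definition diffsequence (D : set nat) (k : nat) (x : seq nat) : Prop :=
  [/\ size x = k,
      forall i, i < k -> 0 < nth 0 x i
    & forall i, i.+1 < k ->
        nth 0 x i < nth 0 x i.+1 /\ D (nth 0 x i.+1 - nth 0 x i)].

Definition monochromatic (C : Type) (chi : nat -> C) (A : set nat) : Prop :=
  forall a b, A a -> A b -> chi a = chi b.

(* The colour that [chi] gives to 0 plays no role, since the terms of a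
   diffsequence are positive. *)
Definition accessible (r : nat) (D : set nat) : Prop :=
  forall (chi : nat -> 'I_r) (k : nat), 0 < k ->
    exists2 x : seq nat, diffsequence D k x & monochromatic chi [set` x].

Definition greatest_accessible (D : set nat) (r : nat) : Prop :=
  [/\ 0 < r, accessible r D & forall s, 0 < s -> accessible s D -> s <= r].

(* [None] stands for infinity; the value is the dummy [Some 0] when [D] is not
   even 1-accessible, in which case there is no greatest [r]. *)
Definition doa (D : set nat) : option nat :=
  if `[< forall r, 0 < r -> accessible r D >] then None
  else Some (xget 0 [set r | greatest_accessible D r]).

Definition primes_set : set nat := [set p | prime p].

Definition dilate (t : nat) (A : set nat) : set nat := [set t * p | p in A].

(* Main.v *)
Require Import Defs.
From mathcomp Require Import all_boot all_order all_algebra.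
From mathcomp Require Import boolp classical_sets reals topology normedtype derive realfun exp trigo.
From mathcomp Require Import fingroup cyclic.
From mathcomp Require Rstruct.
From mathcomp Require Import zify ring lra.

(** Upper bound. Colour [x] by [x mod N], except on a sparse set of windows of a
    long period, which gets an extra colour; see [special].

    Lower bound. Let [chi] be an [N]-colouring and call [w, w + t] with
    [0 < t < N] a defect if both have the same colour. On an interval without
    defects [chi] is [N]-periodic, and [N] is in [D]; so if such intervals are
    arbitrarily long we are done. Otherwise defects are syndetic. If
    monochromatic chains were bounded, let the rank of [x] be the maximal length
    of a chain ending at [x], and classify the integers by the position and [t]
    of a nearby defect, its colour and the ranks of [w] and [w + t]. Some class
    has positive upper density, so by a Sarkozy-type theorem for shifted primes it
    has elements differing by [t (p - 1)] and elements differing by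
    [t (p + 1)]. The first gives a step of length [t p] from [w] to [w' + t], the
    second one from [w + t] to [w'], and the two ranks would have to be
    ordered both ways.

    The recurrence theorem follows, by averaging over the discrete circle, from
    weights on shifted primes whose cosine sum is everywhere at least [-eps].
    They are an average over a tower of moduli [q] and scales of the primes
    congruent to [1] (or [-1]) mod [q]. Two facts are needed. First, the
    exponential sum over primes is small near rationals whose
    denominator [b] is large; no zero-free region is used: in a Vaughan-type
    identity the weights [Lambda(d)] are majorized by a Selberg sieve on
    divisors coprime to [b], which saves the logarithm lost by
    Cauchy-Schwarz. Second, the primes congruent to [1] and [-1] mod [q] have
    positive lower density: the vector of the sums of [Lambda(n) / n] over residue
    classes is studied through the operator [v -> sum_m v(g m) / m] on functions
    on the unit group, whose kernel is trivial because it would otherwise contain a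
    real character [chi] with [L(1, chi) = 0]. *)

Set Implicit Arguments.
Unset Strict Implicit.
Unset Printing Implicit Defensive.
Import Order.TTheory GRing.Theory Num.Theory.
Import numFieldNormedType.Exports.
Local Open Scope ring_scope.

(** * Arithmetic functions *)

(** The logarithm saved by the sieve decides the range of the exponential sum estimate. With the
    plain bound for [Lambda], Cauchy-Schwarz loses powers of [ln x], so that it is of use only for
    denominators beyond a power of [ln x]; the range between a constant and that power is the
    classical domain of the Siegel-Walfisz theorem. The sieve brings the threshold down to a
    constant that depends on the required saving alone.

    Each cosine sum is divided by its own mass. A positive lower density of the primes for a fixed
    modulus then turns a saving against [x] into a saving against the mass, because the saving can
    be chosen after the modulus. At a rational whose denominator is small and does not divide the
    modulus, the normalized sum is only known to be at least [-1]; the tower of moduli makes this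
    happen at boundedly many of its levels, and the average over the levels hides them. *)

Lemma sum_multiples (V : nmodType) (F : nat -> V) (d x : nat) : (0 < d)%N ->
  \sum_(1 <= n < x.+1 | (d %| n)%N) F n
  = \sum_(1 <= m < (x %/ d).+1) F (d * m)%N.
Proof.
move=> d0; elim: x => [|x IHx]; first by rewrite div0n !big_geq.
rewrite big_mkcond big_nat_recr //= -big_mkcond /= IHx divnS //.
case: ifP => [/dvdnP[m hm]|_]; last by rewrite addr0 add0n.
by rewrite add1n [RHS]big_nat_recr //=; congr (_ + F _);
  move: (divnS x d0); rewrite hm dvdn_mull // mulnK // mulnC => ->.
Qed.

Lemma sum_dvd_swap (V : nmodType) (G : nat -> nat -> V) (x : nat) :
  \sum_(1 <= n < x.+1) \sum_(1 <= d < x.+1 | (d %| n)%N) G d n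
  = \sum_(1 <= d < x.+1) \sum_(1 <= m < (x %/ d).+1) G d (d * m)%N.
Proof.
rewrite (exchange_big_dep_nat xpredT) //=.
by apply: eq_big_nat => d /andP[d0 _]; rewrite -sum_multiples.
Qed.

Lemma sum_divisors_range (V : nmodType) (f : nat -> V) (n x : nat) :
  (0 < n)%N -> (n <= x)%N ->
  \sum_(d <- divisors n) f d = \sum_(1 <= d < x.+1 | (d %| n)%N) f d.
Proof.
move=> n0 nx; rewrite -[RHS]big_filter; apply: perm_big; apply: uniq_perm.
- exact: divisors_uniq.
- by rewrite filter_uniq // iota_uniq.
- move=> d; rewrite -dvdn_divisors // mem_filter mem_index_iota.
  by case: (boolP (d %| n)%N) => //= dn; have := dvdn_leq n0 dn;
    have := dvdn_gt0 n0 dn; lia.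
Qed.

Lemma sum_divisors_ppart (V : nmodType) (f : nat -> V) (p a m : nat) :
  prime p -> ~~ (p %| m)%N -> (0 < m)%N ->
  \sum_(d <- divisors (p ^ a * m)) f d
  = \sum_(0 <= i < a.+1) \sum_(d <- divisors m) f (p ^ i * d)%N.
Proof.
move=> pp pm m0.
transitivity (\sum_(e <- [seq (p ^ i * d)%N | i <- index_iota 0 a.+1, d <- divisors m]) f e);
  last by rewrite big_allpairs_dep.
have p0 := prime_gt0 pp.
have cop i d : (d %| m)%N -> coprime (p ^ i) d.
  by move=> dm; apply: coprimeXl; rewrite prime_coprime //; apply: contra pm => /dvdn_trans; apply.
apply: perm_big; apply: uniq_perm; first exact: divisors_uniq.
  apply: allpairs_uniq; rewrite ?iota_uniq ?divisors_uniq //.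
  move=> [i d] [j e] h1 h2; case/allpairsP: h1 => [[i' d'] /= [_ hd [-> ->]]].
  case/allpairsP: h2 => [[j' e'] /= [_ he [-> ->]]] /= {i d j e} H.
  move: hd he; rewrite -!dvdn_divisors // => hd he.
  have pd k : (k %| m)%N -> logn p k = 0%N.
    move=> km; apply/eqP; rewrite -leqn0 leqNgt logn_gt0 mem_primes pp /=.
    by rewrite (dvdn_gt0 m0 km) /=; apply: contra pm => /dvdn_trans; apply.
  have E : i' = j'.
    have := congr1 (logn p) H; rewrite !lognM ?expn_gt0 ?p0 ?(dvdn_gt0 m0) //.
    by rewrite !pfactorK // !pd // !addn0.
  move: H; rewrite E => /eqP; rewrite eqn_pmul2l ?expn_gt0 ?p0 // => /eqP -> //.
move=> d; rewrite -dvdn_divisors ?muln_gt0 ?expn_gt0 ?p0 //; apply/idP/idP.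
  move=> dv; apply/allpairsP.
  have d0 : (0 < d)%N by apply: dvdn_gt0 dv; rewrite muln_gt0 expn_gt0 p0.
  exists (logn p d, (d`_p^')%N); split => /=.
  - rewrite mem_index_iota /= ltnS.
    have := dvdn_leq_log p (_ : 0 < p ^ a * m)%N dv.
    rewrite muln_gt0 expn_gt0 p0 m0 => /(_ isT); rewrite lognM ?expn_gt0 ?p0 //.
    by rewrite pfactorK // (lognE p m) pp m0 (negbTE pm) addn0.
  - rewrite -dvdn_divisors //.
    have : ((d`_p^')%N %| p ^ a * m)%N by apply: dvdn_trans dv; exact: dvdn_part.
    rewrite Gauss_dvdr // coprimeXr // coprime_sym prime_coprime //.
    by rewrite -p'natE //; exact: part_pnat.
  - by rewrite -p_part partnC.
case/allpairsP=> -[i e] /= [hi he ->].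
move: he; rewrite -dvdn_divisors // => he.
rewrite Gauss_dvd ?cop //; apply/andP; split; last exact: dvdn_mull.
by apply: dvdn_mulr; rewrite dvdn_exp2l //; move: hi; rewrite mem_index_iota; lia.
Qed.

Lemma logn_ndvd (p m : nat) : prime p -> (0 < m)%N -> ~~ (p %| m)%N -> logn p m = 0%N.
Proof. by move=> pp m0 pm; rewrite lognE pp m0 (negbTE pm). Qed.

Lemma primes_ppart (p a m : nat) : prime p -> ~~ (p %| m)%N -> (0 < m)%N ->
  (0 < a)%N -> perm_eq (primes (p ^ a * m)) (p :: primes m).
Proof.
move=> pp pm m0 a0; apply: uniq_perm; first exact: primes_uniq.
  by rewrite /= primes_uniq mem_primes (negbTE pm) !andbF.
move=> q; rewrite in_cons !mem_primes muln_gt0 expn_gt0 (prime_gt0 pp) m0 /=.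
case: (boolP (prime q)) => qp /=; last by rewrite orbF; apply/esym/negP => /eqP E; move: qp; rewrite E pp.
by rewrite Euclid_dvdM // Euclid_dvdX // a0 andbT dvdn_prime2.
Qed.

Lemma ppart_decomp (n : nat) : (1 < n)%N ->
  exists p a m, [/\ prime p, ~~ (p %| m)%N, (0 < m)%N, (0 < a)%N & n = (p ^ a * m)%N].
Proof.
move=> n1; have pp := pdiv_prime n1; have n0 : (0 < n)%N by lia.
exists (pdiv n), (logn (pdiv n) n), (n`_(pdiv n)^')%N; split => //.
- by rewrite -p'natE //; exact: part_pnat.
- by rewrite logn_gt0 mem_primes pp n0 pdiv_dvd.
- by rewrite -p_part partnC.
Qed.

Section Arith.
Variable R : realType.
Implicit Types (n d m p : nat).

Definition mu n : R := \prod_(p <- primes n) (if logn p n == 1%N then -1 else 0).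

(* The von Mangoldt function. *)
Definition vonM n : R := if primes n is [:: p] then ln p%:R else 0.

Lemma mu1 : mu 1 = 1.
Proof. by rewrite /mu big_nil. Qed.

Lemma mu_ppart p a m : prime p -> ~~ (p %| m)%N -> (0 < m)%N -> (0 < a)%N ->
  mu (p ^ a * m) = (if a == 1%N then -1 else 0) * mu m.
Proof.
move=> pp pm m0 a0; rewrite /mu (perm_big _ (primes_ppart pp pm m0 a0)) /= big_cons.
have p0 : (0 < p ^ a)%N by rewrite expn_gt0 prime_gt0.
rewrite lognM // pfactorK // logn_ndvd // addn0; congr (_ * _).
apply: eq_big_seq => q; rewrite mem_primes => /and3P[qp _ qm].
have qp' : q != p by apply: contraNneq pm => <-.
by rewrite lognM // lognX logn_prime // (negbTE qp') muln0 add0n.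
Qed.

Lemma mu_norm n : `|mu n| <= 1.
Proof.
rewrite /mu normr_prod; elim: (primes n) => [|p s IHs]; rewrite ?big_nil ?big_cons //.
apply: mulr_ile1 => //; first exact: prodr_ge0.
by case: ifP => _; rewrite ?normrN1 ?normr0.
Qed.

(** Split off a prime power: only the exponents 0 and 1 contribute, with opposite signs. *)
Lemma sum_mu n : (0 < n)%N -> \sum_(d <- divisors n) mu d = (n == 1%N)%:R.
Proof.
move=> n0; case: (ltnP 1 n) => n1; last first.
  by have -> : n = 1%N by [lia]; rewrite (_ : divisors 1 = [:: 1%N]) // big_seq1 mu1.
have [p [a [m [pp pm m0 a0 ->]]]] := ppart_decomp n1.
rewrite sum_divisors_ppart // gtn_eqF; last first.
  by apply: (@leq_trans (p ^ a)); rewrite ?leq_pmulr // -{1}(exp1n a) ltn_exp2r // prime_gt1.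
rewrite exchange_big big_seq big1 //= => d; rewrite -dvdn_divisors // => dm.
have d0 := dvdn_gt0 m0 dm; have pd : ~~ (p %| d)%N by apply: contra pm => /dvdn_trans; apply.
case: a a0 {n n0 n1} => // a _.
rewrite big_nat_recl // big_nat_recl // expn0 mul1n mu_ppart //= mulN1r addrA subrr add0r.
by rewrite big1_seq // => i _; rewrite mu_ppart //= mul0r.
Qed.

Lemma sum_vonM n : (0 < n)%N -> \sum_(d <- divisors n) vonM d = ln n%:R.
Proof.
elim/ltn_ind: n => n IHn n0; case: (ltnP 1 n) => n1; last first.
  by have -> : n = 1%N by [lia]; rewrite (_ : divisors 1 = [:: 1%N]) // big_seq1 /vonM /= ln1.
have [p [a [m [pp pm m0 a0 E]]]] := ppart_decomp n1; rewrite E.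
have p1 : (1 < p ^ a)%N by rewrite -{1}(exp1n a) ltn_exp2r // prime_gt1.
rewrite sum_divisors_ppart // big_nat_recl // expn0.
rewrite (eq_bigr (fun d => vonM d)); last by move=> d _; rewrite mul1n.
rewrite IHn // ?E ?ltn_Pmull //.
have -> : ln (p ^ a * m)%:R = ln m%:R + (ln p%:R) *+ a :> R.
  by rewrite natrM lnM ?posrE ?ltr0n ?(ltnW p1) // natrX lnXn ?ltr0n ?prime_gt0 // addrC.
congr (_ + _).
have -> : ln p%:R *+ a = \sum_(0 <= i < a) ln p%:R :> R by rewrite sumr_const_nat subn0.
apply: eq_bigr => i _.
(* Among the numbers [p ^ i.+1 * d] only [d = 1] gives a prime power. *)
rewrite (bigD1_seq 1%N) /= ?divisors_uniq -?dvdn_divisors ?dvd1n //.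
rewrite big_seq_cond big1 ?addr0 => [|d /andP[]].
  by rewrite /vonM muln1 primesX // primes_prime.
rewrite -dvdn_divisors // => dm d1; have d0 := dvdn_gt0 m0 dm.
have pd : ~~ (p %| d)%N by apply: contra pm => /dvdn_trans; apply.
have hs : (0 < size (primes d))%N.
  have d2 : (1 < d)%N by lia.
  have : pdiv d \in primes d by rewrite mem_primes pdiv_prime // d0 pdiv_dvd.
  by case: (primes d).
rewrite /vonM; move: (perm_size (primes_ppart pp pd d0 (ltn0Sn i))).
by case: (primes (p ^ i.+1 * d)) => [|q [|r t]] //= H; move: hs; lia.
Qed.

Lemma vonM_neq0 n : vonM n != 0 -> exists p k, [/\ prime p, (0 < k)%N & n = (p ^ k)%N].
Proof.
rewrite /vonM; case E : (primes n) => [|p [|? ?]]; rewrite ?eqxx // => _.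
have n0 : (0 < n)%N by case: n E.
have pn : p \in primes n by rewrite E inE.
exists p, (logn p n); split; first by move: pn; rewrite mem_primes => /and3P[].
  by rewrite logn_gt0.
by rewrite {1}(prod_prime_decomp n0) prime_decompE E /= big_seq1.
Qed.

Lemma vonM_pexp p k : prime p -> (0 < k)%N -> vonM (p ^ k) = ln p%:R.
Proof. by move=> pp k0; rewrite /vonM primesX // primes_prime. Qed.

Lemma ln_nat_ge0 n : 0 <= ln n%:R :> R.
Proof. by case: n => [|n]; [rewrite ln0 | apply: ln_ge0; rewrite ler1n]. Qed.

Lemma ln_nat_le m n : (m <= n)%N -> ln m%:R <= ln n%:R :> R.
Proof.
case: m => [|m] mn; first by rewrite ln0 // ln_nat_ge0.
by rewrite ler_ln ?posrE ?ltr0n ?ler_nat //; lia.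
Qed.

Lemma vonM_ge0 n : 0 <= vonM n.
Proof. by rewrite /vonM; case: (primes n) => [|p []] //; rewrite ln_nat_ge0. Qed.

Lemma vonM_le n : vonM n <= ln n%:R.
Proof.
case: (eqVneq (vonM n) 0) => [->|/vonM_neq0[p [k [pp k0 ->]]]]; first exact: ln_nat_ge0.
by rewrite vonM_pexp // ln_nat_le // -{1}(expn1 p) leq_exp2l ?prime_gt1.
Qed.

End Arith.

(** * Trigonometric sums *)
Section Trig.
Variable R : realType.
Implicit Types (x y a w : R) (n m k b : nat).

Lemma sin_cos_mul x : 0 <= x -> exists2 c, 0 <= c <= x & sin x = cos c * x.
Proof.
move=> x0; have [c cx] := @MVT_segment R (@sin R) (@cos R) 0 x x0
  (fun y _ => is_derive_sin y) (continuous_subspaceT (@continuous_sin R)).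
by rewrite sin0 !subr0 => ->; exists c; rewrite // -in_itv.
Qed.

Lemma sin_le_id x : 0 <= x -> sin x <= x.
Proof. by move=> x0; have [c _ ->] := sin_cos_mul x0; rewrite ler_piMl ?cos_le1. Qed.

Lemma one_sub_cos x : 1 - cos x <= x ^+ 2 / 2.
Proof.
have H y : 0 <= y -> 1 - cos y <= y ^+ 2 / 2.
  move=> y0; have -> : y = (y / 2) *+ 2 by rewrite -mulr_natr; lra.
  rewrite cos_mulr2n; have := cos2Dsin2 (y / 2).
  have : sin (y / 2) ^+ 2 <= (y / 2) ^+ 2.
    rewrite -[leLHS]real_normK ?num_real // -[leRHS]real_normK ?num_real //.
    rewrite lerXn2r ?nnegrE ?normr_ge0 // (ger0_norm (x := y / 2)) ?divr_ge0 //.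
    case: (leP (y / 2) 1) => h1; last by apply: le_trans (ltW h1); exact: sin_max.
    rewrite ger0_norm ?sin_le_id ?divr_ge0 // sin_ge0_pi // divr_ge0 //=.
    by have := pi_ge2 R; lra.
  by rewrite -mulr_natr; nra.
case: (lerP 0 x) => hx; first exact: H.
by rewrite -cosN -sqrrN H; lra.
Qed.

(** A weak Jordan inequality. The split at 1 works because [sin] increases on [[1, pi / 2]], where
    [x / 4 < 1 / 2 <= sin 1]. *)
Lemma sin_ge_quarter x : 0 <= x -> x <= pi / 2 -> x / 4 <= sin x.
Proof.
move=> x0 xp; have p2 := pihalf_lt2 R; have p1 := pihalf_ge1 R.
have small y : 0 <= y -> y <= 1 -> y / 2 <= sin y.
  move=> y0 y1; have [c /andP[c0 cy] ->] := sin_cos_mul y0; have := one_sub_cos c => hc.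
  by have : c ^+ 2 <= 1 by [nra]; nra.
case: (leP x 1) => x1; first by have := small x x0 x1; lra.
have : sin 1 <= sin x.
  by rewrite le_eqVlt ltr_sin ?x1 ?orbT // in_itv /=; lra.
by have := small 1 ler01 (lexx _); lra.
Qed.

(** Multiplication by [2 * sin (a / 2)] makes the sum telescope. *)
Lemma cos_sum_bound m n a w :
  `|\sum_(m <= k < n) cos (k%:R * a + w)| * `|sin (a / 2)| <= 1.
Proof.
case: (leqP n m) => [nm|mn]; first by rewrite big_geq // normr0 mul0r.
have tel : (\sum_(m <= k < n) cos (k%:R * a + w)) * (2 * sin (a / 2)) =
   sin (n%:R * a + w - a / 2) - sin (m%:R * a + w - a / 2).
  rewrite mulr_suml (telescope_sumr_eq (fun k => sin (k%:R * a + w - a / 2))) ?(ltnW mn) //.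
  move=> k _; set y := k%:R * a + w.
  have -> : k.+1%:R * a + w - a / 2 = y + a / 2 by rewrite /y -natr1; lra.
  by rewrite sinD sinB; ring.
rewrite -normrM -(ler_pM2r (ltr0n R 2)) mul1r -[X in _ * X](normr_nat R 2) -normrM.
rewrite -mulrA [sin _ * _]mulrC tel.
by apply: le_trans (ler_normB _ _) _; rewrite -[2%:R]/(1 + 1) lerD ?sin_max.
Qed.

(** The left side is the squared real part of [e^(iw) sum c_j e^(i f_j)], the right side its squared
    modulus. *)
Lemma quad_form (I : Type) (r : seq I) (c f : I -> R) w :
  (\sum_(i <- r) c i * cos (f i + w)) ^+ 2
  <= \sum_(i <- r) \sum_(j <- r) c i * c j * cos (f i - f j).
Proof.
set C := \sum_(i <- r) c i * cos (f i); set S := \sum_(i <- r) c i * sin (f i).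
have -> : \sum_(i <- r) c i * cos (f i + w) = C * cos w - S * sin w.
  by rewrite /C /S !mulr_suml -sumrB; apply: eq_bigr => i _; rewrite cosD; ring.
have -> : \sum_(i <- r) \sum_(j <- r) c i * c j * cos (f i - f j) = C ^+ 2 + S ^+ 2.
  rewrite !expr2 /C /S !mulr_suml -big_split /=; apply: eq_bigr => i _.
  rewrite !mulr_sumr -big_split /=; apply: eq_bigr => j _.
  by rewrite cosB; ring.
by have := cos2Dsin2 w; have := sqr_ge0 (C * sin w + S * cos w); nra.
Qed.

Lemma cosD2pin x n : cos (x + 2 * pi * n%:R) = cos x.
Proof.
have -> : x + 2 * pi * n%:R = x + (pi *+ 2) *+ n by rewrite -(mulr_natr (pi *+ 2)) -(mulr_natr pi); ring.
exact: (periodicn (@cosD2pi R)).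
Qed.

Lemma norm_sinDpin x n : `|sin (x + pi * n%:R)| = `|sin x|.
Proof.
elim: n => [|n IHn]; first by rewrite mulr0 addr0.
by rewrite -natr1 mulrDr mulr1 addrA sinDpi normrN.
Qed.

Lemma sin_rat_ge b r : (0 < r < b)%N ->
  (minn r (b - r))%:R / (2 * b%:R) <= `|sin (pi * (r%:R / b%:R))| :> R.
Proof.
move=> /andP[r0 rb]; have b0 : 0 < b%:R :> R by rewrite ltr0n; lia.
have H s : (0 < s)%N -> (2 * s <= b)%N -> s%:R / (2 * b%:R) <= `|sin (pi * (s%:R / b%:R))| :> R.
  move=> s0 sb; have sb' : s%:R / b%:R <= 1 / 2 :> R.
    by rewrite ler_pdivrMr // mulrC mul1r ler_pdivlMr // -natrM ler_nat mulnC.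
  have s0' : 0 <= s%:R / b%:R :> R by rewrite divr_ge0.
  apply: le_trans (ler_norm _).
  have := @sin_ge_quarter (pi * (s%:R / b%:R)).
  have := pi_ge2 R; have := pi_ge0 R.
  move=> p0 p2 h; apply: le_trans (h _ _); last 2 first.
  - exact: mulr_ge0.
  - by nra.
  have -> : s%:R / (2 * b%:R) = 2 * (s%:R / b%:R) / 4 :> R.
    by rewrite invfM; field; rewrite gt_eqF.
  by rewrite !ler_wpM2r // invr_ge0.
case: (leqP (2 * r) b) => hb.
  by have -> : minn r (b - r) = r by [lia]; apply: H.
have -> : minn r (b - r) = (b - r)%N by lia.
have -> : `|sin (pi * (r%:R / b%:R))| = `|sin (pi * ((b - r)%:R / b%:R))| :> R.
  rewrite natrB ?(ltnW rb) // mulrBl divff ?gt_eqF // mulrBr mulr1.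
  rewrite -[in RHS]normrN -sinN opprB -[in RHS](norm_sinDpin _ 1) mulr1 subrK //.
by apply: H; lia.
Qed.

End Trig.

(** * Logarithmic sums *)
Section Logs.
Variable R : realType.
Implicit Types (n d m k : nat).

Lemma ln_diff_le n : (0 < n)%N -> ln n.+1%:R - ln n%:R <= n%:R^-1 :> R.
Proof.
move=> n0; have n0' : 0 < n%:R :> R by rewrite ltr0n.
rewrite -ln_div ?posrE ?ltr0n // -natr1 mulrDl mul1r divff ?gt_eqF //.
by apply: le_ln1Dx; rewrite (lt_trans (ltrN10 _)) // invr_gt0.
Qed.

Lemma ln_diff_ge n : (0 < n)%N -> n.+1%:R^-1 <= ln n.+1%:R - ln n%:R :> R.
Proof.
move=> n0; have n0' : 0 < n%:R :> R by rewrite ltr0n.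
rewrite -opprB lerNr -ln_div ?posrE ?ltr0n //.
have -> : n%:R / n.+1%:R = 1 + (- n.+1%:R^-1) :> R.
  by rewrite -[X in X / _](addrK 1) natr1 mulrDl divff ?pnatr_eq0 // mulN1r.
by apply: le_ln1Dx; rewrite ltrN2 invf_lt1 ?ltr0n // ltr1n.
Qed.

Definition harm n : R := \sum_(1 <= k < n.+1) k%:R^-1.

Lemma harmS n : harm n.+1 = harm n + n.+1%:R^-1.
Proof. by rewrite /harm big_nat_recr. Qed.

Lemma harm_ge n : ln n.+1%:R <= harm n.
Proof.
elim: n => [|n IHn]; first by rewrite ln1 /harm big_geq.
by rewrite harmS -[leLHS](subrK (ln n.+1%:R)) addrC lerD // ln_diff_le.
Qed.

Lemma harm_le n : (0 < n)%N -> harm n <= 1 + ln n%:R.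
Proof.
elim: n => // -[|n] IHn _; first by rewrite /harm big_nat1 invr1 ln1 addr0.
rewrite harmS -[in leRHS](subrK (ln n.+1%:R) (ln n.+2%:R)) addrCA addrC lerD ?IHn //.
by rewrite ln_diff_ge.
Qed.

Definition sumln n : R := \sum_(1 <= k < n.+1) ln k%:R.

Lemma sumlnS n : sumln n.+1 = sumln n + ln n.+1%:R.
Proof. by rewrite /sumln big_nat_recr. Qed.

Lemma sumln_ge n : n%:R * ln n%:R - n%:R <= sumln n.
Proof.
elim: n => [|[|n] IHn]; first by rewrite /sumln big_geq // mul0r subrr.
  rewrite sumlnS /sumln big_geq // ln1; lra.
rewrite sumlnS; have := @ln_diff_le n.+1 isT; have n0 : 0 < n.+1%:R :> R by rewrite ltr0n.
rewrite -(ler_pM2l n0) divff ?gt_eqF // => H.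
by move: IHn; rewrite -[n.+2%:R]natr1 in H *; lra.
Qed.

Lemma sumln_vonM n : sumln n = \sum_(1 <= d < n.+1) vonM R d * (n %/ d)%:R.
Proof.
transitivity (\sum_(1 <= k < n.+1) \sum_(1 <= d < n.+1 | (d %| k)%N) vonM R d).
  apply: eq_big_nat => k /andP[k0 kn]; rewrite -sum_vonM //.
  exact: sum_divisors_range.
rewrite (sum_dvd_swap (fun d _ => vonM R d)); apply: eq_bigr => d _.
by rewrite sumr_const_nat subn1 /= mulr_natr.
Qed.

Definition psi n : R := \sum_(1 <= d < n.+1) vonM R d.

Lemma psi_le m n : (m <= n)%N -> psi m <= psi n.
Proof.
move=> mn; rewrite /psi (@big_cat_nat _ _ _ m.+1 1 n.+1) //= lerDl.
by apply: sumr_ge0 => d _; exact: vonM_ge0.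
Qed.

Lemma psi_double n : psi (2 * n) <= psi n + 2 * n%:R.
Proof.
have nn : (n < (2 * n).+1)%N by lia.
have l2 : ln 2 <= 1 :> R by have := @ln_sublinear R 2 (ltr0n _ 2); have := @le_ln1Dx R 1; rewrite -[2]/(1+1); lra.
have H : sumln (2 * n) - 2 * sumln n <= 2 * n%:R.
  elim: n {nn} => [|n IHn]; first by rewrite muln0 /sumln big_geq // !mulr0 subrr.
  have -> : (2 * n.+1 = (2 * n).+2)%N by lia.
  rewrite !sumlnS; have : ln (2 * n).+1%:R <= ln (2 * n).+2%:R :> R by apply: ln_nat_le.
  have : ln (2 * n).+2%:R = ln 2 + ln n.+1%:R :> R.
    by rewrite -lnM ?posrE ?ltr0n // -natrM; congr (ln _%:R); lia.
  by rewrite -[n.+1%:R]natr1; lra.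
have : \sum_(1 <= d < (2 * n).+1) vonM R d * ((2 * n) %/ d)%:R
     - 2 * \sum_(1 <= d < (2 * n).+1) vonM R d * (n %/ d)%:R
     >= psi (2 * n) - psi n.
  rewrite /psi (@big_cat_nat _ _ _ n.+1 1 (2 * n).+1) //=.
  rewrite [_ + _ - _]addrC addKr mulr_sumr -sumrB (@big_cat_nat _ _ _ n.+1 1 (2 * n).+1) //=.
  rewrite -[leLHS]add0r; apply: lerD.
    rewrite big_nat; apply: sumr_ge0 => d /andP[d0 dn].
    rewrite mulrCA -mulrBr mulr_ge0 ?vonM_ge0 // subr_ge0 -natrM ler_nat.
    by rewrite leq_divRL // -mulnA leq_mul2l leq_divM.
  apply: ler_sum_nat => d /andP[dn d2n].
  rewrite (divn_small dn) mulr0 mulr0 subr0 ler_peMr ?vonM_ge0 // ler1n.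
  by rewrite divn_gt0; lia.
have -> : \sum_(1 <= d < (2 * n).+1) vonM R d * (n %/ d)%:R = sumln n.
  rewrite sumln_vonM (@big_cat_nat _ _ _ n.+1 1 (2 * n).+1) //=.
  rewrite [X in _ + X]big_nat [X in _ + X]big1 ?addr0 // => d /andP[dn _].
  by rewrite divn_small // mulr0.
by rewrite -(sumln_vonM (2 * n)); move: H; lra.
Qed.

Lemma psi_bound n : psi n <= 4 * n%:R.
Proof.
elim/ltn_ind: n => n IHn; have [n2|n2] := leqP n 1.
  case: n n2 IHn => [|[|]] // _ _; first by rewrite /psi big_geq // mulr0.
  by rewrite /psi big_nat1 /vonM /=; lra.
(* Doubling gives [4m + 2m], and [3m <= 2n] for the upper half [m] of any [n >= 2]. *)
set m := uphalf n; have mn : (m < n)%N by rewrite /m; lia.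
have nm : (n <= 2 * m)%N by rewrite /m; lia.
apply: le_trans (psi_le nm) _; apply: le_trans (psi_double m) _.
have := IHn m mn; have : (3 * m%:R <= 2 * n%:R :> R); last by lra.
by rewrite -!natrM ler_nat /m; lia.
Qed.

Definition mert n : R := \sum_(1 <= d < n.+1) vonM R d / d%:R.

(** Mertens' estimate. This bound and the next compare [n * mert n] with [sumln n]; the floors
    [n %/ d] cost at most [psi n]. *)
Lemma mert_ge n : (0 < n)%N -> ln n%:R - 1 <= mert n.
Proof.
move=> n0; have n0' : 0 < n%:R :> R by rewrite ltr0n.
rewrite -(ler_pM2l n0'); apply: (@le_trans _ _ (sumln n)).
  by have := sumln_ge n; lra.
rewrite sumln_vonM /mert mulr_sumr; apply: ler_sum_nat => d /andP[d0 _].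
rewrite mulrCA ler_wpM2l ?vonM_ge0 // ler_pdivlMr ?ltr0n // -natrM ler_nat.
exact: leq_divM.
Qed.

Lemma mert_le n : (0 < n)%N -> mert n <= ln n%:R + 4.
Proof.
move=> n0; have n0' : 0 < n%:R :> R by rewrite ltr0n.
have T : sumln n <= n%:R * ln n%:R.
  have -> : n%:R * ln n%:R = \sum_(1 <= k < n.+1) ln n%:R :> R by rewrite sumr_const_nat subn1 mulr_natl.
  by apply: ler_sum_nat => k /andP[_ kn]; exact: ln_nat_le.
rewrite -(ler_pM2l n0'); apply: (@le_trans _ _ (sumln n + psi n)); last first.
  by have := psi_bound n; lra.
rewrite sumln_vonM /psi -big_split /mert mulr_sumr; apply: ler_sum_nat => d /andP[d0 _].
rewrite /= mulrCA -{3}[vonM R d]mulr1 -mulrDr ler_wpM2l ?vonM_ge0 // ler_pdivrMr ?ltr0n //.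
by rewrite natr1 -natrM ler_nat ltnW // ltn_ceil.
Qed.

End Logs.

(** * The Selberg sieve *)
Definition sqfree (n : nat) : bool := all (fun p => logn p n == 1%N) (primes n).

Lemma sqfree_square (n : nat) : (0 < n)%N ->
  exists m k, [/\ sqfree m, (0 < m)%N, (0 < k)%N & n = (m * (k * k))%N].
Proof.
elim/ltn_ind: n => n IHn n0; case: (boolP (sqfree n)) => [sq|].
  by exists n, 1%N; rewrite !muln1.
case/allPn => p pn /= lp; have : (1 < logn p n)%N by move: pn lp; rewrite -logn_gt0; lia.
move: (pn); rewrite mem_primes => /and3P[pp _ _] l1.
have : (p ^ 2 %| n)%N by rewrite pfactor_dvdn.
case/dvdnP => q E; have p1 := prime_gt1 pp.
have q0 : (0 < q)%N by move: n0; rewrite E; case: q {E}.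
have qn : (q < n)%N by rewrite E; rewrite ltn_Pmulr // (leq_trans p1) // leq_pmulr // lt0n; lia.
have [m [k [sm m0 k0 Eq]]] := IHn q qn q0.
exists m, (k * p)%N; split => //; first by rewrite muln_gt0 k0 prime_gt0.
by rewrite E Eq; lia.
Qed.

Lemma perm_divisors_rev (n : nat) : (0 < n)%N ->
  perm_eq [seq (n %/ d)%N | d <- divisors n] (divisors n).
Proof.
move=> n0; have inv d : (d %| n)%N -> (n %/ (n %/ d))%N = d.
  by move=> dn; rewrite divnA // mulKn.
apply: uniq_perm; last 2 first; rewrite ?divisors_uniq //.
  move=> d; rewrite -dvdn_divisors //; apply/mapP/idP => [[e]|dn].
    by rewrite -dvdn_divisors // => en ->; rewrite dvdn_div.
  by exists (n %/ d)%N; rewrite ?inv // -dvdn_divisors // dvdn_div.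
rewrite map_inj_in_uniq ?divisors_uniq // => d e; rewrite -!dvdn_divisors // => dn en E.
by rewrite -(inv d dn) E inv.
Qed.

Section Selberg.
Variable R : realType.
Implicit Types (n d m k z E : nat).

Lemma mu_sq n : mu R n * mu R n = (sqfree n)%:R.
Proof.
rewrite /mu -big_split /sqfree /=.
elim: (primes n) => [|p s IHs]; rewrite ?big_nil ?big_cons //= IHs.
by case: eqP => _; rewrite ?mulN1r ?mulrN1 ?opprK ?mul1r ?mul0r.
Qed.

Lemma sum_mu_quot n : (0 < n)%N -> \sum_(d <- divisors n) mu R (n %/ d) = (n == 1%N)%:R.
Proof.
by move=> n0; rewrite -sum_mu // -[RHS](perm_big _ (perm_divisors_rev n0)) big_map.
Qed.

(** Moebius inversion between [k] and [m] in the divisor lattice; it recovers the diagonal variables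
    [ys] from [lams]. *)
Lemma sum_mu_between z k m : (0 < k)%N -> (0 < m)%N -> (m <= z)%N ->
  \sum_(1 <= d < z.+1 | (k %| d)%N && (d %| m)%N) mu R (m %/ d) = (k == m)%:R.
Proof.
move=> k0 m0 mz; case: (boolP (k %| m)%N) => [/dvdnP[m' E]|km]; last first.
  rewrite big1 => [|d /andP[kd dm]]; last by rewrite (dvdn_trans kd dm) in km.
  by case: eqP => // E; rewrite E dvdnn in km.
have m'0 : (0 < m')%N by move: m0; rewrite E; case: m' {E}.
rewrite big_mkcondr /= (sum_multiples (fun d => if (d %| m)%N then mu R (m %/ d) else 0)) //.
rewrite -big_mkcond E /= (eq_bigl (fun e => e %| m')%N); last by move=> e; rewrite mulnC dvdn_pmul2r.
rewrite (eq_bigr (fun e => mu R (m' %/ e))); last by move=> e _; rewrite mulnC divnMl.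
rewrite -(sum_divisors_range (fun d => mu R (m' %/ d))) ?leq_divRL -?E // sum_mu_quot //.
by congr (_%:R); rewrite E; case: m' m'0 {E} => [|[|m']] // _; rewrite ?mul1n ?eqxx //=; lia.
Qed.

(* Selberg's sieve of level [z] restricted to divisors coprime to [E]: [lams]
   are the optimal weights, and the form [sum lam lam / lcm] takes the value
   [1 / Gs]. *)
Definition Gs E z : R := \sum_(1 <= m < z.+1 | coprime m E && sqfree m) m%:R^-1.

Definition ys E z m : R := mu R m / (Gs E z * m%:R).

Definition lams E z d : R :=
  d%:R * \sum_(1 <= m < z.+1 | coprime m E && (d %| m)%N) mu R (m %/ d) * ys E z m.

Lemma Gs_ge1 E z : (0 < z)%N -> 1 <= Gs E z.
Proof.
move=> z0; rewrite /Gs big_ltn_cond // coprime1n /= invr1 lerDl.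
by apply: sumr_ge0 => m _; rewrite invr_ge0.
Qed.

Lemma lams1 E z : (0 < z)%N -> lams E z 1 = 1.
Proof.
move=> z0; have G0 : Gs E z != 0 by rewrite gt_eqF // (lt_le_trans ltr01) // Gs_ge1.
rewrite /lams mul1r -[RHS](divff G0) {2}/Gs mulr_suml big_mkcondr /=.
rewrite [RHS]big_mkcondr /= big_nat_cond [RHS]big_nat_cond.
apply: eq_bigr => m /andP[/andP[m0 _] _]; rewrite dvd1n divn1 /ys mulrA mu_sq.
by case: sqfree; rewrite ?mul0r // mul1r invfM mulrC.
Qed.

Lemma sum_ys E z : (0 < z)%N ->
  \sum_(1 <= m < z.+1 | coprime m E) `|ys E z m| = 1.
Proof.
move=> z0; rewrite -[RHS](lams1 E z0) /lams mul1r.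
under [RHS]eq_bigl do rewrite dvd1n andbT.
have G0 : 0 < Gs E z by rewrite (lt_le_trans ltr01) // Gs_ge1.
apply: eq_bigr => m _; rewrite divn1 /ys normrM [RHS]mulrA mu_sq.
rewrite (ger0_norm (x := (Gs E z * m%:R)^-1)) ?invr_ge0 ?mulr_ge0 ?(ltW G0) //; congr (_ * _).
rewrite /mu normr_prod /sqfree.
elim: (primes m) => [|p s IHs]; rewrite ?big_nil ?big_cons //= IHs.
by case: eqP => _; rewrite ?normrN1 ?mul1r ?normr0 ?mul0r.
Qed.

(** A crude bound, but what it loses is a power of the level [z], which stays small against the
    length of a block. *)
Lemma lams_le E z d : (0 < z)%N -> `|lams E z d| <= d%:R.
Proof.
move=> z0; rewrite /lams normrM normr_nat -[leRHS]mulr1 ler_wpM2l //.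
apply: le_trans (ler_norm_sum _ _ _) _; rewrite -(sum_ys E z0) big_mkcondr /=.
by apply: ler_sum => m _; case: ifP => _; rewrite ?normr_ge0 // normrM ler_piMl // mu_norm.
Qed.

Lemma lams_neq0 E z d : lams E z d != 0 -> (d <= z)%N /\ coprime d E.
Proof.
move=> H; have : exists2 m, (0 < m <= z)%N & coprime m E && (d %| m)%N.
  apply: contrapT => N; move: H; rewrite /lams big_nat_cond big1 ?mulr0 ?eqxx // => m /andP[hm hc].
  by exfalso; apply: N; exists m.
case=> m /andP[m0 mz] /andP[cm dm]; split; first exact: leq_trans (dvdn_leq m0 dm) mz.
exact: coprime_dvdl dm cm.
Qed.

Lemma sum_lams E z k : (0 < k)%N -> (k <= z)%N ->
  \sum_(1 <= d < z.+1 | (k %| d)%N) lams E z d / d%:R = (coprime k E)%:R * ys E z k.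
Proof.
move=> k0 kz.
transitivity (\sum_(1 <= d < z.+1 | (k %| d)%N) \sum_(1 <= m < z.+1 | coprime m E && (d %| m)%N)
   mu R (m %/ d) * ys E z m).
  rewrite big_nat_cond [RHS]big_nat_cond; apply: eq_bigr => d /andP[/andP[d0 _] _].
  by rewrite /lams mulrAC divff ?mul1r // pnatr_eq0; lia.
rewrite (exchange_big_dep_nat (fun m => coprime m E)) //=; last by move=> ? ? _ _ _ /andP[].
transitivity (\sum_(1 <= m < z.+1 | coprime m E) (k == m)%:R * ys E z m).
  rewrite big_nat_cond [RHS]big_nat_cond; apply: eq_bigr => m /andP[/andP[m0 mz] cm].
  rewrite -(@sum_mu_between z) // mulr_suml; apply: eq_bigl => d.
  by rewrite cm.
rewrite big_mkcond (bigD1_seq k) ?mem_index_iota ?iota_uniq ?k0 //= eqxx mul1r.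
rewrite big1 ?addr0 => [|m mk]; first by case: coprime; rewrite ?mul1r ?mul0r.
by rewrite eq_sym (negbTE mk) mul0r if_same.
Qed.

Lemma sum_totient n : (0 < n)%N -> \sum_(d <- divisors n) totient d = n.
Proof.
move=> n0; rewrite (@sum_divisors_range _ _ n n) // -[RHS]sum_totient_dvd.
by rewrite -(big_mkord (fun d => d %| n)%N totient) [RHS]big_ltn_cond //= dvd0n gtn_eqF.
Qed.

Lemma totient_leq n : (totient n <= n)%N.
Proof.
rewrite totient_count_coprime -[leqRHS](subn0 n) -[leqRHS]muln1 -sum_nat_const_nat.
by apply: leq_sum => i _; exact: leq_b1.
Qed.

(** Selberg's diagonalization: [1 / lcm] is [gcd / (d e)], and the gcd is the sum of the totients of
    the common divisors. *)
Lemma lcm_form (u : nat -> R) z :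
  \sum_(1 <= d < z.+1) \sum_(1 <= e < z.+1) u d * u e / (lcmn d e)%:R
  = \sum_(1 <= k < z.+1) (totient k)%:R * (\sum_(1 <= d < z.+1 | (k %| d)%N) u d / d%:R) ^+ 2.
Proof.
transitivity (\sum_(1 <= d < z.+1) \sum_(1 <= e < z.+1) \sum_(1 <= k < z.+1 | (k %| d)%N && (k %| e)%N)
  (totient k)%:R * ((u d / d%:R) * (u e / e%:R))).
  apply: eq_big_nat => d /andP[d0 dz]; apply: eq_big_nat => e /andP[e0 ez].
  have g0 : (0 < gcdn d e)%N by rewrite gcdn_gt0 d0.
  rewrite -mulr_suml; under eq_bigl do rewrite -dvdn_gcd.
  rewrite -natr_sum -(@sum_divisors_range _ _ (gcdn d e) z) //; last first.
    by apply: leq_trans (dvdn_leq d0 (dvdn_gcdl d e)) _.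
  rewrite sum_totient //.
  have : (gcdn d e)%:R * (lcmn d e)%:R = d%:R * e%:R :> R by rewrite -!natrM mulnC muln_lcm_gcd.
  have l0 : (lcmn d e)%:R != 0 :> R by rewrite pnatr_eq0 -lt0n lcmn_gt0 d0.
  have d0' : d%:R != 0 :> R by rewrite pnatr_eq0 -lt0n.
  have e0' : e%:R != 0 :> R by rewrite pnatr_eq0 -lt0n.
  move=> H; have -> : (gcdn d e)%:R = d%:R * e%:R / (lcmn d e)%:R :> R by rewrite -H mulfK.
  by field; rewrite l0 d0' e0'.
transitivity (\sum_(1 <= d < z.+1) \sum_(1 <= k < z.+1 | (k %| d)%N) \sum_(1 <= e < z.+1 | (k %| e)%N)
  (totient k)%:R * ((u d / d%:R) * (u e / e%:R))).
  apply: eq_bigr => d _; rewrite (exchange_big_dep_nat (fun k => (k %| d)%N)) //=; last by move=> ? ? _ _ _ /andP[].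
  by apply: eq_bigr => k kd; apply: eq_bigl => e; rewrite kd.
rewrite (exchange_big_dep_nat xpredT) //=; apply: eq_big_nat => k /andP[k0 kz].
rewrite expr2 mulr_suml mulr_sumr; apply: eq_bigr => d kd.
by rewrite !mulr_sumr.
Qed.

(** After diagonalization the terms are [totient k * ys k ^ 2]; with [totient k <= k] they are at
    most [1 / k], summed over the range of [Gs] and divided by [Gs ^ 2]. *)
Lemma selberg_form E z : (0 < z)%N ->
  \sum_(1 <= d < z.+1) \sum_(1 <= e < z.+1) lams E z d * lams E z e / (lcmn d e)%:R
  <= (Gs E z)^-1.
Proof.
move=> z0; have G0 : 0 < Gs E z by rewrite (lt_le_trans ltr01) // Gs_ge1.
rewrite lcm_form.
have G0' : Gs E z != 0 by rewrite gt_eqF.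
rewrite -[leRHS]mulr1 -[X in _ * X](divff G0').
rewrite {2}/Gs !mulr_suml mulr_sumr [leRHS]big_mkcond; apply: ler_sum_nat => k /andP[k0 kz].
rewrite sum_lams //.
have k0' : 0 < k%:R :> R by rewrite ltr0n.
case: (boolP (coprime k E)) => /= ck; last by rewrite mul0r expr0n mulr0.
rewrite mul1r /ys exprMn expr2 mu_sq; case: sqfree; rewrite /= ?mul0r ?mulr0 // mul1r.
apply: (@le_trans _ _ (k%:R * ((Gs E z * k%:R)^-1 ^+ 2))).
  by rewrite ler_wpM2r ?exprn_ge0 ?invr_ge0 ?mulr_ge0 ?(ltW G0) ?(ltW k0') // ler_nat totient_leq.
by rewrite le_eqVlt; apply/orP; left; apply/eqP; field; rewrite (gt_eqF G0) (gt_eqF k0').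
Qed.

End Selberg.

(** * Lower bound for the mass of the sieve *)

Lemma sqfree_mulp (p m : nat) : prime p -> (0 < m)%N -> sqfree (p * m) ->
  sqfree m /\ ~~ (p %| m)%N.
Proof.
move=> pp m0 /allP sq; have p0 := prime_gt0 pp.
have pm : ~~ (p %| m)%N.
  have /eqP : logn p (p * m) == 1%N by apply: sq; rewrite mem_primes pp muln_gt0 p0 m0 dvdn_mulr.
  by rewrite lognM // logn_prime // eqxx lognE pp m0 /=; case: ifP.
split=> //; apply/allP => q qm; have := qm; rewrite mem_primes => /and3P[qp _ qd].
have : logn q (p * m) == 1%N by apply: sq; rewrite mem_primes qp muln_gt0 p0 m0 dvdn_mull.
have qp' : q != p by apply: contraNneq pm => <-.
by rewrite lognM // logn_prime // (negbTE qp') add0n.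
Qed.

(** Bounds the number of primes dividing a denominator, hence the cost of excluding these primes
    from the sieve. *)
Lemma expn_size_primes (n : nat) : (0 < n)%N -> (2 ^ size (primes n) <= n)%N.
Proof.
move=> n0; rewrite {2}(prod_prime_decomp n0) prime_decompE big_map /=.
have : forall p, p \in primes n -> (2 <= p ^ logn p n)%N.
  move=> p pn; have := pn; rewrite mem_primes => /and3P[pp _ _].
  apply: leq_trans (prime_gt1 pp) _; rewrite -{1}(expn1 p) leq_exp2l ?prime_gt1 //.
  by rewrite logn_gt0.
elim: (primes n) => [|p s IHs] H; first by rewrite big_nil.
rewrite big_cons /= expnS leq_mul // ?H ?mem_head //.
by apply: IHs => q qs; rewrite H // in_cons qs orbT.
Qed.

Section SieveMass.
Variable R : realType.
Implicit Types (n d m k z p E : nat).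

Lemma sum_inv_sq z : \sum_(1 <= k < z.+1) (k%:R * k%:R)^-1 <= 2 :> R.
Proof.
have : (0 < z)%N -> \sum_(1 <= k < z.+1) (k%:R * k%:R)^-1 <= 2 - z%:R^-1 :> R.
  elim: z => // -[|z] IHz _; first by rewrite big_nat1 mulr1 invr1; lra.
  rewrite big_nat_recr //=; have := IHz isT; set S := bigop _ _ _.
  have a0 : 0 < z.+1%:R :> R by rewrite ltr0n.
  have -> : z.+2%:R = z.+1%:R + 1 :> R by rewrite natr1.
  move: a0; set a := z.+1%:R => a0 H.
  apply: le_trans (lerD H (lexx _)) _.
  have -> : 2 - a^-1 + ((a + 1) * (a + 1))^-1 = 2 - (a + 1)^-1 - (a * (a + 1) * (a + 1))^-1.
    by field; rewrite !gt_eqF //; lra.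
  rewrite gerBl invr_ge0 !mulr_ge0 //; lra.
case: z => [|z] H; first by rewrite big_geq.
by apply: le_trans (H isT) _; rewrite gerBl invr_ge0.
Qed.

(** [Gs] with coprimality expressed by a list of primes, so that the primes can be excluded one at a
    time. *)
Definition Gl (s : seq nat) z : R :=
  \sum_(1 <= m < z.+1 | all (fun p => ~~ (p %| m)%N) s && sqfree m) m%:R^-1.

(** Every [n] is [m k^2] with [m] squarefree, and the sum of [1 / k^2] is at most 2. *)
Lemma Gl_nil z : harm R z <= 2 * Gl [::] z.
Proof.
apply: (@le_trans _ _ (\sum_(1 <= n < z.+1) \sum_(1 <= m < z.+1 | sqfree m) \sum_(1 <= k < z.+1)
   (n == m * (k * k))%N%:R * (m%:R^-1 * (k%:R * k%:R)^-1))).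
  apply: ler_sum_nat => n /andP[n0 nz].
  have [m [k [sm m0 k0 E]]] := sqfree_square n0.
  have kk : (0 < k * k)%N by rewrite muln_gt0 k0.
  have mn : (m <= n)%N by rewrite E leq_pmulr.
  have kn : (k <= n)%N by rewrite E (leq_trans (leq_pmulr k k0)) // leq_pmull.
  have nn (a b c : nat) : 0 <= (a == b)%N%:R * (c%:R^-1) :> R by rewrite mulr_ge0 ?invr_ge0.
  rewrite (big_rem m) /= ?sm ?mem_index_iota ?m0 /=; last exact: leq_ltn_trans mn nz.
  rewrite (big_rem k) /= ?mem_index_iota ?k0 /=; last exact: leq_ltn_trans kn nz.
  rewrite -E eqxx mul1r -invfM -!natrM -E -addrA lerDl addr_ge0 //.
    by apply: sumr_ge0 => i _; rewrite -natrM -invfM -natrM.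
  by apply: sumr_ge0 => i _; apply: sumr_ge0 => j _; rewrite -natrM -invfM -natrM.
rewrite exchange_big /= /Gl mulr_sumr; apply: ler_sum => m _.
rewrite exchange_big /= mulrC.
apply: (@le_trans _ _ (\sum_(1 <= k < z.+1) m%:R^-1 * (k%:R * k%:R)^-1)); last first.
  by rewrite -mulr_sumr ler_wpM2l ?invr_ge0 // sum_inv_sq.
apply: ler_sum => k _; rewrite -mulr_suml ler_piMl ?mulr_ge0 ?invr_ge0 ?mulr_ge0 //.
rewrite -natr_sum lern1; set c := (m * (k * k))%N.
rewrite (eq_bigr (fun n => if n == c then 1%N else 0%N)); last by move=> n _; case: eqP.
by rewrite -big_mkcond sum1_count count_uniq_mem ?iota_uniq // leq_b1.
Qed.

(** A squarefree multiple of [p] is [p] times a squarefree number prime to [p]. *)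
Lemma Gl_cons p s z : prime p -> Gl s z <= (1 + p%:R^-1) * Gl (p :: s) z.
Proof.
move=> pp; have p0 := prime_gt0 pp; rewrite mulrDl mul1r /Gl (bigID (fun m => ~~ (p %| m)%N)) /=.
apply: lerD; first by rewrite le_eqVlt (eq_bigl (fun m => ~~ (p %| m)%N && all (fun p => ~~ (p %| m)%N) s && sqfree m)) ?eqxx // => m; rewrite andbC andbA.
rewrite (eq_bigl (fun m => (p %| m)%N && (all (fun p => ~~ (p %| m)%N) s && sqfree m))); last first.
  by move=> m; rewrite negbK andbC.
rewrite big_mkcondr (sum_multiples (fun m => if all (fun p => ~~ (p %| m)%N) s && sqfree m then m%:R^-1 else 0)) // mulr_sumr.
rewrite -big_mkcond /= [leRHS](@big_cat_nat _ _ _ (z %/ p).+1) //=; last by rewrite ltnS leq_div.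
rewrite -[leLHS]addr0 lerD //; last by apply: sumr_ge0 => m _; rewrite mulr_ge0 ?invr_ge0.
rewrite big_mkcond [leRHS]big_mkcond; apply: ler_sum_nat => m /andP[m0 _].
case: ifP => [/andP[al sq]|_]; last by case: ifP => // _; rewrite mulr_ge0 ?invr_ge0.
have [sm pm] := sqfree_mulp pp m0 sq.
rewrite sm pm /= (_ : all _ s) ?natrM ?invfM //.
by apply/allP => q qs; move/allP: al => /(_ q qs); apply: contra => /dvdn_mull; apply.
Qed.

(** The entry of index [i] is at least [i + 2], so the product is dominated by a telescoping one. *)
Lemma prod_primes_le (s : seq nat) : sorted ltn s -> all (fun p => (2 <= p)%N) s ->
  \prod_(p <- s) (1 + p%:R^-1) <= (size s + 2)%:R / 2 :> R.
Proof.
elim/last_ind: s => [|s p IHs]; first by rewrite big_nil ler_pdivlMr ?ltr0n // mul1r.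
rewrite -cats1 => srt; rewrite all_cat /= andbT => /andP[al p2].
have ss : sorted ltn s by move: srt => /cat_sorted2[].
rewrite big_cat big_seq1 /=.
have sp : (size s + 2 <= p)%N.
  have : (size s <= size (iota 2 (p - 2)))%N; last by rewrite size_iota; lia.
  apply: uniq_leq_size; first exact: sorted_uniq ltn_trans ltnn _ ss.
  move=> q qs; rewrite mem_iota; move/allP: al => /(_ q qs) q2.
  have : (q < p)%N; last by lia.
  move: srt; rewrite cats1 (sorted_pairwise ltn_trans) pairwise_rcons => /andP[/allP h _].
  exact: h.
apply: (@le_trans _ _ ((size s + 2)%:R / 2 * (1 + (size s + 2)%:R^-1))).
  apply: ler_pM; rewrite ?prodr_ge0 //; first by move=> q _; rewrite addr_ge0 ?invr_ge0.
  - by rewrite addr_ge0 ?invr_ge0.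
  - exact: IHs.
  - by rewrite lerD2l lef_pV2 ?posrE ?ltr0n ?ler_nat //; lia.
have a0 : (size s + 2)%:R != 0 :> R by rewrite pnatr_eq0; lia.
rewrite size_cat /= (_ : (size s + 1 + 2)%:R = (size s + 2)%:R + 1 :> R); last by rewrite natr1; congr _%:R; lia.
move: a0; move: ((size s + 2)%:R : R) => a a0.
by rewrite le_eqVlt; apply/orP; left; apply/eqP; field.
Qed.

Lemma Gl_lower (s : seq nat) z : all prime s ->
  harm R z <= 2 * \prod_(p <- s) (1 + p%:R^-1) * Gl s z.
Proof.
elim: s => [|p s IHs] /=; first by rewrite big_nil mulr1 Gl_nil.
move=> /andP[pp al]; apply: le_trans (IHs al) _; rewrite big_cons.
have : 0 <= \prod_(q <- s) (1 + q%:R^-1) :> R by apply: prodr_ge0 => q _; rewrite addr_ge0 ?invr_ge0.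
move: (\prod_(q <- s) _) => P P0; have := @Gl_cons p s z pp.
move: (Gl s z) (Gl (p :: s) z) (1 + _) => A B c H.
by have := ler_wpM2l (mulr_ge0 (ler0n R 2) P0) H; lra.
Qed.

Lemma Gs_lower E z : (0 < E)%N ->
  ln z.+1%:R <= (size (primes E) + 2)%:R * Gs R E z.
Proof.
move=> E0; apply: le_trans (harm_ge R z) _.
have al : all prime (primes E) by apply/allP => p; rewrite mem_primes => /andP[].
apply: le_trans (Gl_lower z al) _.
have -> : Gl (primes E) z = Gs R E z.
  rewrite /Gl /Gs big_nat_cond [RHS]big_nat_cond; apply: eq_bigl => m.
  case: (boolP (1 <= m < z.+1)%N) => //= /andP[m0 _]; congr andb.
  rewrite coprime_has_primes // -all_predC; apply: eq_in_all => p /=.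
  by rewrite [in RHS]mem_primes m0 mem_primes => /and3P[-> _ _].
apply: ler_wpM2r; first by apply: sumr_ge0 => m _; rewrite invr_ge0.
have := @prod_primes_le (primes E) (sorted_primes E).
have -> : all (fun p => (1 < p)%N) (primes E).
  by apply: sub_all al => p; exact: prime_gt1.
by move=> /(_ isT); lra.
Qed.

End SieveMass.

(** * A Vaughan-type identity *)
Section Identity.
Variable R : realType.
Implicit Types (n d m k x K : nat) (f : nat -> R).

(* Equal to [1] at [n = 1] and to [0] for [1 < n <= K]; hence in
   [vaughan_identity] the term [n = 1] is the sum over primes and the others,
   collected in [hsum], have [n > K]. *)
Definition MK K n : R := \sum_(1 <= k < K.+1 | (k %| n)%N) mu R k.

Lemma MK1 K : (0 < K)%N -> MK K 1 = 1.
Proof.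
move=> K0; rewrite /MK big_ltn_cond //= mu1 big_nat_cond big1 ?addr0 // => k /andP[/andP[k1 _]].
by rewrite dvdn1 => /eqP E; rewrite E in k1.
Qed.

Lemma MK_small K n : (1 < n)%N -> (n <= K)%N -> MK K n = 0.
Proof.
move=> n1 nK; rewrite /MK -(@sum_divisors_range _ _ n K) //; last exact: ltnW.
by rewrite sum_mu 1?ltnW // gtn_eqF.
Qed.

Definition tauK K n : R := \sum_(1 <= k < K.+1 | (k %| n)%N) 1.

Lemma MK_le K n : `|MK K n| <= tauK K n.
Proof.
by rewrite /MK /tauK; apply: le_trans (ler_norm_sum _ _ _) _; apply: ler_sum => k _; exact: mu_norm.
Qed.

Lemma sum_MK K y f :
  \sum_(1 <= n < y.+1) MK K n * f n
  = \sum_(1 <= k < K.+1) mu R k * \sum_(1 <= l < (y %/ k).+1) f (k * l)%N.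
Proof.
transitivity (\sum_(1 <= k < K.+1) \sum_(1 <= n < y.+1 | (k %| n)%N) mu R k * f n).
  under eq_bigr => n _ do rewrite /MK mulr_suml.
  by rewrite (exchange_big_dep_nat xpredT).
by apply: eq_big_nat => k /andP[k0 _]; rewrite sum_multiples // mulr_sumr.
Qed.

Lemma sum_tauK K y : \sum_(1 <= n < y.+1) tauK K n <= y%:R * harm R K.
Proof.
rewrite /tauK (exchange_big_dep_nat xpredT) //= /harm mulr_sumr.
apply: ler_sum_nat => k /andP[k0 _]; rewrite sum_multiples // sumr_const_nat subn1 /=.
by rewrite ler_pdivlMr ?ltr0n // -natrM ler_nat leq_divM.
Qed.

(** Both sides are the sum of [mu(k) Lambda(d) f(k d l)] over [k <= K] and [k d l <= x]: the left
    one expands [ln m] over divisors, the right one groups [n = k l]. *)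
Lemma vaughan_identity K x f :
  \sum_(1 <= k < K.+1) mu R k * \sum_(1 <= m < (x %/ k).+1) ln m%:R * f (k * m)%N
  = \sum_(1 <= d < x.+1) vonM R d * \sum_(1 <= n < (x %/ d).+1) MK K n * f (d * n)%N.
Proof.
transitivity (\sum_(1 <= k < K.+1) \sum_(1 <= d < x.+1)
    mu R k * (vonM R d * \sum_(1 <= l < (x %/ k %/ d).+1) f (k * (d * l))%N)).
  apply: eq_big_nat => k /andP[k0 _]; rewrite -mulr_sumr; congr (_ * _).
  transitivity (\sum_(1 <= m < (x %/ k).+1) \sum_(1 <= d < (x %/ k).+1 | (d %| m)%N)
     vonM R d * f (k * m)%N).
    apply: eq_big_nat => m /andP[m0 mx]; rewrite -mulr_suml; congr (_ * _).
    by rewrite -sum_vonM // (@sum_divisors_range _ _ m (x %/ k)).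
  rewrite (sum_dvd_swap (fun d m => vonM R d * f (k * m)%N)).
  have xk : ((x %/ k).+1 <= x.+1)%N by rewrite ltnS leq_div.
  rewrite [RHS](@big_cat_nat _ _ _ (x %/ k).+1) //= [X in _ = _ + X]big_nat.
  rewrite [X in _ = _ + X]big1 ?addr0; last first.
    by move=> d /andP[dx _]; rewrite (@divn_small (x %/ k)) // big_geq // mulr0.
  by apply: eq_bigr => d _; rewrite mulr_sumr.
rewrite exchange_big /=; apply: eq_bigr => d _; rewrite sum_MK mulr_sumr.
apply: eq_big_nat => k /andP[k0 _]; rewrite mulrCA; congr (_ * (_ * _)).
by rewrite -!divnMA (mulnC k d); apply: eq_bigr => l _; rewrite mulnCA.
Qed.

Definition hsum K x f d : R := \sum_(K.+1 <= n < (x %/ d).+1) MK K n * f (d * n)%N.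

Lemma hsum_eq K x f d : (0 < K)%N -> (0 < d)%N -> (d <= x)%N ->
  \sum_(1 <= n < (x %/ d).+1) MK K n * f (d * n)%N = f d + hsum K x f d.
Proof.
move=> K0 d0 dx; have q0 : (0 < x %/ d)%N by rewrite divn_gt0.
rewrite big_ltn // MK1 // mul1r muln1; congr (_ + _).
have z1 n : (1 < n <= K)%N -> MK K n * f (d * n)%N = 0.
  by move=> /andP[n1 nK]; rewrite MK_small // mul0r.
case: (leqP K.+1 (x %/ d).+1) => h.
  rewrite (@big_cat_nat _ _ _ K.+1 2 (x %/ d).+1) //=.
  have -> : \sum_(2 <= n < K.+1) MK K n * f (d * n)%N = 0; last by rewrite add0r.
  by rewrite big_nat big1 // => n /andP[n1 nK]; apply: z1; rewrite n1.
rewrite /hsum [RHS]big_geq; last exact: ltnW.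
by rewrite big_nat big1 // => n /andP[n1 nx]; apply: z1; rewrite n1 -ltnS (ltn_trans nx).
Qed.

Lemma vonM_sum_split K x f : (0 < K)%N ->
  \sum_(1 <= d < x.+1) vonM R d * f d
  = \sum_(1 <= k < K.+1) mu R k * (\sum_(1 <= m < (x %/ k).+1) ln m%:R * f (k * m)%N)
    - \sum_(1 <= d < x.+1) vonM R d * hsum K x f d.
Proof.
move=> K0; rewrite vaughan_identity -sumrB; apply: eq_big_nat => d /andP[d0 dx].
by rewrite hsum_eq // mulrDr addrK.
Qed.

Lemma hsum_le K x f d : (0 < d)%N -> (forall n, `|f n| <= 1) ->
  `|hsum K x f d| <= x%:R / d%:R * harm R K.
Proof.
move=> d0 f1; apply: le_trans (ler_norm_sum _ _ _) _.
apply: (@le_trans _ _ (\sum_(1 <= n < (x %/ d).+1) tauK K n)).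
  apply: (@le_trans _ _ (\sum_(K.+1 <= n < (x %/ d).+1) tauK K n)).
    apply: ler_sum => n _; rewrite normrM.
    by apply: le_trans (MK_le K n); rewrite ler_piMr.
  case: (leqP K.+1 (x %/ d).+1) => h; last first.
    by rewrite big_geq ?(ltnW h) //; apply: sumr_ge0 => n _; apply: sumr_ge0.
  rewrite [leRHS](@big_cat_nat _ _ _ K.+1) //= lerDr.
  by apply: sumr_ge0 => n _; apply: sumr_ge0.
apply: le_trans (sum_tauK _ _) _; rewrite ler_wpM2r //.
  by apply: sumr_ge0 => k _; rewrite invr_ge0.
by rewrite ler_pdivlMr ?ltr0n // -natrM ler_nat leq_divM.
Qed.

Lemma abel_bound (g c : nat -> R) (B : R) (i n : nat) : (i <= n)%N ->
  (forall m, (i <= m)%N -> g m <= g m.+1) ->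
  (forall j, `|\sum_(j <= m < n.+1) c m| <= B) ->
  `|\sum_(i <= m < n.+1) g m * c m - g i * \sum_(i <= m < n.+1) c m| <= (g n - g i) * B.
Proof.
move=> + gi cB; have [k kn] : exists k, k = (n - i)%N by exists (n - i)%N.
elim: k i kn gi => [|k IHk] i kn gi le_in.
  have -> : i = n by lia.
  by rewrite !big_nat1 subrr normr0 subrr mul0r.
rewrite !(@big_ltn _ _ _ i) ?ltnS // mulrDr opprD addrACA subrr add0r.
set S := \sum_(_ <= _ < _) _ * _; set T := \sum_(_ <= _ < _) _.
have -> : S - g i * T = (S - g i.+1 * T) + (g i.+1 - g i) * T by ring.
have -> : (g n - g i) * B = (g n - g i.+1) * B + (g i.+1 - g i) * B by ring.
apply: le_trans (ler_normD _ _) _; apply: lerD.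
  by apply: IHk => [|m im|]; [lia|apply: gi; lia|lia].
by rewrite normrM ger0_norm ?subr_ge0 ?gi // ler_wpM2l ?subr_ge0 ?gi // cB.
Qed.

Lemma sum_ln_bound (c : nat -> R) (B : R) y :
  (forall i j, `|\sum_(i <= m < j) c m| <= B) ->
  `|\sum_(1 <= m < y.+1) ln m%:R * c m| <= ln y%:R * B.
Proof.
case: y => [|y] cB; first by rewrite big_geq // normr0 ln0 // mul0r.
have := @abel_bound (fun m => ln m%:R) c B 1 y.+1 isT.
rewrite ln1 mul0r !subr0; apply => [m m1|j]; last exact: cB.
exact: ln_nat_le.
Qed.

End Identity.

(** * Sums over rational frequencies *)
Definition natdist (n m : nat) : nat := (n - m + (m - n))%N.

Section RatFreq.
Variable R : realType.
Implicit Types (a b n m k d l x K : nat) (w : R).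

Lemma sin_mod_rat b u : (0 < b)%N ->
  `|sin (pi * (u%:R / b%:R))| = `|sin (pi * ((u %% b)%:R / b%:R))| :> R.
Proof.
move=> b0; have b0' : b%:R != 0 :> R by rewrite pnatr_eq0; lia.
have -> : u%:R / b%:R = (u %% b)%:R / b%:R + (u %/ b)%:R :> R.
  by rewrite {1}(divn_eq u b) addnC natrD natrM mulrDl mulfK.
by rewrite mulrDr norm_sinDpin.
Qed.

Lemma sin_ndvd_ge b u : (0 < b)%N -> ~~ (b %| u)%N ->
  (2 * b%:R)^-1 <= `|sin (pi * (u%:R / b%:R))| :> R.
Proof.
move=> b0 bu; rewrite sin_mod_rat //; have rb := ltn_pmod u b0.
have r0 : (0 < u %% b)%N by rewrite lt0n.
apply: le_trans (sin_rat_ge R (_ : 0 < u %% b < b)%N); last by rewrite r0.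
rewrite -[leLHS]mul1r ler_wpM2r ?invr_ge0 ?mulr_ge0 // ler1n.
by rewrite leq_min r0 subn_gt0.
Qed.

Definition alpha a b : R := 2 * pi * (a%:R / b%:R).

Lemma cos_rat_sum a b l i j w : (0 < b)%N -> coprime a b -> ~~ (b %| l)%N ->
  `|\sum_(i <= m < j) cos (m%:R * (l%:R * alpha a b) + w)| <= 2 * b%:R.
Proof.
move=> b0 cab bl; have b0' : 0 < 2 * b%:R :> R by rewrite mulr_gt0 ?ltr0n.
have := cos_sum_bound i j (l%:R * alpha a b) w.
have -> : l%:R * alpha a b / 2 = pi * ((l * a)%:R / b%:R).
  by rewrite /alpha natrM; field; rewrite pnatr_eq0; lia.
have bla : ~~ (b %| l * a)%N by rewrite Gauss_dvdl // coprime_sym.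
have := sin_ndvd_ge b0 bla; set s := `|sin _| => sb.
rewrite -[s]invrK; have s0 : 0 < s by apply: lt_le_trans sb; rewrite invr_gt0.
rewrite ler_pdivrMr ?invr_gt0 // mul1r => H; apply: le_trans H _.
by rewrite -[leRHS]invrK lef_pV2 ?posrE ?invr_gt0.
Qed.

Definition cosw a b w n : R := cos (n%:R * alpha a b + w).

Lemma cosw_le1 a b w n : `|cosw a b w n| <= 1.
Proof. exact: cos_max. Qed.

Lemma cosw_sum_mul a b l i j w : (0 < b)%N -> coprime a b -> ~~ (b %| l)%N ->
  `|\sum_(i <= m < j) cosw a b w (l * m)| <= 2 * b%:R.
Proof.
move=> b0 cab bl; rewrite (eq_bigr (fun m => cos (m%:R * (l%:R * alpha a b) + w))).
  exact: cos_rat_sum.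
by move=> m _; rewrite /cosw natrM mulrA [m%:R * _]mulrC.
Qed.

(** Since [k <= K < b], no [k] is a multiple of [b], and every inner sum is a geometric sum with
    nontrivial ratio, weighted by [ln]. *)
Lemma typeI_bound a b w K x : (0 < b)%N -> coprime a b -> (K < b)%N ->
  `|\sum_(1 <= k < K.+1) mu R k * \sum_(1 <= m < (x %/ k).+1) ln m%:R * cosw a b w (k * m)|
  <= K%:R * (ln x%:R * (2 * b%:R)).
Proof.
move=> b0 cab Kb; apply: le_trans (ler_norm_sum _ _ _) _.
have -> : K%:R * (ln x%:R * (2 * b%:R)) = \sum_(1 <= k < K.+1) ln x%:R * (2 * b%:R) :> R.
  by rewrite sumr_const_nat subn1 mulr_natl.
apply: ler_sum_nat => k /andP[k0 kK]; rewrite normrM -[leRHS]mul1r.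
apply: ler_pM; rewrite ?mu_norm //.
apply: le_trans (sum_ln_bound _ (B := 2 * b%:R) _) _.
  move=> i j; apply: cosw_sum_mul => //; apply/negP => /(dvdn_leq k0).
  by rewrite leqNgt (leq_ltn_trans _ Kb).
by rewrite ler_wpM2r ?mulr_ge0 // ln_nat_le // leq_div.
Qed.

(** With the term [n = 1] added back, the sum splits by [sum_MK] into at most [K] progressions,
    whose differences [k * d] are not multiples of [b]. *)
Lemma hsum_small a b w K x d : (0 < b)%N -> coprime a b -> (0 < K)%N -> (0 < d)%N -> (d <= x)%N ->
  (forall k, (0 < k <= K)%N -> ~~ (b %| k * d)%N) ->
  `|hsum K x (cosw a b w) d| <= K%:R * (2 * b%:R) + 1.
Proof.
move=> b0 cab K0 d0 dx H; have := hsum_eq (cosw a b w) K0 d0 dx.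
move/eqP; rewrite addrC -subr_eq => /eqP <-.
apply: le_trans (ler_normB _ _) _; apply: lerD; last exact: cosw_le1.
rewrite (sum_MK K _ (fun n => cosw a b w (d * n))); apply: le_trans (ler_norm_sum _ _ _) _.
have -> : K%:R * (2 * b%:R) = \sum_(1 <= k < K.+1) (2 * b%:R) :> R.
  by rewrite sumr_const_nat subn1 mulr_natl.
apply: ler_sum_nat => k kK; rewrite normrM -[leRHS]mul1r; apply: ler_pM; rewrite ?mu_norm //.
under eq_bigr do rewrite mulnA (mulnC d).
by apply: cosw_sum_mul => //; apply: H.
Qed.

(* [n' + (b - 1) n] represents [n' - n] modulo [b] without subtraction. *)
Definition rho a b n n' : nat := ((n' + b.-1 * n) * a) %% b.

Lemma sin_rho a b n n' : (0 < b)%N ->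
  `|sin (pi * ((natdist n n' * a)%:R / b%:R))| = `|sin (pi * ((rho a b n n')%:R / b%:R))| :> R.
Proof.
move=> b0; have b0' : b%:R != 0 :> R by rewrite pnatr_eq0; lia.
rewrite /rho -sin_mod_rat //; case: (leqP n n') => h.
  have -> : ((n' + b.-1 * n) * a = natdist n n' * a + n * a * b)%N.
    rewrite /natdist (eqP (_ : n - n' == 0)%N) //; case: b b0 b0' => // b _ _ /=.
    have [k ->] : exists k, n' = (n + k)%N by exists (n' - n)%N; lia.
    by rewrite addKn; lia.
  have -> : (natdist n n' * a + n * a * b)%:R / b%:R = (natdist n n' * a)%:R / b%:R + (n * a)%:R :> R.
    by rewrite natrD (natrM _ (n * a)) mulrDl mulfK.
  by rewrite mulrDr norm_sinDpin.
have E : ((n' + b.-1 * n) * a + natdist n n' * a = n * a * b)%N.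
  rewrite /natdist (eqP (_ : n' - n == 0)%N) ?subn_eq0 ?(ltnW h) //; case: b b0 b0' => // b _ _ /=.
  have [k ->] : exists k, n = (n' + k)%N by exists (n - n')%N; lia.
  by rewrite addKn; lia.
have -> : ((n' + b.-1 * n) * a)%:R / b%:R = (n * a)%:R - (natdist n n' * a)%:R / b%:R :> R.
  by rewrite -[X in _ = X - _](mulfK b0') -mulrBl -natrM -E natrD addrK.
by rewrite mulrBr -[RHS]normrN -sinN opprB -[RHS](norm_sinDpin _ (n * a)) subrK.
Qed.

Lemma rho_eq0 a b n n' : (0 < b)%N -> coprime a b ->
  (rho a b n n' == 0%N) = (b %| natdist n n')%N.
Proof.
move=> b0 cab; rewrite /rho -/(b %| _)%N Gauss_dvdl 1?coprime_sym //.
case: (leqP n n') => h.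
  have -> : (n' + b.-1 * n = natdist n n' + n * b)%N.
    rewrite /natdist (eqP (_ : n - n' == 0)%N) //; case: b b0 cab => // b _ _ /=.
    have [k ->] : exists k, n' = (n + k)%N by exists (n' - n)%N; lia.
    by rewrite addKn; lia.
  by rewrite dvdn_addl // dvdn_mull.
have E : ((n' + b.-1 * n) + natdist n n' = n * b)%N.
  rewrite /natdist (eqP (_ : n' - n == 0)%N) ?subn_eq0 ?(ltnW h) //; case: b b0 cab => // b _ _ /=.
  have [k ->] : exists k, n = (n' + k)%N by exists (n - n')%N; lia.
  by rewrite addKn; lia.
have bn : (b %| (n' + b.-1 * n) + natdist n n')%N by rewrite E dvdn_mull.
by apply/idP/idP => h'; [rewrite -(dvdn_addr _ h') | rewrite -(dvdn_addl _ h')].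
Qed.

Lemma sum_residues (g : nat -> R) a b c s : (0 < b)%N -> coprime a b ->
  \sum_(s <= i < s + b) g (((i + c) * a) %% b)%N = \sum_(0 <= r < b) g r.
Proof.
move=> b0 cab; rewrite -(big_map (fun i => ((i + c) * a) %% b)%N xpredT g).
apply: perm_big; have U : uniq [seq (((i + c) * a) %% b)%N | i <- index_iota s (s + b)].
  rewrite map_inj_in_uniq ?iota_uniq // => i j; rewrite !mem_index_iota => hi hj /eqP E.
  have W i' j' : (s <= i' < s + b)%N -> (s <= j' < s + b)%N -> (i' <= j')%N ->
      ((i' + c) * a == (j' + c) * a %[mod b])%N -> i' = j'.
    move=> hi' hj' le; rewrite eq_sym eqn_mod_dvd ?leq_mul2r ?leq_add2r ?le ?orbT //.
    rewrite -mulnBl subnDr Gauss_dvdl 1?coprime_sym // => dv.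
    case: (posnP (j' - i')) => [|h]; first by lia.
    by have := dvdn_leq h dv; lia.
  case/orP: (leq_total i j) => le; first exact: W.
  by apply/esym/W => //; rewrite eq_sym.
apply: uniq_perm => //; first exact: iota_uniq.
apply: (@uniq_min_size _ _ _ U _ _).2.
  by move=> r /mapP[i _ ->]; rewrite mem_index_iota /= ltn_pmod.
by rewrite size_map !size_iota; lia.
Qed.

Lemma sum_residues_le (g : nat -> R) a b c s y : (0 < b)%N -> coprime a b ->
  (forall r, 0 <= g r) ->
  \sum_(s <= i < s + y) g (((i + c) * a) %% b)%N
  <= (y%:R / b%:R + 1) * \sum_(0 <= r < b) g r.
Proof.
move=> b0 cab g0; set G := \sum_(0 <= r < b) _.
have G0 : 0 <= G by apply: sumr_ge0.
have H q : \sum_(s <= i < s + q * b) g (((i + c) * a) %% b)%N = q%:R * G.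
  elim: q => [|q IHq]; first by rewrite addn0 big_geq // mul0r.
  rewrite (@big_cat_nat _ _ _ (s + q * b)) ?leq_addr //=; last by rewrite leq_add2l leq_mul2r leqnSn orbT.
  by rewrite IHq mulSnr addnA sum_residues // -natr1 mulrDl mul1r.
apply: (@le_trans _ _ ((y %/ b).+1%:R * G)).
  rewrite -H [leRHS](@big_cat_nat _ _ _ (s + y)) ?leq_addr //=.
    by rewrite lerDl; apply: sumr_ge0.
  by rewrite leq_add2l ltnW // ltn_ceil.
rewrite ler_wpM2r // -natr1 lerD2r ler_pdivlMr ?ltr0n // -natrM ler_nat.
exact: leq_divM.
Qed.

(** Schur's test, from [2 |c_i c_j| <= c_i^2 + c_j^2] and the symmetry of [g]. *)
Lemma sym_form_le (I : Type) (r : seq I) (c : I -> R) (g : I -> I -> R) :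
  (forall i j, 0 <= g i j) -> (forall i j, g i j = g j i) ->
  \sum_(i <- r) \sum_(j <- r) `|c i| * `|c j| * g i j
  <= \sum_(i <- r) c i ^+ 2 * \sum_(j <- r) g i j.
Proof.
move=> g0 gs; rewrite -(ler_pM2l (ltr0n R 2)).
have -> : 2%:R * \sum_(i <- r) c i ^+ 2 * \sum_(j <- r) g i j
    = \sum_(i <- r) \sum_(j <- r) (c i ^+ 2 + c j ^+ 2) * g i j.
  rewrite mulr_natl mulr2n.
  rewrite [X in _ + X](_ : _ = \sum_(i <- r) \sum_(j <- r) c j ^+ 2 * g i j); last first.
    rewrite exchange_big /=; apply: eq_bigr => i _; rewrite mulr_sumr.
    by apply: eq_bigr => j _; rewrite gs.
  rewrite -big_split /=; apply: eq_bigr => i _; rewrite mulr_sumr -big_split /=.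
  by apply: eq_bigr => j _; rewrite mulrDl.
rewrite mulr_sumr; apply: ler_sum => i _; rewrite mulr_sumr; apply: ler_sum => j _.
rewrite mulrA ler_wpM2r // -[c i ^+ 2]real_normK ?num_real // -[c j ^+ 2]real_normK ?num_real //.
by have := sqr_ge0 (`|c i| - `|c j|); nra.
Qed.

End RatFreq.

(** * Bilinear sums over a block, with sieve weights *)

Section Block.
Variable R : realType.
Implicit Types (a b n m k d l x K y z D U V E : nat) (w : R).

Lemma sum_multiples_itv (F : nat -> R) l D U : (0 < l)%N -> (D <= U)%N ->
  \sum_(D.+1 <= d < U.+1 | (l %| d)%N) F d
  = \sum_((D %/ l).+1 <= m < (U %/ l).+1) F (l * m)%N.
Proof.
move=> l0 DU; apply: (addrI (\sum_(1 <= d < D.+1 | (l %| d)%N) F d)).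
rewrite -(@big_cat_nat _ _ _ D.+1) ?ltnS //= !sum_multiples //.
by rewrite -(@big_cat_nat _ _ _ (D %/ l).+1) ?ltnS ?leq_div2r.
Qed.

Lemma sum_itv_minn (F : nat -> R) D V W :
  \sum_(D.+1 <= d < V.+1 | (d <= W)%N) F d = \sum_(D.+1 <= d < (minn V W).+1) F d.
Proof.
rewrite [RHS](@big_nat_widen _ _ _ _ _ V.+1) ?ltnS ?geq_minl //.
rewrite [LHS]big_nat_cond [RHS]big_nat_cond; apply: eq_bigl => d.
by rewrite !ltnS leq_min; case: (D < d)%N; case: (d <= V)%N; rewrite ?andbF ?andbT.
Qed.

Lemma cos_natdist a b d n n' :
  cos ((d * n)%:R * alpha R a b - (d * n')%:R * alpha R a b)
  = cos (d%:R * ((natdist n n')%:R * alpha R a b)).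
Proof.
rewrite -mulrBl !natrM -mulrBr -mulrA; case: (leqP n n') => h.
  have -> : natdist n n' = (n' - n)%N by rewrite /natdist; lia.
  by rewrite natrB // -[RHS]cosN; congr cos; ring.
have -> : natdist n n' = (n - n')%N by rewrite /natdist; lia.
by rewrite natrB // ltnW.
Qed.

Lemma natdistC n n' : natdist n n' = natdist n' n.
Proof. by rewrite /natdist addnC. Qed.

(** Expand the square and sum over [d] first. The range [n <= x / d] of [hsum] then becomes a cutoff
    of [d] at [min (x / n) (x / n')], which is why the hypothesis is required for every endpoint
    [U <= V]. *)
Lemma block_generic (s : nat -> R) (g : nat -> nat -> R) a b w K x y D V :
  (x %/ D.+1 <= y)%N -> (forall d, 0 <= s d) ->
  (forall n n', 0 <= g n n') -> (forall n n', g n n' = g n' n) ->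
  (forall n n' U, (U <= V)%N ->
     `|\sum_(D.+1 <= d < U.+1) s d * cos (d%:R * ((natdist n n')%:R * alpha R a b))| <= g n n') ->
  \sum_(D.+1 <= d < V.+1) s d * hsum K x (cosw a b w) d ^+ 2
  <= \sum_(K.+1 <= n < y.+1) MK R K n ^+ 2 * \sum_(K.+1 <= n' < y.+1) g n n'.
Proof.
move=> xy s0 g0 gs H.
apply: le_trans (_ : \sum_(K.+1 <= n < y.+1) \sum_(K.+1 <= n' < y.+1)
    `|MK R K n| * `|MK R K n'| * g n n' <= _); last first.
  exact: (sym_form_le _ (MK R K)).
apply: (@le_trans _ _ (\sum_(D.+1 <= d < V.+1) s d *
    \sum_(K.+1 <= n < y.+1 | (d <= x %/ n)%N) \sum_(K.+1 <= n' < y.+1 | (d <= x %/ n')%N)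
      MK R K n * MK R K n' * cos (d%:R * ((natdist n n')%:R * alpha R a b)))).
  apply: ler_sum_nat => d /andP[Dd dV]; apply: ler_wpM2l => //.
  have d0 : (0 < d)%N by apply: leq_trans Dd.
  have xdy : (x %/ d <= y)%N by apply: leq_trans xy; apply: leq_div2l.
  have E (F : nat -> R) : \sum_(K.+1 <= n < y.+1 | (d <= x %/ n)%N) F n
       = \sum_(K.+1 <= n < (x %/ d).+1) F n.
    rewrite [RHS](@big_nat_widen _ _ _ _ _ y.+1) ?ltnS //.
    rewrite [LHS]big_nat_cond [RHS]big_nat_cond; apply: eq_bigl => n.
    case: (boolP (K < n < y.+1)%N) => //= /andP[Kn _].
    by rewrite ltnS !leq_divRL ?(leq_ltn_trans _ Kn) // mulnC.
  rewrite E; under [leRHS]eq_bigr => n _ do rewrite E.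
  rewrite /hsum /cosw; apply: le_trans (quad_form _ _ _ w) _.
  rewrite le_eqVlt; apply/orP; left; apply/eqP.
  by apply: eq_bigr => n _; apply: eq_bigr => n' _; rewrite cos_natdist.
rewrite (_ : \sum_(D.+1 <= d < V.+1) _ = \sum_(K.+1 <= n < y.+1) \sum_(K.+1 <= n' < y.+1)
    MK R K n * MK R K n' * \sum_(D.+1 <= d < V.+1 | (d <= x %/ n)%N && (d <= x %/ n')%N)
      s d * cos (d%:R * ((natdist n n')%:R * alpha R a b))).
  apply: ler_sum => n _; apply: ler_sum => n' _.
  apply: le_trans (ler_norm _) _; rewrite !normrM ler_wpM2l ?mulr_ge0 //.
  under eq_bigl do rewrite -leq_min.
  by rewrite sum_itv_minn H // geq_minl.
under eq_bigr => d _ do rewrite mulr_sumr.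
rewrite (exchange_big_dep_nat xpredT) //=; apply: eq_bigr => n _.
under eq_bigr => d _ do rewrite mulr_sumr.
rewrite (exchange_big_dep_nat xpredT) //=; apply: eq_bigr => n' _.
rewrite [RHS]mulr_sumr; apply: eq_big => // d _; ring.
Qed.

(* A nonnegative majorant of the indicator of the primes above [z]. *)
Definition sig E z d : R := (\sum_(1 <= e < z.+1 | (e %| d)%N) lams R E z e) ^+ 2.

Lemma sig_ge0 E z d : 0 <= sig E z d.
Proof. exact: sqr_ge0. Qed.

Lemma sig_prime_pow E z p k : (0 < z)%N -> prime p -> (z < p)%N -> sig E z (p ^ k) = 1.
Proof.
move=> z0 pp zp; rewrite /sig big_ltn_cond // dvd1n lams1 //.
rewrite big_nat_cond big1 ?addr0 ?expr1n // => e /andP[/andP[e1 ez] /(dvdn_pfactor e k pp)[j _ E']].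
move: e1 ez; rewrite E'; case: j {E'} => [|j]; first by rewrite expn0.
move=> _; rewrite ltnS => h; exfalso.
have : (p <= p ^ j.+1)%N by rewrite expnS leq_pmulr // expn_gt0 prime_gt0.
by lia.
Qed.

Lemma sig_sum E z D U (c : nat -> R) : \sum_(D.+1 <= d < U.+1) sig E z d * c d
  = \sum_(1 <= e1 < z.+1) \sum_(1 <= e2 < z.+1)
      lams R E z e1 * lams R E z e2 * \sum_(D.+1 <= d < U.+1 | (lcmn e1 e2 %| d)%N) c d.
Proof.
transitivity (\sum_(D.+1 <= d < U.+1) \sum_(1 <= e1 < z.+1 | (e1 %| d)%N)
    \sum_(1 <= e2 < z.+1 | (e2 %| d)%N) lams R E z e1 * lams R E z e2 * c d).
  apply: eq_bigr => d _; rewrite /sig expr2 mulr_suml mulr_suml; apply: eq_bigr => e1 _.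
  by rewrite mulr_sumr mulr_suml.
rewrite (exchange_big_dep_nat xpredT) //=; apply: eq_bigr => e1 _.
rewrite (exchange_big_dep_nat xpredT) //=; apply: eq_bigr => e2 _.
rewrite mulr_sumr; apply: eq_bigl => d; by rewrite dvdn_lcm.
Qed.

Lemma sum_lams_norm E z : (0 < z)%N ->
  \sum_(1 <= e < z.+1) `|lams R E z e| <= (z ^ 2)%:R.
Proof.
move=> z0; apply: (@le_trans _ _ (\sum_(1 <= e < z.+1) z%:R)).
  by apply: ler_sum_nat => e /andP[_ ez]; apply: le_trans (lams_le R E e z0) _; rewrite ler_nat.
by rewrite sumr_const_nat subn1 /= -(mulr_natr z%:R) -natrM mulnn.
Qed.

Lemma sum_lams_norm2 E z (B : R) (F : nat -> nat -> R) : (0 < z)%N -> 0 <= B ->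
  (forall e1 e2, (0 < e1)%N -> (0 < e2)%N -> coprime e1 E -> coprime e2 E -> `|F e1 e2| <= B) ->
  `|\sum_(1 <= e1 < z.+1) \sum_(1 <= e2 < z.+1) lams R E z e1 * lams R E z e2 * F e1 e2|
  <= (z ^ 4)%:R * B.
Proof.
move=> z0 B0 H; apply: le_trans (ler_norm_sum _ _ _) _.
have S0 : 0 <= \sum_(1 <= e < z.+1) `|lams R E z e| by apply: sumr_ge0.
have S2 := sum_lams_norm E z0.
apply: (@le_trans _ _ (\sum_(1 <= e1 < z.+1) \sum_(1 <= e2 < z.+1) `|lams R E z e1| * `|lams R E z e2| * B)).
  apply: ler_sum_nat => e1 /andP[e10 _]; apply: le_trans (ler_norm_sum _ _ _) _.
  apply: ler_sum_nat => e2 /andP[e20 _].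
  rewrite (normrM (lams R E z e1 * _)) (normrM (lams R E z e1)).
  have [h1|/lams_neq0[_ c1]] := eqVneq (lams R E z e1) 0; first by rewrite h1 normr0 !mul0r.
  have [h2|/lams_neq0[_ c2]] := eqVneq (lams R E z e2) 0; first by rewrite h2 normr0 mulr0 !mul0r.
  by rewrite ler_wpM2l ?mulr_ge0 // H.
under eq_bigr => e1 _ do rewrite -mulr_suml -mulr_sumr.
rewrite -!mulr_suml ler_wpM2r // (_ : (z ^ 4)%:R = (z ^ 2)%:R * (z ^ 2)%:R :> R); last by rewrite -natrM -expnD.
by apply: ler_pM.
Qed.

(** The least common multiple [L] of two sieving divisors is coprime to [b], so [b] does not divide
    [L * l] and the geometric sum over multiples of [L] stays nontrivial. This is the reason for
    sieving by divisors coprime to [b]. *)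
Lemma sig_cos a b z D U l : (0 < z)%N -> (0 < b)%N -> coprime a b -> ~~ (b %| l)%N ->
  `|\sum_(D.+1 <= d < U.+1) sig b z d * cos (d%:R * (l%:R * alpha R a b))|
  <= (z ^ 4)%:R * (2 * b%:R).
Proof.
move=> z0 b0 cab bl; have b2 : 0 <= 2 * b%:R :> R by rewrite mulr_ge0.
rewrite sig_sum; apply: sum_lams_norm2 => // e1 e2 e10 e20 c1 c2.
set L := lcmn e1 e2; have L0 : (0 < L)%N by rewrite lcmn_gt0 e10.
have cL : coprime L b.
  apply: (@coprime_dvdl _ (e1 * e2)); last by rewrite coprimeMl c1 c2.
  by rewrite dvdn_lcm dvdn_mulr ?dvdn_mull.
case: (leqP D U) => DU; last by rewrite big_geq ?ltnS ?(ltnW DU) // normr0.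
rewrite sum_multiples_itv // (eq_bigr (fun m => cos (m%:R * ((L * l)%:R * alpha R a b) + 0))).
  by apply: cos_rat_sum => //; rewrite Gauss_dvdr // coprime_sym.
by move=> m _; rewrite addr0 !natrM; congr cos; ring.
Qed.

(** The number of multiples of the lcm is [(U - D) / lcm] up to an error of modulus at most 1: the
    main part gives Selberg's form, the error at most [z ^ 4]. *)
Lemma sig_mass E z D U : (0 < z)%N -> (D <= U)%N ->
  \sum_(D.+1 <= d < U.+1) sig E z d <= (U - D)%:R / Gs R E z + (z ^ 4)%:R.
Proof.
move=> z0 DU; have -> : \sum_(D.+1 <= d < U.+1) sig E z d = \sum_(D.+1 <= d < U.+1) sig E z d * 1.
  by apply: eq_bigr => d _; rewrite mulr1.
rewrite sig_sum.
have -> : \sum_(1 <= e1 < z.+1) \sum_(1 <= e2 < z.+1)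
      lams R E z e1 * lams R E z e2 * \sum_(D.+1 <= d < U.+1 | (lcmn e1 e2 %| d)%N) 1
  = (U - D)%:R * (\sum_(1 <= d < z.+1) \sum_(1 <= e < z.+1) lams R E z d * lams R E z e / (lcmn d e)%:R)
   + \sum_(1 <= e1 < z.+1) \sum_(1 <= e2 < z.+1) lams R E z e1 * lams R E z e2 *
     (\sum_(D.+1 <= d < U.+1 | (lcmn e1 e2 %| d)%N) 1 - (U - D)%:R / (lcmn e1 e2)%:R).
  rewrite mulr_sumr -big_split; apply: eq_bigr => e1 _ /=.
  by rewrite mulr_sumr -big_split; apply: eq_bigr => e2 _ /=; ring.
apply: lerD; first by rewrite ler_wpM2l // selberg_form.
apply: le_trans (ler_norm _) _; rewrite -[leRHS]mulr1; apply: sum_lams_norm2 => // e1 e2 e10 e20 _ _.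
set L := lcmn e1 e2; have L0 : (0 < L)%N by rewrite lcmn_gt0 e10.
rewrite sum_multiples_itv // sumr_const_nat subSS natrB ?leq_div2r // natrB //.
have L0' : 0 < L%:R :> R by rewrite ltr0n.
have fl k : ((k %/ L)%:R <= k%:R / L%:R :> R) /\ (k%:R / L%:R - 1 <= (k %/ L)%:R :> R).
  split; first by rewrite ler_pdivlMr // -natrM ler_nat leq_divM.
  by rewrite lerBlDr natr1 ler_pdivrMr // -natrM ler_nat ltnW // ltn_ceil.
have [u1 u2] := fl U; have [d1 d2] := fl D.
by rewrite mulrBl ler_norml; lra.
Qed.

End Block.

(** * Mean square of [hsum] over one block *)

Section DyadicBlock.
Variable R : realType.
Implicit Types (a b n m k d l x K y z D U V E : nat) (w : R).

Lemma harm_mono m n : (m <= n)%N -> harm R m <= harm R n.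
Proof.
move=> mn; rewrite /harm [leRHS](@big_cat_nat _ _ _ m.+1) //= lerDl.
by apply: sumr_ge0 => k _; rewrite invr_ge0.
Qed.

Lemma harm_ge0 n : 0 <= harm R n.
Proof. by apply: sumr_ge0 => k _; rewrite invr_ge0. Qed.

(** The second moment of [tauK] is at most [y] times the sum of [1 / lcm k l], which [lcm_form]
    turns into a product of three harmonic sums. *)
Lemma sum_MK_sq K y : \sum_(1 <= n < y.+1) MK R K n ^+ 2 <= y%:R * harm R K ^+ 3.
Proof.
apply: (@le_trans _ _ (\sum_(1 <= n < y.+1) tauK R K n ^+ 2)).
  apply: ler_sum => n _; rewrite -[leLHS]real_normK ?num_real //.
  by rewrite lerXn2r ?nnegrE ?(le_trans _ (MK_le R K n)) // MK_le.
apply: (@le_trans _ _ (y%:R * \sum_(1 <= k < K.+1) \sum_(1 <= l < K.+1) 1 * 1 / (lcmn k l)%:R)).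
  rewrite (_ : \sum_(1 <= n < y.+1) _ = \sum_(1 <= k < K.+1) \sum_(1 <= l < K.+1)
      \sum_(1 <= n < y.+1 | (lcmn k l %| n)%N) 1); last first.
    transitivity (\sum_(1 <= n < y.+1) \sum_(1 <= k < K.+1 | (k %| n)%N) \sum_(1 <= l < K.+1 | (l %| n)%N) (1 : R)).
      apply: eq_bigr => n _; rewrite /tauK expr2 mulr_suml; apply: eq_bigr => k _.
      by rewrite mul1r.
    rewrite (exchange_big_dep_nat xpredT) //=; apply: eq_bigr => k _.
    rewrite (exchange_big_dep_nat xpredT) //=; apply: eq_bigr => l _.
    by apply: eq_bigl => n; rewrite dvdn_lcm.
  rewrite mulr_sumr; apply: ler_sum_nat => k /andP[k0 _].
  rewrite mulr_sumr; apply: ler_sum_nat => l /andP[l0 _].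
  have L0 : (0 < lcmn k l)%N by rewrite lcmn_gt0 k0.
  rewrite sum_multiples // sumr_const_nat subn1 /= mulr1 mul1r.
  by rewrite ler_pdivlMr ?ltr0n // -natrM ler_nat leq_divM.
rewrite ler_wpM2l // (lcm_form (fun=> 1)).
apply: (@le_trans _ _ (\sum_(1 <= k < K.+1) k%:R^-1 * harm R K ^+ 2)); last first.
  by rewrite -mulr_suml -/(harm R K) -exprS.
apply: ler_sum_nat => k /andP[k0 kK]; have k0' : 0 < k%:R :> R by rewrite ltr0n.
rewrite sum_multiples //.
have -> : \sum_(1 <= m < (K %/ k).+1) (1 / (k * m)%:R) = k%:R^-1 * harm R (K %/ k) :> R.
  by rewrite /harm mulr_sumr; apply: eq_bigr => m _; rewrite natrM invfM mul1r.
rewrite exprMn mulrA; apply: ler_pM; rewrite ?mulr_ge0 ?exprn_ge0 ?invr_ge0 ?harm_ge0 //.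
  rewrite [leRHS](_ : _ = k%:R * k%:R^-1 ^+ 2 :> R); last by rewrite expr2 mulrA divff ?mul1r // gt_eqF.
  by apply: ler_wpM2r; rewrite ?exprn_ge0 ?invr_ge0 // ler_nat totient_leq.
by rewrite lerXn2r ?nnegrE ?harm_ge0 // harm_mono // leq_div.
Qed.

Lemma sum_MK_sq_tail K y : \sum_(K.+1 <= n < y.+1) MK R K n ^+ 2 <= y%:R * harm R K ^+ 3.
Proof.
apply: le_trans (sum_MK_sq K y); case: (leqP K y) => h; last first.
  rewrite [leLHS]big_geq; last exact: ltnW.
  by apply: sumr_ge0 => n _; apply: sqr_ge0.
rewrite [leRHS](@big_cat_nat _ _ _ K.+1) ?ltnS //= lerDr.
by apply: sumr_ge0 => n _; apply: sqr_ge0.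
Qed.

Lemma block_residues (g : nat -> nat -> R) (gg : nat -> R) (G : R) a b K y :
  (0 < b)%N -> coprime a b -> (forall r, 0 <= gg r) ->
  (forall n n', g n n' = gg (rho a b n n')) ->
  \sum_(0 <= r < b) gg r <= G ->
  \sum_(K.+1 <= n < y.+1) MK R K n ^+ 2 * \sum_(K.+1 <= n' < y.+1) g n n'
  <= y%:R * harm R K ^+ 3 * ((y%:R / b%:R + 1) * G).
Proof.
move=> b0 cab gg0 gE GG; have G0 : 0 <= G by apply: le_trans GG; apply: sumr_ge0.
apply: (@le_trans _ _ (\sum_(K.+1 <= n < y.+1) MK R K n ^+ 2 * ((y%:R / b%:R + 1) * G))); last first.
  rewrite -mulr_suml; apply: ler_wpM2r; last exact: sum_MK_sq_tail.
  by rewrite mulr_ge0 // addr_ge0 // divr_ge0.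
apply: ler_sum => n _; rewrite ler_wpM2l ?sqr_ge0 //.
case: (leqP K y) => h; last first.
  rewrite [leLHS]big_geq; last exact: ltnW.
  by rewrite mulr_ge0 // addr_ge0 // divr_ge0.
have -> : y.+1 = (K.+1 + (y - K))%N by lia.
under eq_bigr do rewrite gE.
apply: le_trans (@sum_residues_le _ gg a b (b.-1 * n) K.+1 (y - K) b0 cab gg0) _.
apply: ler_pM => //; first by rewrite addr_ge0 // divr_ge0.
  exact: sumr_ge0.
by rewrite lerD2r; apply: ler_wpM2r; rewrite ?invr_ge0 // ler_nat leq_subr.
Qed.

(** For given [n], the [n'] in one residue class out of [b] are bounded by the sieve mass; in the
    other classes [sig_cos] applies. *)
Lemma block_sieve a b w K x y z D V : (0 < z)%N -> (0 < b)%N -> coprime a b ->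
  (x %/ D.+1 <= y)%N -> (D <= V)%N ->
  \sum_(D.+1 <= d < V.+1) sig R b z d * hsum K x (cosw a b w) d ^+ 2
  <= y%:R * harm R K ^+ 3 * ((y%:R / b%:R + 1) *
     ((V - D)%:R / Gs R b z + (z ^ 4)%:R + b%:R * ((z ^ 4)%:R * (2 * b%:R)))).
Proof.
move=> z0 b0 cab xy DV; set S := (V - D)%:R / _ + _; set T := (z ^ 4)%:R * _.
have T0 : 0 <= T by rewrite !mulr_ge0.
have S0 : 0 <= S.
  by rewrite addr_ge0 // divr_ge0 //; apply: le_trans (Gs_ge1 R b z0).
pose gg r : R := if r == 0%N then S else T.
pose g n n' := gg (rho a b n n').
have gE n n' : g n n' = if (b %| natdist n n')%N then S else T by rewrite /g /gg rho_eq0.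
have gg0 r : 0 <= gg r by rewrite /gg; case: ifP.
apply: le_trans (@block_generic R (sig R b z) g a b w K x y D V xy _ _ _ _) _ => //.
- by move=> d; exact: sig_ge0.
- by move=> n n'; exact: gg0.
- by move=> n n'; rewrite !gE natdistC.
- move=> n n' U UV; rewrite gE; case: ifPn => h; last exact: sig_cos.
  apply: (@le_trans _ _ (\sum_(D.+1 <= d < V.+1) sig R b z d)); last exact: sig_mass.
  apply: (@le_trans _ _ (\sum_(D.+1 <= d < U.+1) sig R b z d)).
    apply: le_trans (ler_norm_sum _ _ _) _; apply: ler_sum => d _.
    by rewrite normrM ger0_norm ?sig_ge0 // ler_piMr ?sig_ge0 // cos_max.
  case: (leqP D U) => DU; last by rewrite [leLHS]big_geq; [apply: sumr_ge0 => d _; exact: sig_ge0|exact: ltnW].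
  rewrite [leRHS](@big_cat_nat _ _ _ U.+1) ?ltnS //= lerDl.
  by apply: sumr_ge0 => d _; exact: sig_ge0.
apply: (@block_residues g gg _ a b K y b0 cab gg0) => //.
rewrite big_ltn // {1}/gg eqxx lerD2l.
apply: (@le_trans _ _ (\sum_(1 <= r < b) T)).
  by apply: ler_sum_nat => r /andP[r0 _]; rewrite /gg gtn_eqF.
by rewrite sumr_const_nat -(mulr_natl T); apply: ler_wpM2r; rewrite // ler_nat leq_subr.
Qed.

(** The analogue with weights 1: off the diagonal class the inner sums are at most [1 / |sin|],
    which adds up to [4 * b * harm b] over the residues. *)
Lemma block_plain a b w K x y D V : (0 < b)%N -> coprime a b ->
  (x %/ D.+1 <= y)%N -> (D <= V)%N ->
  \sum_(D.+1 <= d < V.+1) hsum K x (cosw a b w) d ^+ 2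
  <= y%:R * harm R K ^+ 3 * ((y%:R / b%:R + 1) *
     ((V - D)%:R + 4 * b%:R * harm R b)).
Proof.
move=> b0 cab xy DV; have b0' : 0 < b%:R :> R by rewrite ltr0n.
pose gg r : R := if r == 0%N then (V - D)%:R else `|sin (pi * (r%:R / b%:R))|^-1.
pose g n n' := gg (rho a b n n').
have gE n n' : g n n' = if (b %| natdist n n')%N then (V - D)%:R
    else `|sin (pi * ((natdist n n' * a)%:R / b%:R))|^-1.
  by rewrite /g /gg rho_eq0 // sin_rho.
have gg0 r : 0 <= gg r by rewrite /gg; case: ifP => _ //; rewrite invr_ge0.
rewrite (eq_bigr (fun d => 1 * hsum K x (cosw a b w) d ^+ 2)); last by move=> d _; rewrite mul1r.
apply: le_trans (@block_generic R (fun=> 1) g a b w K x y D V xy _ _ _ _) _ => //.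
- by move=> n n'; exact: gg0.
- by move=> n n'; rewrite !gE natdistC.
- move=> n n' U UV; rewrite gE; under eq_bigr do rewrite mul1r.
  case: ifPn => h.
    apply: (@le_trans _ _ (\sum_(D.+1 <= d < U.+1) 1)).
      by apply: le_trans (ler_norm_sum _ _ _) _; apply: ler_sum => d _; exact: cos_max.
    by rewrite sumr_const_nat ler_nat subSS leq_sub2r.
  have h' : ~~ (b %| natdist n n' * a)%N by rewrite Gauss_dvdl // coprime_sym.
  have s0 : 0 < `|sin (pi * ((natdist n n' * a)%:R / b%:R))| :> R.
    by apply: lt_le_trans (sin_ndvd_ge R b0 h'); rewrite invr_gt0 mulr_gt0.
  rewrite -[leRHS]mul1r ler_pdivlMr //.
  have := cos_sum_bound D.+1 U.+1 ((natdist n n')%:R * alpha R a b) 0.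
  have -> : (natdist n n')%:R * alpha R a b / 2 = pi * ((natdist n n' * a)%:R / b%:R).
    by rewrite /alpha natrM; field; rewrite gt_eqF.
  rewrite (eq_bigr (fun k => cos (k%:R * ((natdist n n')%:R * alpha R a b)))) //.
  by move=> k _; rewrite addr0.
apply: (@block_residues g gg _ a b K y b0 cab gg0) => //.
rewrite big_ltn // {1}/gg eqxx lerD2l.
(* The reciprocal of [min r (b - r)] is bounded by the sum of both reciprocals. *)
apply: (@le_trans _ _ (\sum_(1 <= r < b) (2 * b%:R * r%:R^-1 + 2 * b%:R * (b - r)%:R^-1))).
  apply: ler_sum_nat => r /andP[r0 rb]; rewrite /gg gtn_eqF //.
  have := sin_rat_ge R (_ : 0 < r < b)%N; rewrite r0 rb => /(_ isT) H.
  set mm := minn r (b - r) in H.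
  have mm0 : (0 < mm)%N by rewrite leq_min r0 subn_gt0.
  have P0 : 0 < mm%:R / (2 * b%:R) :> R by rewrite divr_gt0 ?ltr0n ?mulr_gt0.
  apply: (@le_trans _ _ (2 * b%:R * mm%:R^-1)).
    by rewrite -(invf_div mm%:R) lef_pV2 ?posrE ?(lt_le_trans P0 H).
  rewrite -mulrDr ler_wpM2l ?mulr_ge0 // /mm.
  case: (leqP r (b - r)) => _; first by rewrite lerDl invr_ge0.
  by rewrite lerDr invr_ge0.
rewrite big_split /= -!mulr_sumr.
have h1 : \sum_(1 <= r < b) r%:R^-1 <= harm R b.
  by rewrite /harm [leRHS]big_nat_recr //= lerDl invr_ge0.
have -> : \sum_(1 <= r < b) (b - r)%:R^-1 = \sum_(1 <= r < b) r%:R^-1 :> R.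
  rewrite [RHS]big_nat_rev /=; apply: eq_big_nat => r _.
  by rewrite add1n subSS.
have := mulr_ge0 (ler0n R 2) (ltW b0'); move=> h2; have := ler_wpM2l h2 h1; lra.
Qed.

End DyadicBlock.

Lemma exp_beats_poly (C j : nat) : exists k0, forall k, (k0 <= k)%N -> (C * k.+1 ^ j <= 2 ^ k)%N.
Proof.
(* With [t = k / (j + 1)] one has [k + 1 <= (j + 1) 2^t]. The [j] factors cost [2^(j t)], and the
   remaining [2^t] absorbs the constant [C (j + 1)^j]. *)
exists (j.+1 * (C * j.+1 ^ j))%N => k hk; set t := (k %/ j.+1)%N.
have tk : (j * t + t <= k)%N by rewrite addnC -mulSn mulnC leq_divM.
have kt : (k.+1 <= j.+1 * 2 ^ t)%N.
  apply: leq_trans (ltn_ceil k (ltn0Sn j)) _; rewrite -/t mulnC leq_mul2l /=.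
  exact: ltn_expl.
have Ct : (C * j.+1 ^ j <= 2 ^ t)%N.
  by apply: leq_trans (ltnW (ltn_expl t (ltnSn 1))); rewrite /t leq_divRL // mulnC.
have le1 i : (k.+1 ^ i <= (j.+1 * 2 ^ t) ^ i)%N by case: i => // i; rewrite leq_exp2r.
apply: (@leq_trans (C * (j.+1 * 2 ^ t) ^ j)); first by rewrite leq_mul2l le1 orbT.
rewrite expnMn mulnA; apply: (@leq_trans (2 ^ t * (2 ^ t) ^ j)).
  by rewrite leq_mul2r Ct orbT.
by rewrite -expnM -expnD leq_exp2l // addnC mulnC.
Qed.

(** * Dyadic decomposition and small primes *)

Section Dyadic.
Variable R : realType.
Implicit Types (a b n m k d l x K y z D U V E N M : nat) (w : R).

Lemma ln_2pow N : ln (2 ^ N)%:R <= N%:R :> R.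
Proof.
rewrite natrX lnXn ?ltr0n // -(mulr_natl (ln _)) ler_piMr //.
by have := @le_ln1Dx R 1; rewrite -[2]/(1 + 1); apply; lra.
Qed.

Lemma ln2_ge_half : 1 / 2 <= ln 2 :> R.
Proof. by have := @ln_diff_ge R 1 isT; rewrite ln1 subr0; lra. Qed.

Lemma harm_2pow k : harm R (2 ^ k) <= k.+1%:R.
Proof.
apply: le_trans (harm_le R _) _; first by rewrite expn_gt0.
by have := ln_2pow k; rewrite -natr1; lra.
Qed.

Lemma sum_dyadic (F : nat -> R) M N : (M <= N)%N ->
  \sum_(1 <= d < (2 ^ N).+1) F d
  = \sum_(1 <= d < (2 ^ M).+1) F d
    + \sum_(M <= i < N) \sum_((2 ^ i).+1 <= d < (2 ^ i.+1).+1) F d.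
Proof.
elim: N => [|N IHN]; first by rewrite leqn0 => /eqP ->; rewrite [X in _ + X]big_geq ?addr0.
rewrite leq_eqVlt => /predU1P[->|]; first by rewrite [X in _ + X]big_geq ?addr0.
rewrite ltnS => MN; rewrite (@big_cat_nat _ _ _ (2 ^ N).+1) ?ltnS ?leq_exp2l //=.
by rewrite IHN // [X in _ = _ + X]big_nat_recr // addrA.
Qed.

Lemma cauchy_weighted (r : seq nat) (s h : nat -> R) : (forall d, 0 <= s d) ->
  (\sum_(d <- r) s d * `|h d|) ^+ 2 <= (\sum_(d <- r) s d) * (\sum_(d <- r) s d * h d ^+ 2).
Proof.
move=> s0; set U := \sum_(d <- r) _ * _; set T := \sum_(d <- r) s d; set V := \sum_(d <- r) _.
have : 0 <= \sum_(i <- r) \sum_(j <- r) s i * s j * (`|h i| - `|h j|) ^+ 2.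
  by apply: sumr_ge0 => i _; apply: sumr_ge0 => j _; rewrite mulr_ge0 ?sqr_ge0 // mulr_ge0.
have -> : \sum_(i <- r) \sum_(j <- r) s i * s j * (`|h i| - `|h j|) ^+ 2
   = 2 * (T * V - U ^+ 2).
  transitivity (\sum_(i <- r) (s i * h i ^+ 2 * T + s i * V - 2 * (s i * `|h i|) * U)).
    apply: eq_bigr => i _; rewrite /T /V /U !mulr_sumr -big_split -sumrB /=.
    apply: eq_bigr => j _.
    by rewrite -[h i ^+ 2]real_normK ?num_real // -[h j ^+ 2]real_normK ?num_real //; ring.
  rewrite !big_split /= sumrN -!mulr_suml -mulr_sumr -/T -/V -/U; ring.
by lra.
Qed.

Lemma vonM_cosw_split a b w K x : (0 < K)%N -> (0 < b)%N -> coprime a b -> (K < b)%N ->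
  `|\sum_(1 <= d < x.+1) vonM R d * cosw a b w d|
  <= K%:R * (ln x%:R * (2 * b%:R)) + \sum_(1 <= d < x.+1) vonM R d * `|hsum K x (cosw a b w) d|.
Proof.
move=> K0 b0 cab Kb; rewrite (vonM_sum_split _ (cosw a b w) K0).
apply: le_trans (ler_normB _ _) _; apply: lerD; first exact: typeI_bound.
apply: le_trans (ler_norm_sum _ _ _) _; apply: ler_sum => d _.
by rewrite normrM ger0_norm ?vonM_ge0.
Qed.

Lemma hsum_eq0 K x (f : nat -> R) d : (x %/ d <= K)%N -> hsum K x f d = 0.
Proof. by move=> h; rewrite /hsum big_geq. Qed.

Lemma pdiv_pexp p k : prime p -> (0 < k)%N -> pdiv (p ^ k) = p.
Proof.
move=> pp k0; have n1 : (1 < p ^ k)%N by rewrite -{1}(exp1n k) ltn_exp2r ?prime_gt1.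
have := pdiv_dvd (p ^ k); rewrite Euclid_dvdX ?pdiv_prime // k0 andbT.
by rewrite dvdn_prime2 ?pdiv_prime // => /eqP.
Qed.

(** There are at most [z.+1 * N.+1] pairs of base and exponent, and each weight is at most [N]. *)
Lemma vonM_small_primes z N :
  \sum_(1 <= d < (2 ^ N).+1 | (pdiv d <= z)%N) vonM R d <= (z.+1 * N.+1 * N)%:R.
Proof.
apply: (@le_trans _ _ (\sum_(1 <= d < (2 ^ N).+1) \sum_(0 <= p < z.+1) \sum_(0 <= k < N.+1)
    (d == p ^ k)%N%:R * N%:R)).
  rewrite big_mkcond /=; apply: ler_sum_nat => d /andP[d0 dx].
  have nn : 0 <= \sum_(0 <= p < z.+1) \sum_(0 <= k < N.+1) (d == p ^ k)%N%:R * N%:R :> R.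
    by apply: sumr_ge0 => p _; apply: sumr_ge0 => k _; rewrite mulr_ge0.
  case: ifPn => // pz; have [->//|/vonM_neq0[p [k [pp k0 E]]]] := eqVneq (vonM R d) 0.
  have pz' : (p <= z)%N by move: pz; rewrite E pdiv_pexp.
  have kN : (k <= N)%N.
    rewrite -(leq_exp2l (m := 2)) // -ltnS; apply: leq_trans dx; rewrite ltnS E.
    by rewrite leq_exp2r ?prime_gt1.
  rewrite (big_rem p) ?mem_index_iota //= (big_rem k) ?mem_index_iota //= -E eqxx mul1r -addrA.
  apply: le_trans (_ : N%:R <= _).
    by apply: le_trans (vonM_le R d) _; apply: le_trans (ln_nat_le R (ltnSE dx)) _; exact: ln_2pow.
  rewrite lerDl addr_ge0 //; first by apply: sumr_ge0 => ? _; rewrite mulr_ge0.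
  by apply: sumr_ge0 => ? _; apply: sumr_ge0 => ? _; rewrite mulr_ge0.
rewrite exchange_big /=.
apply: (@le_trans _ _ (\sum_(0 <= p < z.+1) \sum_(0 <= k < N.+1) N%:R)); last first.
  by rewrite !sumr_const_nat !subn0 -!mulrnA ler_nat; lia.
apply: ler_sum => p _; rewrite exchange_big /=; apply: ler_sum => k _.
rewrite -mulr_suml ler_piMl // -natr_sum lern1.
rewrite (eq_bigr (fun n => if n == p ^ k then 1 else 0)%N); last by move=> n _; case: eqP.
by rewrite -big_mkcond sum1_count count_uniq_mem ?iota_uniq // leq_b1.
Qed.

End Dyadic.

(** * One block for small denominators *)

Section SieveBlock.
Variable R : realType.
Implicit Types (a b n m k d l x K y z D U V E N M i P : nat) (w : R).

Lemma size_primes_lt b e : (0 < b)%N -> (b < 2 ^ e)%N -> (size (primes b) < e)%N.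
Proof.
move=> b0 be; rewrite -(@ltn_exp2l 2) //; exact: leq_ltn_trans (expn_size_primes b0) be.
Qed.

(** Excluding the primes of [b] costs a factor of order [e], the binary logarithm of [b]; the power
    of [b] saved later absorbs it. *)
Lemma Gs_inv_le b e ze : (0 < b)%N -> (b < 2 ^ e.+1)%N -> (0 < ze)%N ->
  (Gs R b (2 ^ ze))^-1 <= (2 * (e + 2))%:R / ze%:R.
Proof.
move=> b0 be z0; have z1 : (0 < 2 ^ ze)%N by rewrite expn_gt0.
have G0 : 0 < Gs R b (2 ^ ze) by apply: lt_le_trans (Gs_ge1 R b z1).
rewrite -[leLHS]mul1r ler_pdivrMr // mulrAC ler_pdivlMr ?ltr0n // mul1r.
have := Gs_lower R (2 ^ ze) b0; have := size_primes_lt b0 be; rewrite ltnS => se H.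
have h1 : ze%:R / 2 <= ln (2 ^ ze).+1%:R :> R.
  apply: le_trans (ln_nat_le R (leqnSn _)).
  by rewrite natrX lnXn ?ltr0n // -(mulr_natl (ln _)) ler_wpM2l //; have := ln2_ge_half R; lra.
have h2 : (size (primes b) + 2)%:R * Gs R b (2 ^ ze) <= (e + 2)%:R * Gs R b (2 ^ ze).
  by rewrite ler_wpM2r ?(ltW G0) // ler_nat leq_add2r.
by rewrite natrM; lra.
Qed.

Lemma le_of_sqr (u v : R) : 0 <= v -> u ^+ 2 <= v ^+ 2 -> u <= v.
Proof.
move=> v0 H; apply: le_trans (ler_norm u) _.
by rewrite -(ger0_norm v0) -ler_sqr ?nnegrE ?normr_ge0 // !real_normK ?num_real.
Qed.

Lemma harm3_2pow k : harm R (2 ^ k) ^+ 3 <= (k.+1 ^ 3)%:R.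
Proof. by rewrite natrX lerXn2r ?nnegrE ?harm_ge0 ?harm_2pow. Qed.

(** The factor [N] stands for the bound of [Lambda]. The sieve mass of the block is of order
    [2 ^ i * ka / ze], and [N <= m * ze] cancels the logarithm. There remains a polynomial in [ka]
    against the square root of [2 ^ ka], where [2 ^ ka] is about the square root of [b]. *)
Lemma block_small_denominator a b w ka ze N m i P : (0 < ze)%N -> coprime a b ->
  (2 ^ (2 * ka) <= b)%N -> (b < 2 ^ (2 * ka + 2))%N -> (i + ka <= N)%N ->
  (ze * (2 * b ^ 2 + 1) * (2 ^ ze) ^ 4 <= 2 ^ i)%N -> (N <= m * ze)%N -> (0 < P)%N ->
  (2 * m ^ 2 * (4 * ka + 7) ^ 2 * ka.+1 ^ 3 * P ^ 2 <= 2 ^ ka)%N ->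
  N%:R * \sum_((2 ^ i).+1 <= d < (2 ^ i.+1).+1)
     sig R b (2 ^ ze) d * `|hsum (2 ^ ka) (2 ^ N) (cosw a b w) d|
  <= (2 ^ N)%:R / P%:R.
Proof.
move=> z0 cab bl bu iN Dbig Nm P0 HP.
have b0 : (0 < b)%N by apply: leq_trans bl; rewrite expn_gt0.
set K := (2 ^ ka)%N; set x := (2 ^ N)%N; set z := (2 ^ ze)%N; set D := (2 ^ i)%N.
set h := hsum K x (cosw a b w); set r := index_iota _ _.
set U := \sum_(d <- r) _.
have zz : (0 < z)%N by rewrite expn_gt0.
pose y := (2 ^ (N - i))%N.
have Dy : (D * y = x)%N by rewrite /D /y /x -expnD; congr expn; clear - iN; lia.
have VD : (2 ^ i.+1 - D = D)%N by rewrite /D expnS mul2n -addnn addnK.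
have DV : (D <= 2 ^ i.+1)%N by rewrite /D leq_exp2l.
have xy : (x %/ D.+1 <= y)%N.
  have Dp : (0 < D)%N by rewrite expn_gt0.
  by apply: leq_trans (leq_div2l _ Dp (leqnSn D)) _; rewrite -Dy mulKn.
have D0 : 0 < D%:R :> R by rewrite ltr0n expn_gt0.
have y0 : 0 < y%:R :> R by rewrite ltr0n expn_gt0.
have b0' : 0 < b%:R :> R by rewrite ltr0n.
have K0 : 0 < K%:R :> R by rewrite ltr0n expn_gt0.
have ze0 : 0 < ze%:R :> R by rewrite ltr0n.
(* [4 * ka + 6] comes from [Gs_inv_le] with [e = 2 * ka + 1], the extra 1 from the error terms
   bounded in [zD]. *)
set q := (4 * ka + 7)%N; pose S' : R := D%:R * q%:R / ze%:R.
have GS := sig_mass R b zz DV; have BS := block_sieve w K zz b0 cab xy DV.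
rewrite VD in GS BS.
have G1 : D%:R / Gs R b z <= D%:R * (4 * ka + 6)%:R / ze%:R.
  rewrite -mulrA ler_wpM2l //.
  have := @Gs_inv_le b (2 * ka + 1) ze b0; rewrite addn1 -addn2 => /(_ _ z0) H.
  apply: le_trans (H _) _; first by apply: leq_trans bu _; rewrite leq_exp2l //; clear; lia.
  by rewrite ler_wpM2r ?invr_ge0 // ler_nat; clear; lia.
have zD : (z ^ 4)%:R + b%:R * ((z ^ 4)%:R * (2 * b%:R)) <= D%:R / ze%:R :> R.
  rewrite ler_pdivlMr //; apply: le_trans (_ : (ze * (2 * b ^ 2 + 1) * z ^ 4)%:R <= _); last by rewrite ler_nat.
  by rewrite !natrM natrD natrM natrX; lra.
have bz0 : 0 <= b%:R * ((z ^ 4)%:R * (2 * b%:R)) :> R by rewrite !mulr_ge0.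
have S'E : S' = D%:R * (4 * ka + 6)%:R / ze%:R + D%:R / ze%:R.
  by rewrite /S' /q (_ : (4 * ka + 7) = (4 * ka + 6) + 1)%N ?natrD; [ring|clear; lia].
have S'0 : 0 <= S' by rewrite divr_ge0 ?mulr_ge0 ?(ltW ze0).
have s1 : \sum_(d <- r) sig R b z d <= S' by apply: le_trans GS _; rewrite S'E; lra.
have H30 : 0 <= harm R K ^+ 3 by rewrite exprn_ge0 ?harm_ge0.
have s2 : \sum_(d <- r) sig R b z d * h d ^+ 2
    <= y%:R * (ka.+1 ^ 3)%:R * ((y%:R / b%:R + 1) * S').
  have A0 : 0 <= y%:R / b%:R + 1 :> R by rewrite addr_ge0 ?divr_ge0.
  have Gp : 0 <= Gs R b z by apply: le_trans (Gs_ge1 R b zz).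
  have B0 : 0 <= D%:R / Gs R b z + (z ^ 4)%:R + b%:R * ((z ^ 4)%:R * (2 * b%:R)).
    by rewrite addr_ge0 // addr_ge0 // divr_ge0.
  apply: le_trans BS _; apply: ler_pM.
  - exact: mulr_ge0.
  - exact: mulr_ge0.
  - by rewrite ler_wpM2l // harm3_2pow.
  - by rewrite ler_wpM2l // S'E; lra.
have U2 : U ^+ 2 <= S' * (y%:R * (ka.+1 ^ 3)%:R * ((y%:R / b%:R + 1) * S')).
  apply: le_trans (cauchy_weighted r h (sig_ge0 R b z)) _.
  apply: ler_pM => //; first by apply: sumr_ge0 => d _; exact: sig_ge0.
  by apply: sumr_ge0 => d _; rewrite mulr_ge0 ?sig_ge0 ?sqr_ge0.
apply: le_of_sqr; first by rewrite divr_ge0.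
rewrite exprMn.
have x0 : 0 < x%:R :> R by rewrite ltr0n expn_gt0.
have xE : x%:R = D%:R * y%:R :> R by rewrite -natrM Dy.
have yK : K%:R <= y%:R :> R by rewrite ler_nat leq_exp2l //; clear - iN; lia.
have bK : K%:R <= b%:R :> R by rewrite ler_nat; apply: leq_trans bl; rewrite leq_exp2l //; clear; lia.
have e1 : S' * (y%:R * (ka.+1 ^ 3)%:R * ((y%:R / b%:R + 1) * S'))
   = x%:R ^+ 2 * (b%:R^-1 + y%:R^-1) * (q%:R ^+ 2 * (ka.+1 ^ 3)%:R) / ze%:R ^+ 2.
  by rewrite xE /S'; field; rewrite !gt_eqF.
have e2 : b%:R^-1 + y%:R^-1 <= 2 / K%:R :> R.
  have : b%:R^-1 <= K%:R^-1 :> R by rewrite lef_pV2 ?posrE.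
  have : y%:R^-1 <= K%:R^-1 :> R by rewrite lef_pV2 ?posrE.
  by lra.
have N2 : N%:R ^+ 2 <= m%:R ^+ 2 * ze%:R ^+ 2 :> R.
  by rewrite -exprMn -natrM lerXn2r ?nnegrE // ler_nat.
apply: (@le_trans _ _ (m%:R ^+ 2 * ze%:R ^+ 2 *
   (x%:R ^+ 2 * (2 / K%:R) * (q%:R ^+ 2 * (ka.+1 ^ 3)%:R) / ze%:R ^+ 2))).
  apply: ler_pM; rewrite ?sqr_ge0 // (le_trans U2) // e1.
  rewrite ler_wpM2r ?invr_ge0 ?sqr_ge0 // ler_wpM2r ?mulr_ge0 ?sqr_ge0 //.
  by apply: ler_wpM2l e2; exact: sqr_ge0.
have -> : m%:R ^+ 2 * ze%:R ^+ 2 * (x%:R ^+ 2 * (2 / K%:R) * (q%:R ^+ 2 * (ka.+1 ^ 3)%:R) / ze%:R ^+ 2)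
   = x%:R ^+ 2 * ((2 * m ^ 2 * q ^ 2 * ka.+1 ^ 3)%:R / K%:R) :> R.
  have gen (mm zz' xx kk qq cc : R) : kk != 0 -> zz' != 0 ->
      mm ^+ 2 * zz' ^+ 2 * (xx ^+ 2 * (2 / kk) * (qq ^+ 2 * cc) / zz' ^+ 2)
      = xx ^+ 2 * (2 * mm ^+ 2 * qq ^+ 2 * cc / kk) by move=> ? ?; field; apply/andP.
  by rewrite gen ?gt_eqF // -!natrX -!natrM.
rewrite exprMn ler_wpM2l ?sqr_ge0 // ler_pdivrMr // exprVn mulrC ler_pdivlMr ?exprn_gt0 ?ltr0n //.
by rewrite -natrX -natrM ler_nat.
Qed.

End SieveBlock.

(** * Exponential sums over primes *)
Section PrimePowers.
Variable R : realType.
Implicit Types (a b n m k d l x K y z D U V E N M i P T p : nat) (w : R).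

Lemma geom_tail p T n : (1 < p)%N -> (0 < T)%N ->
  \sum_(0 <= k < n | (T <= p ^ k)%N) ((p ^ k)%:R)^-1 <= 2 / T%:R :> R.
Proof.
move=> p1 T0; have p0 : 0 < p%:R :> R by rewrite ltr0n ltnW.
have pk k : 0 < (p ^ k)%:R :> R by rewrite ltr0n expn_gt0 ltnW.
have T0' : 0 < T%:R :> R by rewrite ltr0n.
have p2 : 2 / p%:R <= 1 :> R by rewrite ler_pdivrMr // mul1r ler_nat.
pose S n : R := \sum_(0 <= k < n | (T <= p ^ k)%N) ((p ^ k)%:R)^-1.
have small j : (p ^ j < T)%N -> S j = 0.
  move=> h; rewrite /S big_nat_cond big1 // => k /andP[/andP[_ kj] hk].
  by have : (p ^ k < p ^ j)%N by [rewrite ltn_exp2l]; lia.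
(* The induction keeps [2 / p ^ n] in reserve for the later terms once [p ^ n] has reached [T]. *)
suff H : S n + (if (T <= p ^ n)%N then 2 / (p ^ n)%:R else 0) <= 2 / T%:R.
  by apply: le_trans H; rewrite lerDl; case: ifP => // _; rewrite divr_ge0.
elim: n => [|n IHn].
  rewrite /S big_geq // add0r expn0; case: ifP => h; last by rewrite divr_ge0.
  by rewrite (_ : T = 1%N) //; lia.
rewrite /S big_mkcond big_nat_recr //= -big_mkcond -/(S n).
case: ifPn IHn => h.
  have -> : (T <= p ^ n.+1)%N by apply: leq_trans h _; rewrite leq_exp2l.
  move=> IH; apply: le_trans IH; rewrite -addrA lerD2l expnS natrM invfM.
  have i0 : 0 <= (p ^ n)%:R^-1 :> R by rewrite invr_ge0.
  by have := ler_wpM2r i0 p2; lra.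
rewrite small ?ltnNge // !add0r => _; case: ifP => h'; last by rewrite divr_ge0.
by rewrite ler_wpM2l // lef_pV2 ?posrE // ler_nat.
Qed.

Lemma bad_prime_powers b M T : (0 < b)%N -> (0 < T)%N ->
  \sum_(1 <= d < (2 ^ M).+1 | (T <= d)%N && (pdiv d %| b)%N) vonM R d / d%:R
  <= (size (primes b))%:R * (ln b%:R * (2 / T%:R)).
Proof.
move=> b0 T0.
apply: (@le_trans _ _ (\sum_(1 <= d < (2 ^ M).+1) \sum_(p <- primes b) \sum_(0 <= k < M.+1 | (T <= p ^ k)%N)
    (d == p ^ k)%N%:R * (ln b%:R * ((p ^ k)%:R)^-1))).
  have lb : 0 <= ln b%:R :> R by exact: ln_nat_ge0.
  rewrite big_mkcond /=; apply: ler_sum_nat => d /andP[d0 dx].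
  have nn p k : 0 <= (d == p ^ k)%N%:R * (ln b%:R * ((p ^ k)%:R)^-1) :> R.
    by rewrite mulr_ge0 // mulr_ge0 // invr_ge0.
  have nn2 : 0 <= \sum_(p <- primes b) \sum_(0 <= k < M.+1 | (T <= p ^ k)%N)
    (d == p ^ k)%N%:R * (ln b%:R * ((p ^ k)%:R)^-1) :> R.
    by apply: sumr_ge0 => p _; exact: sumr_ge0.
  case: ifPn => // /andP[Td pb]; have [->|/vonM_neq0[p [k [pp k0 Ed]]]] := eqVneq (vonM R d) 0.
    by rewrite mul0r.
  have pb' : p \in primes b by rewrite mem_primes pp b0 -(pdiv_pexp pp k0) -Ed.
  have kM : (k <= M)%N.
    rewrite -(leq_exp2l (m := 2)) // -ltnS; apply: leq_trans dx; rewrite ltnS Ed.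
    by rewrite leq_exp2r ?prime_gt1.
  rewrite (big_rem p) //= (big_rem k) ?mem_index_iota //= -Ed Td eqxx mul1r -addrA.
  apply: le_trans (_ : ln b%:R * d%:R^-1 <= _).
    rewrite ler_wpM2r ?invr_ge0 // Ed vonM_pexp // ln_nat_le // dvdn_leq //.
    by move: pb'; rewrite mem_primes => /and3P[].
  rewrite lerDl addr_ge0 //; first exact: sumr_ge0.
  by apply: sumr_ge0 => q _; exact: sumr_ge0.
rewrite exchange_big /=.
have -> : (size (primes b))%:R * (ln b%:R * (2 / T%:R)) = \sum_(p <- primes b) ln b%:R * (2 / T%:R) :> R.
  by rewrite big_const_seq count_predT iter_addr_0 mulr_natl.
rewrite big_seq [leRHS]big_seq; apply: ler_sum => p; rewrite mem_primes => /and3P[pp _ _].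
rewrite exchange_big /=.
apply: (@le_trans _ _ (\sum_(0 <= k < M.+1 | (T <= p ^ k)%N) ln b%:R * ((p ^ k)%:R)^-1)); last first.
  by rewrite -mulr_sumr ler_wpM2l ?ln_nat_ge0 // geom_tail ?prime_gt1.
apply: ler_sum => k _; rewrite -mulr_suml ler_piMl ?mulr_ge0 ?invr_ge0 ?ln_nat_ge0 //.
rewrite -natr_sum lern1.
rewrite (eq_bigr (fun n => if n == p ^ k then 1 else 0)%N); last by move=> n _; case: eqP.
by rewrite -big_mkcond sum1_count count_uniq_mem ?iota_uniq // leq_b1.
Qed.

(** For a prime power [d] and [k <= K], the product [k * d] can be a multiple of [b] only if [d] is
    [bad]: if [d < K] it is below [K^2 <= b], and if [d] is coprime to [b] then [b] would divide
    [k]. The bad [d] get the trivial bound and are summed by [bad_prime_powers]. *)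
Lemma small_d_sum a b w ka N M : (0 < ka)%N -> coprime a b -> (2 ^ (2 * ka) <= b)%N -> (b < 2 ^ (2 * ka + 2))%N ->
  (M <= N)%N ->
  \sum_(1 <= d < (2 ^ M).+1) vonM R d * `|hsum (2 ^ ka) (2 ^ N) (cosw a b w) d|
  <= (2 ^ (M + 3 * ka + 6))%:R + (2 ^ N)%:R * ((8 * ka.+1 ^ 3)%:R / (2 ^ ka)%:R).
Proof.
move=> k0 cab bl bu MN; set K := (2 ^ ka)%N; set x := (2 ^ N)%N; set h := hsum K x _.
have b0 : (0 < b)%N by apply: leq_trans bl; rewrite expn_gt0.
have K0 : (0 < K)%N by rewrite expn_gt0.
have KK : (K * K <= b)%N by rewrite -expnD addnn -mul2n.
pose bad d := (K <= d)%N && (pdiv d %| b)%N.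
have hd d : (1 <= d < (2 ^ M).+1)%N -> vonM R d * `|h d| <= vonM R d * (3 * K * b)%:R
    + (if bad d then vonM R d / d%:R else 0) * (x%:R * ka.+1%:R).
  move=> /andP[d0 dM]; have dx : (d <= x)%N by apply: leq_trans (ltnSE dM) _; rewrite leq_exp2l.
  have [->|/vonM_neq0[p [k [pp k0' Ed]]]] := eqVneq (vonM R d) 0; first by rewrite !mul0r if_same mul0r addr0.
  have V0 := vonM_ge0 R d.
  case: ifPn => hb.
    rewrite -[leLHS]add0r lerD ?mulr_ge0 // -[leRHS]mulrA ler_wpM2l //.
    apply: le_trans (hsum_le _ _ d0 (cosw_le1 a b w)) _.
    rewrite mulrA [_^-1 * _]mulrC ler_wpM2l ?divr_ge0 //; exact: harm_2pow.
  rewrite mul0r addr0 ler_wpM2l //.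
  have -> : (3 * K * b)%:R = K%:R * (2 * b%:R) + (K * b)%:R :> R by rewrite !natrM; ring.
  apply: le_trans (hsum_small w b0 cab K0 d0 dx _) _; last first.
    by rewrite lerD2l ler1n muln_gt0 K0.
  move=> j /andP[j0 jK]; apply/negP => hdv.
  move: hb; rewrite /bad negb_and -ltnNge => /orP[dK|pb].
    have := dvdn_leq _ hdv; rewrite muln_gt0 j0 d0 => /(_ isT).
    by rewrite leqNgt => /negP; apply; apply: leq_trans KK; apply: leq_ltn_trans (leq_mul jK (leqnn d)) _; rewrite ltn_pmul2l.
  have cbd : coprime b d.
    rewrite Ed coprimeXr // coprime_sym prime_coprime //.
    by move: pb; rewrite Ed pdiv_pexp.
  have := hdv; rewrite (Gauss_dvdl j cbd) => /(dvdn_leq j0).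
  rewrite leqNgt => /negP; apply; apply: leq_ltn_trans jK _.
  by apply: leq_trans KK; rewrite ltn_Pmulr // -[1%N](expn0 2) ltn_exp2l.
apply: le_trans (ler_sum_nat hd) _; rewrite big_split /= -!mulr_suml; apply: lerD.
  apply: le_trans (_ : 4 * (2 ^ M)%:R * (3 * K * b)%:R <= _).
    by rewrite ler_wpM2r // psi_bound.
  rewrite -!natrM ler_nat.
  have -> : (2 ^ (M + 3 * ka + 6) = 4 * 2 ^ M * (4 * K * (2 ^ (2 * ka + 2))))%N.
    by rewrite -[4%N]/(2 ^ 2)%N /K -!expnD; congr expn; clear; lia.
  by rewrite leq_mul2l orbC leq_mul // ?leq_mul // ltnW.
rewrite -big_mkcond mulrCA ler_wpM2l //.
have ka0 : 0 <= ka.+1%:R :> R by [].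
apply: le_trans (ler_wpM2r ka0 (bad_prime_powers M b0 K0)) _.
have sb : ((size (primes b)) <= 2 * ka.+1)%N.
  by have := size_primes_lt b0 bu; clear; lia.
have lb : ln b%:R <= (2 * ka.+1)%:R :> R.
  apply: le_trans (ln_nat_le R (ltnW bu)) _; apply: le_trans (ln_2pow R _) _.
  by rewrite ler_nat; clear; lia.
have iK : 0 <= 2 / K%:R :> R by rewrite divr_ge0.
apply: le_trans (_ : (2 * ka.+1)%:R * ((2 * ka.+1)%:R * (2 / K%:R)) * ka.+1%:R <= _).
  apply: ler_wpM2r => //; apply: ler_pM; first by [].
  - by rewrite mulr_ge0 ?ln_nat_ge0.
  - by rewrite ler_nat.
  - exact: ler_wpM2r.
have -> : (8 * ka.+1 ^ 3)%:R = 8 * ka.+1%:R ^+ 3 :> R by rewrite natrM natrX.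
by rewrite natrM; move: (ka.+1%:R : R) (K%:R^-1 : R) => u v; rewrite le_eqVlt; apply/orP; left; apply/eqP; ring.
Qed.

End PrimePowers.

(** * Exponential sums at small denominators *)

Section SmallDenominator.
Variable R : realType.
Implicit Types (a b n m k d l x K y z D U V E N M i P T p : nat) (w : R).

(** The sieve weight is 1 at powers of primes above [z]; powers of smaller primes escape the sieve
    and get the trivial bound of [hsum]. *)
Lemma vonM_sig_le b K z N M w a d : (0 < z)%N -> (2 ^ M < d <= 2 ^ N)%N -> (M <= N)%N -> 
  vonM R d * `|hsum K (2 ^ N) (cosw a b w) d| <= N%:R * (sig R b z d * `|hsum K (2 ^ N) (cosw a b w) d|)
    + (if (pdiv d <= z)%N then vonM R d else 0) * ((2 ^ (N - M))%:R * harm R K).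
Proof.
move=> z0 /andP[dM dN] MN; set h := hsum K (2 ^ N) (cosw a b w); have d0 : (0 < d)%N by apply: leq_ltn_trans dM.
have V0 := vonM_ge0 R d; have H0 := harm_ge0 R K.
have s0 : 0 <= N%:R * (sig R b z d * `|h d|) by rewrite mulr_ge0 // mulr_ge0 // sig_ge0.
have [->|/vonM_neq0[p [k [pp k0 Ed]]]] := eqVneq (vonM R d) 0.
  by rewrite if_same !mul0r addr0.
case: ifPn => hp.
  rewrite -[leLHS]add0r lerD // ler_wpM2l //.
  apply: le_trans (hsum_le _ _ d0 (cosw_le1 a b w)) _; rewrite ler_wpM2r //.
  by rewrite ler_pdivrMr ?ltr0n // -natrM ler_nat -{1}(subnK MN) expnD leq_mul2l (ltnW dM) orbT.
rewrite mul0r addr0 mulrA ler_wpM2r //.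
have -> : sig R b z d = 1.
  by move: hp; rewrite Ed pdiv_pexp // -ltnNge => hp; rewrite sig_prime_pow.
rewrite mulr1; apply: le_trans (vonM_le R d) _; apply: le_trans (ln_nat_le R dN) _; exact: ln_2pow.
Qed.

Lemma mid_sum K z N M b a w (B : R) : (0 < z)%N -> (M <= N)%N -> 0 <= B ->
  (forall i, (M <= i < N)%N -> N%:R * \sum_((2 ^ i).+1 <= d < (2 ^ i.+1).+1)
     sig R b z d * `|hsum K (2 ^ N) (cosw a b w) d| <= B) ->
  \sum_(M <= i < N) \sum_((2 ^ i).+1 <= d < (2 ^ i.+1).+1) vonM R d * `|hsum K (2 ^ N) (cosw a b w) d|
  <= (N - M)%:R * B + (z.+1 * N.+1 * N)%:R * ((2 ^ (N - M))%:R * harm R K).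
Proof.
move=> z0 MN B0 HB; set h := hsum K _ _.
set C : R := (2 ^ (N - M))%:R * harm R K; have C0 : 0 <= C by rewrite mulr_ge0 ?harm_ge0.
pose g d : R := if (pdiv d <= z)%N then vonM R d else 0.
apply: (@le_trans _ _ (\sum_(M <= i < N) (B + \sum_((2 ^ i).+1 <= d < (2 ^ i.+1).+1) g d * C))).
  apply: ler_sum_nat => i /andP[Mi iN]; rewrite -lerBlDr; apply: le_trans (HB i _); last by rewrite Mi.
  rewrite lerBlDr mulr_sumr -big_split /=; apply: ler_sum_nat => d /andP[di dj].
  apply: vonM_sig_le => //; apply/andP; split; first by apply: leq_ltn_trans di; rewrite leq_exp2l.
  by apply: leq_trans (ltnSE dj) _; rewrite leq_exp2l.
rewrite big_split /= sumr_const_nat -[B *+ _]mulr_natl lerD2l.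
under eq_bigr do rewrite -mulr_suml.
rewrite -mulr_suml ler_wpM2r //; apply: le_trans (vonM_small_primes R z N).
rewrite [leRHS]big_mkcond /= -/g (sum_dyadic g MN) lerDr.
by apply: sumr_ge0 => d _; rewrite /g; case: ifP => // _; exact: vonM_ge0.
Qed.

Lemma minor_small_denominator E m : (0 < E)%N -> exists k0, forall ka ze N a b w,
  (k0 <= ka)%N -> (ka <= ze)%N -> (16 * ze <= N)%N -> (N <= m * ze)%N ->
  coprime a b -> (2 ^ (2 * ka) <= b)%N -> (b < 2 ^ (2 * ka + 2))%N ->
  `|\sum_(1 <= d < (2 ^ N).+1) vonM R d * cosw a b w d| <= (2 ^ N)%:R / E%:R.
Proof.
move=> E0; have [k0 Hk0] := exp_beats_poly (98 * 900 * m.+1 ^ 2 * E ^ 2) 7.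
exists (k0 + 12)%N => ka ze N a b w k0ka kaze N16 Nm cab bl bu.
have {k0ka} [ka12 k0ka] : (12 <= ka)%N /\ (k0 <= ka)%N by clear - k0ka; lia.
have Hka := Hk0 _ k0ka; have Hze := Hk0 _ (leq_trans k0ka kaze).
(* Below [2 ^ M] the bound of [small_d_sum] saves a factor [2 ^ (3 * ka)]; above it there remain
   [6 * ka + 6] blocks, a number that depends on [ka] and not on [N]. *)
pose M := (N - 6 * ka - 6)%N.
have MN : (M <= N)%N by rewrite /M; clear; lia.
have EM : (N - M = 6 * ka + 6)%N by rewrite /M; clear - N16 kaze ka12; lia.
have ze12 : (12 <= ze)%N by apply: leq_trans kaze.
have K0 : (0 < 2 ^ ka)%N by rewrite expn_gt0.
have b0 : (0 < b)%N by apply: leq_trans bl; rewrite expn_gt0.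
have Kb : (2 ^ ka < b)%N by apply: leq_trans bl; rewrite ltn_exp2l //; clear - ka12; lia.
apply: le_trans (vonM_cosw_split w (2 ^ N) K0 b0 cab Kb) _.
rewrite (sum_dyadic _ MN).
have kap0 : (0 < ka)%N by apply: leq_trans ka12.
have S1 := small_d_sum w kap0 cab bl bu MN.
(* [6 * ka.+1] blocks, and five error terms [B1] to [B5] of equal share. *)
pose P := (30 * E * ka.+1)%N; have P0 : (0 < P)%N by rewrite !muln_gt0 E0.
have B0 : 0 <= (2 ^ N)%:R / P%:R :> R by rewrite divr_ge0.
have z0 : (0 < 2 ^ ze)%N by rewrite expn_gt0.
have S2 : forall i, (M <= i < N)%N -> N%:R * \sum_((2 ^ i).+1 <= d < (2 ^ i.+1).+1)
     sig R b (2 ^ ze) d * `|hsum (2 ^ ka) (2 ^ N) (cosw a b w) d| <= (2 ^ N)%:R / P%:R.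
  move=> i /andP[Mi iN]; case: (leqP (i + ka) N) => hi; last first.
    rewrite big_nat big1 ?mulr0 // => d /andP[di _]; rewrite hsum_eq0 ?normr0 ?mulr0 //.
    apply: (@leq_trans (2 ^ N %/ 2 ^ i)); first by rewrite leq_div2l ?expn_gt0 // ltnW.
    by rewrite -expnB // ?(ltnW iN) // leq_exp2l //; clear - hi; lia.
  apply: (@block_small_denominator R a b w ka ze N m i P) => //.
  - exact: leq_trans ze12.
  - apply: (@leq_trans (2 ^ ze * 2 ^ (4 * ka + 6) * 2 ^ (4 * ze))).
      rewrite -expnM [(4 * ze)%N]mulnC leq_mul // leq_mul //; first exact: ltnW (ltn_expl _ _).
      apply: leq_trans (_ : 4 * (2 ^ (2 * ka + 2)) ^ 2 <= _)%N.
        have : (b ^ 2 <= (2 ^ (2 * ka + 2)) ^ 2)%N by rewrite leq_exp2r // ltnW.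
        by have : (0 < b ^ 2)%N; [rewrite expn_gt0 b0|]; clear; lia.
      by rewrite -expnM -[4%N]/(2 ^ 2)%N -expnD leq_exp2l //; clear; lia.
    rewrite -!expnD leq_exp2l //; move: Mi; rewrite /M; clear - N16 kaze ka12 ze12; lia.
  - apply: leq_trans Hka; rewrite /P !expnMn.
    have h1 : (m ^ 2 <= m.+1 ^ 2)%N by rewrite leq_exp2r.
    have h2 : ((4 * ka + 7) ^ 2 <= (7 * ka.+1) ^ 2)%N by rewrite leq_exp2r //; clear; lia.
    apply: leq_trans (_ : 2 * m.+1 ^ 2 * (7 * ka.+1) ^ 2 * ka.+1 ^ 3 * (30 ^ 2 * E ^ 2 * ka.+1 ^ 2) <= _)%N.
      by rewrite leq_mul // leq_mul // leq_mul // leq_mul.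
    by rewrite expnMn; apply: eq_leq; move: (m.+1) (ka.+1) => u v; clear; ring.
have {S2} S2 := mid_sum z0 MN B0 S2.
rewrite EM in S2.
move: S1 S2; set T1 := (X in X <= _) => S1; set T2 := (X in X <= _) => S2.
set x : R := (2 ^ N)%:R; have x0 : 0 <= x by [].
have e0 : 0 < 5 * E%:R :> R by rewrite mulr_gt0 ?ltr0n.
have nat_le u : (5 * E * u <= 2 ^ N)%N -> u%:R <= x / (5 * E%:R).
  by move=> h; rewrite ler_pdivlMr // mulrC -!natrM ler_nat.
have poly : (5 * E * m.+1 ^ 2 * ze.+1 ^ 3 <= 2 ^ ze)%N.
  apply: leq_trans Hze; rewrite [(ze.+1 ^ 7)%N](expnD _ 3 4) mulnA.
  have h : (0 < ze.+1 ^ 4)%N by rewrite expn_gt0.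
  apply: leq_trans (leq_pmulr _ h); rewrite leq_mul2r; apply/orP; right.
  move: (m.+1 ^ 2)%N => u; have : (E * u <= E * E * u)%N by rewrite -mulnA leq_pmull.
  rewrite -mulnn; clear; nia.
have B1 : (2 ^ ka)%:R * (ln (2 ^ N)%:R * (2 * b%:R)) <= x / (5 * E%:R).
  apply: le_trans (_ : (2 ^ ka * (N * (2 * b)))%:R <= _).
    rewrite !natrM ler_wpM2l // ler_wpM2r ?mulr_ge0 //; exact: ln_2pow.
  apply: nat_le; apply: leq_trans (_ : 2 ^ ze * 2 ^ (3 * ze + 3) <= _)%N; last first.
    by rewrite -expnD leq_exp2l //; clear - N16 ze12; lia.
  apply: leq_trans (_ : (5 * E * m.+1 ^ 2 * ze.+1 ^ 3) * (2 ^ (3 * ze + 3)) <= _)%N; last first.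
    by rewrite leq_mul2r poly orbT.
  have hb : (2 ^ ka * (2 * b) <= 2 ^ (3 * ze + 3))%N.
    apply: leq_trans (_ : 2 ^ ka * (2 * 2 ^ (2 * ka + 2)) <= _)%N.
      by rewrite leq_mul // leq_mul // ltnW.
    by rewrite -expnS -expnD leq_exp2l //; clear - kaze; lia.
  have hN : (N <= m.+1 ^ 2 * ze.+1 ^ 3)%N.
    have hp u k : (u <= u.+1 ^ k.+1)%N by apply: ltnW; rewrite expnS leq_pmulr // expn_gt0.
    by apply: leq_trans Nm _; apply: leq_mul.
  rewrite [(2 ^ ka * _)%N]mulnCA !mulnA -!(mulnA (5 * E)) leq_mul2l; apply/orP; right.
  by move: (leq_mul hN hb); rewrite !mulnA.
have B2 : (2 ^ (M + 3 * ka + 6))%:R <= x / (5 * E%:R).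
  apply: nat_le; apply: leq_trans (_ : 2 ^ ka * 2 ^ (M + 3 * ka + 6) <= _)%N.
    rewrite leq_mul2r; apply/orP; right; apply: leq_trans Hka.
    have h : (0 < m.+1 ^ 2 * ka.+1 ^ 7)%N by rewrite muln_gt0 !expn_gt0.
    apply: leq_trans (_ : 98 * 900 * E ^ 2 * (m.+1 ^ 2 * ka.+1 ^ 7) <= _)%N; last by apply: eq_leq; ring.
    apply: leq_trans (leq_pmulr _ h); rewrite -mulnn.
    by have : (E <= E * E)%N by [rewrite leq_pmull]; clear; nia.
  by rewrite -expnD leq_exp2l //; rewrite /M; clear - N16 kaze ka12 ze12; lia.
have B3 : x * ((8 * ka.+1 ^ 3)%:R / (2 ^ ka)%:R) <= x / (5 * E%:R).
  rewrite ler_wpM2l // ler_pdivrMr ?ltr0n // mulrC ler_pdivlMr // -!natrM ler_nat.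
  apply: leq_trans Hka; rewrite [(ka.+1 ^ 7)%N](expnD _ 3 4).
  have h : (0 < m.+1 ^ 2 * ka.+1 ^ 4)%N by rewrite muln_gt0 !expn_gt0.
  apply: leq_trans (_ : 98 * 900 * E ^ 2 * ka.+1 ^ 3 * (m.+1 ^ 2 * ka.+1 ^ 4) <= _)%N; last by apply: eq_leq; ring.
  apply: leq_trans (leq_pmulr _ h); rewrite -mulnn.
  move: (ka.+1 ^ 3)%N => u; have : (E * u <= E * E * u)%N by rewrite -mulnA leq_pmull.
  by clear; nia.
have B4 : (6 * ka + 6)%:R * ((2 ^ N)%:R / P%:R) <= x / (5 * E%:R).
  rewrite -/x mulrCA ler_wpM2l // ler_pdivrMr ?ltr0n // mulrC ler_pdivlMr // -!natrM ler_nat.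
  by rewrite /P; clear; nia.
have B5 : ((2 ^ ze).+1 * N.+1 * N)%:R * ((2 ^ (6 * ka + 6))%:R * harm R (2 ^ ka)) <= x / (5 * E%:R).
  apply: le_trans (_ : ((2 ^ ze).+1 * N.+1 * N * (2 ^ (6 * ka + 6) * ka.+1))%:R <= _).
    by rewrite [leRHS]natrM ler_wpM2l // [leRHS]natrM ler_wpM2l // harm_2pow.
  apply: nat_le.
  apply: leq_trans (_ : 5 * E * (2 ^ ze.+1 * (m.+1 * ze.+1) * (m.+1 * ze.+1) * (2 ^ (6 * ze + 6) * ze.+1)) <= _)%N.
    rewrite leq_mul2l; apply/orP; right.
    have h1 : ((2 ^ ze).+1 <= 2 ^ ze.+1)%N by rewrite expnS; clear - z0; lia.
    have h2 : (N.+1 <= m.+1 * ze.+1)%N by clear - Nm; nia.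
    have h3 : (2 ^ (6 * ka + 6) <= 2 ^ (6 * ze + 6))%N by rewrite leq_exp2l //; clear - kaze; lia.
    rewrite leq_mul //; last by rewrite leq_mul.
    by rewrite leq_mul // ?(ltnW h2) // leq_mul.
  apply: leq_trans (_ : (5 * E * m.+1 ^ 2 * ze.+1 ^ 3) * (2 ^ ze.+1 * 2 ^ (6 * ze + 6)) <= _)%N.
    by apply: eq_leq; move: (m.+1) (2 ^ ze.+1)%N (2 ^ (6 * ze + 6))%N (ze.+1) => u v s t; clear; ring.
  apply: leq_trans (leq_mul poly (leqnn _)) _.
  by rewrite -!expnD leq_exp2l //; clear - N16 ze12; lia.
have -> : x / E%:R = x / (5 * E%:R) * 5.
  by field; rewrite pnatr_eq0 -lt0n.
apply: le_trans (lerD B1 (lerD (le_trans S1 (lerD B2 B3)) (le_trans S2 (lerD B4 B5)))) _.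
by move: (x / (5 * _)) => q; clear; lra.
Qed.

End SmallDenominator.

(** * One block for large denominators *)

Section PlainBlock.
Variable R : realType.
Implicit Types (a b n m k d l x K y z D U V E N M i P T p : nat) (w : R).

(** Here the saving is about [2 ^ (ze / 2)], and [ze] is proportional to [N] in the application: the
    bound [N] for [Lambda] and all other powers of [N] are affordable. *)
Lemma block_large_denominator a b w ze N i P : coprime a b -> (0 < ze)%N -> (0 < P)%N ->
  (2 ^ (2 * ze) <= b)%N -> (b * 2 ^ (4 * ze) <= 2 ^ N)%N -> (ze <= i.+1)%N -> (i + ze <= N)%N ->
  (14 * ze.+1 ^ 3 * N.+1 ^ 3 * P ^ 2 <= 2 ^ ze)%N ->
  N%:R * \sum_((2 ^ i).+1 <= d < (2 ^ i.+1).+1) `|hsum (2 ^ ze) (2 ^ N) (cosw a b w) d|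
  <= (2 ^ N)%:R / P%:R.
Proof.
move=> cab ze0 P0 bl bu zi iN Hp; set h := hsum _ _ _.
have b0 : (0 < b)%N by apply: leq_trans bl; rewrite expn_gt0.
have D0 : (0 < 2 ^ i)%N by rewrite expn_gt0.
have iN' : (i <= N)%N by clear - iN; lia.
have yD : (2 ^ (N - i) * 2 ^ i = 2 ^ N)%N by rewrite -expnD subnK.
have Hb : \sum_((2 ^ i).+1 <= d < (2 ^ i.+1).+1) h d ^+ 2 <= (2 ^ (N - i))%:R * harm R (2 ^ ze) ^+ 3 *
  (((2 ^ (N - i))%:R / b%:R + 1) * ((2 ^ i)%:R + 4 * b%:R * harm R b)).
  have E2 : (2 ^ i = 2 ^ i.+1 - 2 ^ i)%N by rewrite expnS mul2n -addnn addnK.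
  rewrite [X in X%:R + _]E2; apply: block_plain => //; last by rewrite leq_exp2l.
  apply: leq_trans (_ : 2 ^ N %/ 2 ^ i <= _)%N; first by rewrite leq_div2l.
  by rewrite -expnB.
have [N0|N0] := posnP N.
  by rewrite N0 mul0r divr_ge0.
have nn : 0 <= (2 ^ N)%:R / P%:R / N%:R :> R by rewrite !divr_ge0.
rewrite mulrC -ler_pdivlMr ?ltr0n //; apply: le_of_sqr => //.
have := @cauchy_weighted R (index_iota (2 ^ i).+1 (2 ^ i.+1).+1) (fun=> 1) h (fun=> ler01).
rewrite (eq_bigr (fun d => `|h d|)); last by move=> *; rewrite mul1r.
rewrite [X in _ * X](eq_bigr (fun d => h d ^+ 2)); last by move=> *; rewrite mul1r.
move/le_trans; apply; rewrite sumr_const_nat.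
have -> : 1 *+ ((2 ^ i.+1).+1 - (2 ^ i).+1) = (2 ^ i)%:R :> R.
  by rewrite subSS expnS mul2n -addnn addnK.
apply: le_trans (ler_wpM2l (ler0n R _) Hb) _.
have hb : harm R b <= N.+1%:R.
  apply: le_trans (harm_2pow R N); apply: harm_mono; apply: leq_trans bu.
  by rewrite leq_pmulr // expn_gt0.
have hb0 := harm_ge0 R b.
have H3 := harm3_2pow R ze.
have H0 : 0 <= harm R (2 ^ ze) ^+ 3 by rewrite exprn_ge0 ?harm_ge0.
set x : R := (2 ^ N)%:R; set y : R := (2 ^ (N - i))%:R; set D : R := (2 ^ i)%:R; set B : R := b%:R.
set Z : R := (2 ^ ze)%:R; set H := harm _ _ ^+ 3 in H3 H0 *; set hh := harm R b in hb hb0 *.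
have Z0 : 0 < Z by rewrite ltr0n expn_gt0.
have x0 : 0 < x by rewrite ltr0n expn_gt0.
have B0 : 0 < B by rewrite ltr0n.
have xyD : y * D = x by rewrite /y /D -natrM yD.
have x1 : x / B <= x / Z.
  rewrite ler_wpM2l // ?(ltW x0) // lef_pV2 ?posrE // ler_nat.
  by apply: leq_trans bl; rewrite leq_exp2l // mul2n -addnn leq_addr.
have x2 : D <= x / Z.
  by rewrite ler_pdivlMr // -natrM ler_nat -expnD leq_exp2l.
have x3 : y <= 2 * (x / Z).
  rewrite mulrA ler_pdivlMr // -!natrM ler_nat -expnD -expnS leq_exp2l //; clear - zi iN'; lia.
have x4 : B <= x / Z.
  rewrite ler_pdivlMr // -natrM ler_nat; apply: leq_trans bu.
  by rewrite leq_mul2l leq_exp2l // leq_pmull // orbT.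
have -> : D * (y * H * ((y / B + 1) * (D + 4 * B * hh)))
   = H * (x * (x / B + D + 4 * y * hh + 4 * B * hh)).
  by rewrite -xyD; field; rewrite gt_eqF.
apply: le_trans (_ : (ze.+1 ^ 3)%:R * (x * (x / Z * (14 * N.+1%:R))) <= _).
  have nonneg : 0 <= x / B + D + 4 * y * hh + 4 * B * hh.
    have [y0 D0'] : 0 <= y /\ 0 <= D by [].
    have := mulr_ge0 y0 hb0; have := mulr_ge0 (ltW B0) hb0; have := divr_ge0 (ltW x0) (ltW B0).
    by move: (x / B) D0' => *; lra.
  apply: ler_pM => //; first by rewrite mulr_ge0 // ltW.
  rewrite ler_wpM2l ?(ltW x0) //.
  have N1 : 1 <= N.+1%:R :> R by rewrite ler1n.
  move: (N.+1%:R : R) N1 hb => n N1 hb; move: (x / Z) x1 x2 x3 x4 => q x1 x2 x3 x4.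
  have q0 : 0 <= q by apply: le_trans x4; exact: ltW.
  have y0 : 0 <= y by [].
  have e1 : y * hh <= 2 * q * n by apply: ler_pM.
  have e2 : B * hh <= q * n by apply: ler_pM => //; exact: ltW.
  have e3 : q <= q * n by rewrite ler_peMr.
  have -> : x / B + D + 4 * y * hh + 4 * B * hh = x / B + D + 4 * (y * hh) + 4 * (B * hh) by rewrite !mulrA.
  have -> : q * (14 * n) = 14 * (q * n) by ring.
  rewrite -mulrA in e1; move: x1 e1 e2 e3; move: (x / B) (y * hh) (B * hh) (q * n).
  clear - x2 q0; move: D x2 => D *. lra.
rewrite -/x; have -> : (ze.+1 ^ 3)%:R * (x * (x / Z * (14 * N.+1%:R)))
  = x ^+ 2 * ((14 * ze.+1 ^ 3 * N.+1)%:R / Z) by rewrite !natrM; field; rewrite gt_eqF.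
rewrite !exprMn -[leRHS]mulrA ler_wpM2l ?sqr_ge0 // -exprMn -invfM expr2 -invfM.
rewrite ler_pdivrMr // mulrC ler_pdivlMr; last by rewrite !mulr_gt0 ?ltr0n.
rewrite -!natrM ler_nat; apply: leq_trans Hp.
have h2 : (N * N <= N.+1 ^ 2)%N by rewrite mulnn leq_exp2r.
apply: leq_trans (_ : 14 * ze.+1 ^ 3 * N.+1 * P ^ 2 * (N * N) <= _)%N.
  by apply: eq_leq; move: (N.+1) (ze.+1 ^ 3)%N => u v; clear; ring.
apply: leq_trans (leq_mul (leqnn _) h2) _; apply: eq_leq.
by move: (N.+1) (ze.+1 ^ 3)%N => u v; clear; ring.
Qed.

End PlainBlock.

(** * Exponential sums at large denominators, and both ranges together *)

Section MinorArcs.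
Variable R : realType.
Implicit Types (a b n m k d l x K y z D U V E N M i P T p : nat) (w : R).

Lemma minor_large_denominator E m : (0 < E)%N -> exists k0, forall ze N a b w,
  (k0 <= ze)%N -> (N <= m * ze)%N ->
  coprime a b -> (2 ^ (2 * ze) <= b)%N -> (b * 2 ^ (4 * ze) <= 2 ^ N)%N ->
  `|\sum_(1 <= d < (2 ^ N).+1) vonM R d * cosw a b w d| <= (2 ^ N)%:R / E%:R.
Proof.
move=> E0; have [k0 Hk0] := exp_beats_poly (126 * E ^ 2 * m.+1 ^ 5) 8.
exists (k0 + 1)%N => ze N a b w k0ze Nm cab bl bu.
have {k0ze} [ze0 /Hk0 Hze] : (0 < ze)%N /\ (k0 <= ze)%N by clear - k0ze; lia.
have K0 : (0 < 2 ^ ze)%N by rewrite expn_gt0.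
have b0 : (0 < b)%N by apply: leq_trans bl; rewrite expn_gt0.
have N6 : (6 * ze <= N)%N.
  rewrite -(leq_exp2l (m := 2)) //; apply: leq_trans bu; apply: leq_trans (leq_mul bl (leqnn _)).
  by rewrite -expnD leq_exp2l // -mulnDl.
have N0 : (0 < N)%N by clear - N6 ze0; lia.
have N1 : (N.+1 <= m.+1 * ze.+1)%N by clear - Nm; nia.
have Kb : (2 ^ ze < b)%N by apply: leq_trans bl; rewrite ltn_exp2l //; clear - ze0; lia.
apply: le_trans (vonM_cosw_split w (2 ^ N) K0 b0 cab Kb) _.
(* For [d <= 2 ^ ze.-1] and [k <= 2 ^ ze] the product is below [2 ^ (2 * ze) <= b], so [hsum_small]
   covers all these [d]. *)
have MN : (ze.-1 <= N)%N by clear - N6; lia.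
rewrite (sum_dyadic _ MN).
pose P := (3 * E * N)%N; have P0 : (0 < P)%N by rewrite !muln_gt0 E0.
set x : R := (2 ^ N)%:R.
have EN : (126 * E ^ 2 * N.+1 ^ 5 * ze.+1 ^ 3 <= 2 ^ ze)%N.
  apply: leq_trans Hze; rewrite [(ze.+1 ^ 8)%N](expnD _ 5 3) mulnA leq_mul2r; apply/orP; right.
  by rewrite -[leqRHS]mulnA leq_mul2l -expnMn leq_exp2r // N1 orbT.
have S2 : \sum_(ze.-1 <= i < N) \sum_((2 ^ i).+1 <= d < (2 ^ i.+1).+1)
    vonM R d * `|hsum (2 ^ ze) (2 ^ N) (cosw a b w) d| <= (N - ze.-1)%:R * (x / P%:R).
  rewrite mulr_natl -sumr_const_nat; apply: ler_sum_nat => i /andP[zi iN].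
  case: (leqP (i + ze) N) => hi; last first.
    rewrite big_nat big1 ?divr_ge0 // => d /andP[di _]; rewrite hsum_eq0 ?normr0 ?mulr0 //.
    apply: (@leq_trans (2 ^ N %/ 2 ^ i)); first by rewrite leq_div2l ?expn_gt0 // ltnW.
    by rewrite -expnB // ?(ltnW iN) // leq_exp2l //; clear - hi; lia.
  apply: le_trans (_ : N%:R * \sum_((2 ^ i).+1 <= d < (2 ^ i.+1).+1)
     `|hsum (2 ^ ze) (2 ^ N) (cosw a b w) d| <= _).
    rewrite mulr_sumr; apply: ler_sum_nat => d /andP[di dj]; rewrite ler_wpM2r //.
    apply: le_trans (vonM_le R d) _; apply: le_trans (ln_nat_le R (_ : d <= 2 ^ N)%N) (ln_2pow R N).
    by apply: leq_trans (ltnSE dj) _; rewrite leq_exp2l.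
  apply: block_large_denominator => //; first by clear - zi; lia.
  apply: leq_trans EN; rewrite /P.
  have h : (N ^ 2 <= N.+1 ^ 2)%N by rewrite leq_exp2r.
  apply: leq_trans (_ : 126 * E ^ 2 * ze.+1 ^ 3 * N.+1 ^ 3 * N ^ 2 <= _)%N.
    by apply: eq_leq; move: (N.+1) (ze.+1 ^ 3)%N => u v; clear; ring.
  apply: leq_trans (leq_mul (leqnn _) h) _; apply: eq_leq.
  by move: (N.+1) (ze.+1 ^ 3)%N => u v; clear; ring.
have S1 : \sum_(1 <= d < (2 ^ ze.-1).+1) vonM R d * `|hsum (2 ^ ze) (2 ^ N) (cosw a b w) d|
    <= (6 * 2 ^ (2 * ze) * b)%:R.
  apply: le_trans (_ : 4 * (2 ^ ze.-1)%:R * (3 * 2 ^ ze * b)%:R <= _); last first.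
    rewrite -!natrM ler_nat mul2n -addnn expnD -{3}(prednK ze0) expnS.
    by apply: eq_leq; move: (2 ^ ze)%N (2 ^ ze.-1)%N => u v; clear; ring.
  apply: le_trans (ler_wpM2r _ (psi_bound R _)); last by [].
  rewrite /psi mulr_suml; apply: ler_sum_nat => d /andP[d0 dM]; rewrite ler_wpM2l ?vonM_ge0 //.
  have -> : (3 * 2 ^ ze * b)%:R = (2 ^ ze)%:R * (2 * b%:R) + (2 ^ ze * b)%:R :> R by rewrite !natrM; ring.
  have dx : (d <= 2 ^ ze.-1)%N by [].
  apply: le_trans (hsum_small w b0 cab K0 d0 _ _) _.
  - by apply: leq_trans dx _; rewrite leq_exp2l.
  - move=> j /andP[j0 jK]; apply/negP => /dvdn_leq; rewrite muln_gt0 j0 d0 => /(_ isT).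
    apply/negP; rewrite -ltnNge; apply: leq_ltn_trans (leq_mul jK dx) _; apply: leq_trans bl.
    by rewrite -expnD ltn_exp2l //; clear - ze0; lia.
  - by rewrite lerD2l ler1n muln_gt0 K0.
have e0 : 0 < 3 * E%:R :> R by rewrite mulr_gt0 ?ltr0n.
have nat_le u : (3 * E * u <= 2 ^ N)%N -> u%:R <= x / (3 * E%:R).
  by move=> h; rewrite ler_pdivlMr // mulrC -!natrM ler_nat.
have poly : (18 * E * N <= 2 ^ ze)%N.
  apply: leq_trans EN; have h : (0 < N.+1 ^ 4 * ze.+1 ^ 3)%N by rewrite muln_gt0 !expn_gt0.
  apply: leq_trans (_ : 126 * E ^ 2 * N.+1 * (N.+1 ^ 4 * ze.+1 ^ 3) <= _)%N; last first.
    by apply: eq_leq; move: (N.+1) (ze.+1 ^ 3)%N => u v; clear; ring.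
  apply: leq_trans (leq_pmulr _ h); rewrite -mulnn; clear - E0; nia.
have B1 : (2 ^ ze)%:R * (ln (2 ^ N)%:R * (2 * b%:R)) <= x / (3 * E%:R).
  apply: le_trans (_ : (2 ^ ze * (N * (2 * b)))%:R <= _).
    rewrite !natrM ler_wpM2l // ler_wpM2r ?mulr_ge0 //; exact: ln_2pow.
  apply: nat_le; apply: leq_trans bu; apply: leq_trans (_ : b * (2 ^ ze * (18 * E * N)) <= _)%N.
    by move: (2 ^ ze)%N => u; clear; nia.
  apply: leq_trans (_ : b * (2 ^ ze * 2 ^ ze) <= _)%N; first by rewrite leq_mul // leq_mul.
  by rewrite -expnD leq_mul // leq_exp2l //; clear; lia.
have B2 : (6 * 2 ^ (2 * ze) * b)%:R <= x / (3 * E%:R).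
  apply: nat_le; apply: leq_trans bu; apply: leq_trans (_ : b * (2 ^ (2 * ze) * (18 * E * N)) <= _)%N.
    by move: (2 ^ (2 * ze))%N => u; clear - N0; nia.
  apply: leq_trans (_ : b * (2 ^ (2 * ze) * 2 ^ ze) <= _)%N; first by rewrite leq_mul // leq_mul.
  by rewrite -expnD leq_mul // leq_exp2l //; clear; lia.
have B3 : (N - ze.-1)%:R * (x / P%:R) <= x / (3 * E%:R).
  rewrite mulrCA ler_wpM2l // ler_pdivrMr ?ltr0n // mulrC ler_pdivlMr // -!natrM ler_nat.
  by rewrite /P [leqRHS]mulnC leq_mul // leq_subr.
have -> : x / E%:R = x / (3 * E%:R) * 3.
  by field; rewrite pnatr_eq0 -lt0n.
apply: le_trans (lerD B1 (lerD (le_trans S1 B2) (le_trans S2 B3))) _.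
by move: (x / (3 * _)) => q; clear; lra.
Qed.

Lemma minor_arc_bound E m : (0 < E)%N -> exists B0 ze0, forall ze N a b w,
  (ze0 <= ze)%N -> (16 * ze <= N)%N -> (N <= m * ze)%N ->
  coprime a b -> (B0 <= b)%N -> (b * 2 ^ (4 * ze) <= 2 ^ N)%N ->
  `|\sum_(1 <= d < (2 ^ N).+1) vonM R d * cosw a b w d| <= (2 ^ N)%:R / E%:R.
Proof.
move=> E0; have [k1 H1] := minor_small_denominator R m E0.
have [k2 H2] := minor_large_denominator m E0.
(* The threshold for [b] forces [ka], half of its binary logarithm, to be at least [k1]. *)
exists (2 ^ (2 * k1 + 2))%N, k2 => ze N a b w kze N16 Nm cab Bb bu.
have [hb|hb] := leqP (2 ^ (2 * ze)) b; first exact: (H2 ze).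
have b0 : (0 < b)%N by apply: leq_trans Bb; rewrite expn_gt0.
pose ka := (trunc_log 2 b)./2.
have /andP[t1 t2] : (2 ^ trunc_log 2 b <= b < 2 ^ (trunc_log 2 b).+1)%N by exact: trunc_log_bounds.
have E1 : (2 * ka <= trunc_log 2 b)%N by rewrite /ka; clear; lia.
have E2 : (trunc_log 2 b <= 2 * ka + 1)%N by rewrite /ka; clear; lia.
have c1 : (2 ^ (2 * ka) <= b)%N by apply: leq_trans t1; rewrite leq_exp2l.
have c2 : (b < 2 ^ (2 * ka + 2))%N by apply: leq_trans t2 _; rewrite leq_exp2l // (addnS _ 1) ltnS.
have k1ka : (k1 <= ka)%N.
  have := leq_ltn_trans Bb c2; rewrite ltn_exp2l //; clear; lia.
have kaze : (ka <= ze)%N.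
  have := leq_ltn_trans c1 hb; rewrite ltn_exp2l //; clear; lia.
exact: (H1 ka ze).
Qed.

End MinorArcs.

(** * Sums over residue classes *)
Section Identities.
Variable R : realType.
Implicit Types (n m k d x y : nat) (f : nat -> R).

Lemma ln_vonM_identity x f : \sum_(1 <= m < x.+1) ln m%:R * f m
  = \sum_(1 <= d < x.+1) vonM R d * \sum_(1 <= n < (x %/ d).+1) f (d * n)%N.
Proof.
have := vaughan_identity 1 x f; rewrite big_nat1 mu1 mul1r divn1.
under eq_bigr do rewrite mul1n; move=> ->.
apply: eq_big_nat => d _; congr (_ * _); apply: eq_bigr => n _.
by rewrite /MK big_mkcond big_nat1 dvd1n mu1 mul1r.
Qed.

Lemma sum_MK_full x f : (0 < x)%N -> \sum_(1 <= n < x.+1) MK R x n * f n = f 1%N.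
Proof.
move=> x0; rewrite big_ltn // MK1 // mul1r big_nat big1 ?addr0 // => n /andP[n1 nx].
by rewrite MK_small // ?mul0r.
Qed.

(** Write [ln k = ln (k m) - ln m]. Moebius inversion sends the part with [ln (k m)] to [ln 1 = 0],
    and the part with [ln m] to the sum over [Lambda]. *)
Lemma mu_ln_identity x f : (0 < x)%N ->
  \sum_(1 <= k < x.+1) mu R k * ((ln x%:R - ln k%:R) * \sum_(1 <= m < (x %/ k).+1) f (k * m)%N)
  = ln x%:R * f 1%N + \sum_(1 <= d < x.+1) vonM R d * f d.
Proof.
move=> x0.
have H1 : \sum_(1 <= k < x.+1) mu R k * \sum_(1 <= m < (x %/ k).+1) f (k * m)%N = f 1%N.
  by rewrite -sum_MK sum_MK_full.
have H2 : \sum_(1 <= k < x.+1) mu R k * \sum_(1 <= m < (x %/ k).+1) ln (k * m)%:R * f (k * m)%N = 0.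
  by rewrite -(sum_MK _ _ (fun n => ln n%:R * f n)) sum_MK_full // ln1 mul0r.
have H3 : \sum_(1 <= k < x.+1) mu R k * \sum_(1 <= m < (x %/ k).+1) ln m%:R * f (k * m)%N
   = \sum_(1 <= d < x.+1) vonM R d * f d.
  rewrite vaughan_identity; apply: eq_big_nat => d /andP[d0 dx]; congr (_ * _).
  have q0 : (0 < x %/ d)%N by rewrite divn_gt0.
  rewrite big_ltn // MK1 // mul1r muln1 big_nat big1 ?addr0 // => n /andP[n1 nx].
  by rewrite MK_small ?mul0r //; apply: leq_trans (leq_div x d).
rewrite -H3 -[in ln x%:R * _]H1 mulr_sumr -[RHS]subr0 -[X in _ = _ - X]H2 -big_split -sumrB /=.
apply: eq_big_nat => k /andP[k0 kx].
have -> : \sum_(1 <= m < (x %/ k).+1) ln (k * m)%:R * f (k * m)%N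
  = ln k%:R * \sum_(1 <= m < (x %/ k).+1) f (k * m)%N
    + \sum_(1 <= m < (x %/ k).+1) ln m%:R * f (k * m)%N.
  rewrite mulr_sumr -big_split /=; apply: eq_big_nat => m /andP[m0 _].
  by rewrite natrM lnM ?posrE ?ltr0n // mulrDl.
ring.
Qed.

Lemma abel_decr (a c : nat -> R) (B : R) i n : (forall m, (i <= m)%N -> a m.+1 <= a m) ->
  (forall m, (i <= m)%N -> 0 <= a m) ->
  (forall i j, `|\sum_(i <= m < j) c m| <= B) ->
  `|\sum_(i <= m < n) a m * c m| <= 2 * (a i * B).
Proof.
move=> da a0 cB; have B0 : 0 <= B by apply: le_trans (cB 0%N 0%N).
have ai0 := a0 i (leqnn i).
case: (leqP n i) => h; first by rewrite big_geq // normr0 mulr_ge0 // mulr_ge0.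
case: n h => // n h.
have := @abel_bound R (fun m => - a m) c B i n h _ (cB^~ n.+1).
have -> : \sum_(i <= m < n.+1) - a m * c m = - \sum_(i <= m < n.+1) a m * c m.
  by rewrite -sumrN; apply: eq_bigr => *; rewrite mulNr.
move=> /(_ _)/Wrap[]; first by move=> m im; rewrite lerN2 da.
have := cB i n.+1; have := a0 n h.
move: (\sum_(i <= m < n.+1) c m) (\sum_(i <= m < n.+1) _ * _) => C S an0 hC H.
have : `|a i * C| <= a i * B by rewrite normrM (ger0_norm ai0) ler_wpM2l.
have : 0 <= a n * B by rewrite mulr_ge0.
move: H; rewrite !ler_norml => /andP[p1 p2] p3 /andP[p4 p5].
by apply/andP; split; lra.
Qed.

(** The range starts at 4 because [ln n >= 1] is wanted and [ln 4 >= 1] follows from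
    [ln 2 >= 1 / 2]. *)
Lemma ln_div_decr n : (4 <= n)%N -> ln n.+1%:R / n.+1%:R <= ln n%:R / n%:R :> R.
Proof.
move=> n4; have n0 : (0 < n)%N by apply: leq_trans n4.
have n0' : 0 < n%:R :> R by rewrite ltr0n.
rewrite ler_pdivrMr ?ltr0n // mulrAC ler_pdivlMr // -natr1.
have : 1 <= ln n%:R :> R.
  apply: le_trans (ln_nat_le R n4); rewrite (_ : 4%:R = 2 * 2 :> R) -?natrM //.
  by rewrite natrM lnM ?posrE //; have := ln2_ge_half R; lra.
have := ln_diff_le R n0; rewrite -(ler_pM2r n0') mulVf ?gt_eqF //.
by rewrite -natr1; nra.
Qed.

Definition bounded_seq (F : nat -> R) := exists C : R, forall x, `|F x| <= C.

Lemma bounded_seqD F G : bounded_seq F -> bounded_seq G -> bounded_seq (fun x => F x + G x).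
Proof.
by move=> [C HC] [D HD]; exists (C + D) => x; apply: le_trans (ler_normD _ _) _; exact: lerD.
Qed.

Lemma bounded_seqZ c F : bounded_seq F -> bounded_seq (fun x => c * F x).
Proof. by move=> [C HC]; exists (`|c| * C) => x; rewrite normrM ler_wpM2l. Qed.

Lemma bounded_seq_sum (I : finType) (P : pred I) (F : I -> nat -> R) : (forall i, P i -> bounded_seq (F i)) ->
  bounded_seq (fun x => \sum_(i | P i) F i x).
Proof.
move=> H; have [C HC] : exists C : I -> R, forall i, P i -> forall x, `|F i x| <= C i.
  have : forall i, exists c, P i -> forall x, `|F i x| <= c.
    move=> i; case: (boolP (P i)) => [/H[c Hc]|_]; first by exists c.
    by exists 0.
  by move=> hh; have [C HC] := boolp.choice hh; exists C => i Pi x; exact: HC.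
exists (\sum_(i | P i) C i) => x; apply: le_trans (ler_norm_sum _ _ _) _.
by apply: ler_sum => i Pi; exact: HC.
Qed.

Lemma bounded_seq_eq F G : F =1 G -> bounded_seq F -> bounded_seq G.
Proof. by move=> E [C HC]; exists C => x; rewrite -E. Qed.

Lemma ln_unbounded c : bounded_seq (fun x => c * ln x%:R) -> c = 0.
Proof.
move=> [C HC]; apply/eqP; rewrite -normr_le0 leNgt; apply/negP => c0.
have [n Hn] : exists n, C / `|c| * 2 < n%:R.
  exists (Num.truncn (C / `|c| * 2)).+1; exact: truncnS_gt.
have := HC (2 ^ n)%N; rewrite normrM (ger0_norm (ln_nat_ge0 _ _)) natrX lnXn //.
rewrite mulrC -ler_pdivlMr // -[ln 2 *+ _]mulr_natl => h.
by have := ler_wpM2l (ler0n R n) (ln2_ge_half R); move: h Hn; lra.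
Qed.

End Identities.

(** * Functions on the units modulo q and their series *)

Section UnitFunctions.
Variable R : realType.
Variable q : nat.
Hypothesis q1 : (1 < q)%N.
Local Notation G := {unit 'Z_q}.
Implicit Types (n m k d x y i j : nat) (v w : G -> R) (g h : G).

(** The [q]-periodic extension of [v] to the integers, zero off the units; for a character, the
    Dirichlet character. *)
Definition hat v n : R := \sum_(g : G | FinRing.uval g == n%:R) v g.
Definition shift v g : G -> R := fun h => v (g * h)%g.
Definition norm1 v : R := \sum_g `|v g|.
Definition sum_zero v := \sum_g v g = 0.

Lemma hatE v g n : FinRing.uval g = n%:R -> hat v n = v g.
Proof.
move=> E; rewrite /hat -E; apply: big_pred1 => h /=.
by apply/eqP/eqP => [/val_inj|->].
Qed.

Lemma hat_nunit v n : (n%:R : 'Z_q) \isn't a GRing.unit -> hat v n = 0.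
Proof.
by move=> nu; rewrite /hat big1 // => g /eqP E; case/negP: nu; rewrite -E; exact: (valP g).
Qed.

Lemma unit_class n : (n%:R : 'Z_q) \is a GRing.unit -> exists g : G, FinRing.uval g = n%:R.
Proof. by move=> u; exists (FinRing.unit _ u). Qed.

Lemma hat_le v n : `|hat v n| <= norm1 v.
Proof.
apply: le_trans (ler_norm_sum _ _ _) _; rewrite /norm1 [leRHS](bigID (fun g => FinRing.uval g == n%:R)) /=.
by rewrite lerDl sumr_ge0.
Qed.

Lemma hat_mod v n : hat v (n %% q) = hat v n.
Proof.
rewrite /hat; apply: eq_bigl => g; congr (_ == _); apply: val_inj.
by rewrite /= !val_Zp_nat // modn_mod.
Qed.

Lemma hat_mul v g d m : FinRing.uval g = d%:R -> hat v (d * m) = hat (shift v g) m.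
Proof.
move=> E; have ug : (d%:R : 'Z_q) \is a GRing.unit by rewrite -E; exact: (valP g).
case: (boolP ((m%:R : 'Z_q) \is a GRing.unit)) => [/unit_class[h Eh]|nu].
  rewrite (hatE (shift v g) Eh) (@hatE v (g * h)%g) //.
  by rewrite (_ : FinRing.uval (g * h)%g = FinRing.uval g * FinRing.uval h) // E Eh natrM.
rewrite (hat_nunit (shift v g) nu) hat_nunit // natrM unitrM ug /=.
exact: nu.
Qed.

Lemma hat_mul_nunit v d m : (d%:R : 'Z_q) \isn't a GRing.unit -> hat v (d * m) = 0.
Proof. by move=> nu; rewrite hat_nunit // natrM unitrM negb_and nu. Qed.

Lemma hat_sum_period v i : \sum_(i <= m < i + q) hat v m = \sum_g v g.
Proof.
have q0 : (0 < q)%N by apply: ltnW.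
rewrite (eq_bigr (fun m => hat v (((m + 0) * 1) %% q))); last first.
  by move=> m _; rewrite addn0 muln1 hat_mod.
rewrite (@sum_residues R (hat v) 1 q 0 i q0); last by rewrite coprime1n.
rewrite /hat (exchange_big_dep xpredT) //=; apply: eq_bigr => g _.
have gq : (FinRing.uval g < q)%N by move: (ltn_ord (FinRing.uval g)); rewrite [X in (_ < X)%N]Zp_cast.
rewrite big_mkord (bigD1 (Ordinal gq)) /=; last first.
  by apply/eqP/val_inj; rewrite /= val_Zp_nat // modn_small.
rewrite big1 ?addr0 // => r /andP[/eqP E /eqP]; case; apply: val_inj.
by rewrite /= E val_Zp_nat // modn_small.
Qed.

Lemma hat_sum_bound v i j : sum_zero v -> `|\sum_(i <= m < j) hat v m| <= q%:R * norm1 v.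
Proof.
move=> v0; have q0 : (0 < q)%N by apply: ltnW.
have [k kj] : exists k, (j <= i + k)%N by exists j; rewrite leq_addl.
have N0 : 0 <= norm1 v by apply: sumr_ge0.
elim: k {-2}k (leqnn k) i kj => [|n IHn] k kn i kj.
  by rewrite big_geq ?normr0 ?mulr_ge0 //; move: kn kj; clear; lia.
case: (leqP (i + q) j) => h.
  rewrite (@big_cat_nat _ _ _ (i + q)) ?leq_addr //= hat_sum_period v0 add0r.
  by apply: (IHn (k - q)%N); move: kn kj h q0; clear; lia.
apply: le_trans (ler_norm_sum _ _ _) _.
apply: le_trans (_ : \sum_(i <= m < j) norm1 v <= _); first by apply: ler_sum => *; exact: hat_le.
rewrite sumr_const_nat -[leLHS]mulr_natl ler_wpM2r // ler_nat; move: h; clear; lia.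
Qed.

Definition Asum v n : R := \sum_(1 <= m < n.+1) hat v m / m%:R.

Lemma Asum_tail v i n : sum_zero v -> (i <= n)%N ->
  `|Asum v n - Asum v i| <= 2 * (i.+1%:R^-1 * (q%:R * norm1 v)).
Proof.
move=> v0 le_in; have -> : Asum v n = Asum v i + \sum_(i.+1 <= m < n.+1) hat v m / m%:R by rewrite /Asum -big_cat_nat.
rewrite addrAC subrr add0r.
under eq_bigr do rewrite mulrC.
apply: (@abel_decr R (fun m => m%:R^-1)) => [m im|m _|i' j'].
- by rewrite lef_pV2 ?posrE ?ltr0n // ?ler_nat // (leq_trans _ im).
- by rewrite invr_ge0.
- exact: hat_sum_bound.
Qed.

(* [Gam v] is the sum of the series [sum_m v(m) / m]. *)
Definition is_Gam v (c : R) := forall n, `|Asum v n - c| <= 2 * (n.+1%:R^-1 * (q%:R * norm1 v)).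
Definition Gam v : R := xget 0 [set c | is_Gam v c]%classic.

(** The intervals of radius [e n] around [Asum v n] meet pairwise, so the supremum of their left
    ends lies in all of them. *)
Lemma Gam_exists v : sum_zero v -> exists c, is_Gam v c.
Proof.
move=> v0; pose e n : R := 2 * (n.+1%:R^-1 * (q%:R * norm1 v)).
have en n m : (n <= m)%N -> e m <= e n.
  move=> nm; rewrite ler_wpM2l // ler_wpM2r ?mulr_ge0 ?sumr_ge0 //.
  by rewrite lef_pV2 ?posrE // ler_nat ltnS.
have sep n m : Asum v n - e n <= Asum v m + e m.
  have e0 k : 0 <= e k by rewrite mulr_ge0 // mulr_ge0 ?invr_ge0 // mulr_ge0 ?sumr_ge0.
  case: (leqP n m) => nm.
    by have := Asum_tail v0 nm; rewrite -/(e n) ler_norml => /andP[h1 h2]; have := e0 m; lra.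
  by have := Asum_tail v0 (ltnW nm); rewrite -/(e m) ler_norml => /andP[h1 h2]; have := e0 n; lra.
pose S := [set Asum v n - e n | n in setT]%classic.
have S0 : (S !=set0)%classic by exists (Asum v 0 - e 0%N), 0%N.
have Sub m : ubound S (Asum v m + e m) by move=> _ [n _ <-]; exact: sep.
have hS : has_sup S by split => //; exists (Asum v 0 + e 0%N); exact: Sub.
exists (sup S) => n; rewrite -/(e n) ler_norml.
have h1 : sup S <= Asum v n + e n by apply: sup_le_ub.
have h2 : Asum v n - e n <= sup S by apply: sup_upper_bound => //; exists n.
by apply/andP; split; lra.
Qed.

Lemma GamP v : sum_zero v -> is_Gam v (Gam v).
Proof. by move=> v0; rewrite /Gam; case: xgetP => [c _ //|H]; have [c Hc] := Gam_exists v0; case: (H c). Qed.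

Lemma Gam_unique v c C : sum_zero v -> (forall n, `|Asum v n - c| <= C / n.+1%:R) -> Gam v = c.
Proof.
move=> v0 H; apply/eqP; rewrite -subr_eq0 -normr_le0 leNgt; apply/negP => e0.
set e := `|_| in e0; set D := C + 2 * (q%:R * norm1 v).
have [n Hn] : exists n, D / e < n%:R.
  by exists (Num.truncn (D / e)).+1; exact: truncnS_gt.
have := GamP v0 n; have := H n; have : e <= `|Asum v n - c| + `|Asum v n - Gam v|.
  have -> : e = `|(Asum v n - c) - (Asum v n - Gam v)| by rewrite /e; congr `|_|; ring.
  exact: ler_normB.
move=> h1 h2 h3; have : e <= D / n.+1%:R.
  apply: le_trans h1 (le_trans (lerD h2 h3) _); rewrite /D [leRHS]mulrDl lerD2l.
  by rewrite -[leRHS]mulrA [X in _ <= _ * X]mulrC.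
rewrite ler_pdivlMr ?ltr0n // mulrC -ler_pdivlMr // leNgt => /negP; apply.
by apply: lt_trans Hn _; rewrite ltr_nat.
Qed.

End UnitFunctions.

(** * Sums of Lambda(n) / n over the classes modulo q *)

Section ClassSums.
Variable R : realType.
Variable q : nat.
Hypothesis q1 : (1 < q)%N.
Local Notation G := {unit 'Z_q}.
Implicit Types (n m k d x y : nat) (v w : G -> R) (g h : G).

Definition Lsum g x : R := \sum_(1 <= d < x.+1 | FinRing.uval g == d%:R) vonM R d / d%:R.

Lemma Lsum_ge0 g x : 0 <= Lsum g x.
Proof. by apply: sumr_ge0 => d _; rewrite divr_ge0 ?vonM_ge0. Qed.

Lemma sum_Lsum v x : \sum_(1 <= d < x.+1) vonM R d * (hat v d / d%:R) = \sum_g v g * Lsum g x.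
Proof.
under [RHS]eq_bigr do rewrite mulr_sumr.
rewrite [RHS](exchange_big_dep xpredT) //=; apply: eq_bigr => d _.
rewrite mulrA mulrAC [RHS](eq_bigr (fun g => vonM R d / d%:R * v g)); last by move=> *; rewrite mulrC.
by rewrite -mulr_sumr /hat.
Qed.

Lemma norm1_shift v g : norm1 (shift v g) = norm1 v.
Proof. by rewrite /norm1 /shift [RHS](reindex_inj (mulgI g)). Qed.

Lemma sum_zero_shift v g : sum_zero v -> sum_zero (shift v g).
Proof. by rewrite /sum_zero /shift [in X in X -> _](reindex_inj (mulgI g)). Qed.

Lemma norm1_ge0 v : 0 <= norm1 v. Proof. exact: sumr_ge0. Qed.

Lemma ln_hat_bounded v : sum_zero v ->
  bounded_seq (fun x => \sum_(1 <= m < x.+1) ln m%:R * (hat v m / m%:R)).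
Proof.
move=> v0; pose F m : R := ln m%:R * (hat v m / m%:R).
exists (\sum_(1 <= m < 4) `|F m| + 2 * (ln 4%:R / 4%:R * (q%:R * norm1 v))) => x.
have h2 : 0 <= 2 * (ln 4%:R / 4%:R * (q%:R * norm1 v)).
  by rewrite mulr_ge0 // mulr_ge0 ?divr_ge0 ?ln_nat_ge0 // mulr_ge0 // norm1_ge0.
case: (leqP x.+1 4) => h.
  rewrite -[leLHS]addr0 lerD //; apply: le_trans (ler_norm_sum _ _ _) _.
  by rewrite [leRHS](@big_cat_nat _ _ _ x.+1) //= lerDl sumr_ge0.
rewrite (@big_cat_nat _ _ _ 4) ?(ltnW h) //=; apply: le_trans (ler_normD _ _) _; apply: lerD.
  exact: ler_norm_sum.
rewrite (eq_bigr (fun m => ln m%:R / m%:R * hat v m)); last by move=> m _; rewrite [RHS]mulrAC mulrA.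
apply: (@abel_decr R (fun m => ln m%:R / m%:R)) => [m|m _|i j].
- exact: ln_div_decr.
- by rewrite divr_ge0 ?ln_nat_ge0.
- exact: hat_sum_bound.
Qed.

(** The series of [shift v g] has a tail of order [d / x] beyond [x / d], and the factor [1 / d]
    makes the error uniform in [d]. *)
Lemma inner_sum v d x : sum_zero v -> (0 < d <= x)%N ->
  `|\sum_(1 <= n < (x %/ d).+1) hat v (d * n) / (d * n)%:R - hat (fun g => Gam (shift v g)) d / d%:R|
  <= 2 * (q%:R * norm1 v) / x%:R.
Proof.
move=> v0 /andP[d0 dx]; have x0 : (0 < x)%N by apply: leq_trans dx.
have nn : 0 <= 2 * (q%:R * norm1 v) / x%:R by rewrite divr_ge0 // mulr_ge0 // mulr_ge0 // norm1_ge0.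
case: (boolP ((d%:R : 'Z_q) \is a GRing.unit)) => [/unit_class[g Eg]|nu]; last first.
  rewrite hat_nunit // mul0r subr0 big1 ?normr0 // => n _; by rewrite hat_mul_nunit // mul0r.
rewrite (hatE _ Eg).
have -> : \sum_(1 <= n < (x %/ d).+1) hat v (d * n) / (d * n)%:R = Asum (shift v g) (x %/ d) / d%:R.
  rewrite /Asum mulr_suml; apply: eq_bigr => n _.
  by rewrite (hat_mul _ _ Eg) natrM invfM [d%:R^-1 * _]mulrC mulrA.
rewrite -mulrBl normrM /=.
apply: le_trans (_ : 2 * ((x %/ d).+1%:R^-1 * (q%:R * norm1 (shift v g))) * `|d%:R^-1| <= _).
  by rewrite ler_wpM2r //; exact: (GamP q1 (sum_zero_shift g v0)).
rewrite norm1_shift (ger0_norm (_ : 0 <= d%:R^-1)) ?invr_ge0 //.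
rewrite -[leLHS]mulrA -[leRHS]mulrA ler_wpM2l // mulrC mulrA [leRHS]mulrC ler_wpM2r //.
  by rewrite mulr_ge0 // norm1_ge0.
rewrite -invfM lef_pV2 ?posrE ?mulr_gt0 ?ltr0n // -natrM ler_nat.
by rewrite mulnC ltnW // ltn_ceil.
Qed.

(** The sum of [ln m * v(m) / m] is computed twice. Summation by parts shows that it is bounded;
    expanding [ln m] over [Lambda] gives the combination of the [Lsum], up to an error of order
    [psi x / x]. *)
Lemma Gam_Lsum_bounded v : sum_zero v ->
  bounded_seq (fun x => \sum_g Gam (shift v g) * Lsum g x).
Proof.
move=> v0; have [C HC] := ln_hat_bounded v0.
exists (C + 4 * (2 * (q%:R * norm1 v))) => x; rewrite -sum_Lsum.
set S := (X in `|X|); have := HC x; rewrite ln_vonM_identity; set T := (X in `|X| <= _ -> _) => HT.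
rewrite (_ : S = T - (T - S)); last by ring.
apply: le_trans (ler_normB _ _) _; apply: lerD => //.
have K0 : 0 <= 2 * (q%:R * norm1 v) by rewrite mulr_ge0 // mulr_ge0 // norm1_ge0.
case: (posnP x) => [x0|x0]; first by rewrite /T /S x0 !big_geq // subr0 normr0 mulr_ge0.
rewrite /T /S -sumrB; apply: le_trans (ler_norm_sum _ _ _) _.
apply: le_trans (_ : psi R x * (2 * (q%:R * norm1 v) / x%:R) <= _).
  rewrite /psi mulr_suml; apply: ler_sum_nat => d dx; rewrite -mulrBr normrM ger0_norm ?vonM_ge0 //.
  by rewrite ler_wpM2l ?vonM_ge0 //; apply: inner_sum.
rewrite mulrCA mulrC ler_wpM2r // ler_pdivrMr ?ltr0n //; exact: psi_bound.
Qed.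

(* For [v] in the kernel, Moebius inversion gives
   [sum_g v(g) Lsum g x = - v(1) ln x + O(1)]; for a character [v] this would
   mean [L(1, v) = 0]. *)
Definition in_kernel v := sum_zero v /\ forall g, Gam (shift v g) = 0.

Lemma kernel_Lsum v : in_kernel v -> bounded_seq (fun x => v 1%g * ln x%:R + \sum_g v g * Lsum g x).
Proof.
move=> [v0 Wv]; exists (2 * (q%:R * norm1 v)) => x.
have K0 : 0 <= 2 * (q%:R * norm1 v) by rewrite mulr_ge0 // mulr_ge0 // norm1_ge0.
case: (posnP x) => [->|x0].
  rewrite ln0 // mulr0 add0r big1 ?normr0 // => g _; by rewrite /Lsum big_geq // mulr0.
have := mu_ln_identity (fun n => hat v n / n%:R) x0; rewrite sum_Lsum divr1 mulrC.
rewrite (@hatE _ _ v 1%g 1) // => <-.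
apply: le_trans (ler_norm_sum _ _ _) _.
apply: le_trans (_ : \sum_(1 <= k < x.+1) (ln x%:R - ln k%:R) * (2 * (q%:R * norm1 v) / x%:R) <= _).
  apply: ler_sum_nat => k /andP[k0 kx]; rewrite normrM -[leRHS]mul1r; apply: ler_pM; rewrite ?mu_norm //.
  rewrite normrM ger0_norm ?subr_ge0 ?ln_nat_le // ler_wpM2l ?subr_ge0 ?ln_nat_le //.
  have := @inner_sum v k x v0; rewrite k0 -ltnS kx => /(_ isT).
  by rewrite [X in _ - X / _](_ : _ = 0) ?mul0r ?subr0 // /hat big1.
rewrite -mulr_suml mulrCA -[leRHS]mulr1 ler_wpM2l // ler_pdivrMr ?ltr0n // mul1r.
rewrite sumrB sumr_const_nat subn1 -[ln x%:R *+ _]mulr_natl.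
by have := sumln_ge R x; rewrite /sumln; lra.
Qed.

(** Mertens' estimate without the powers of primes dividing [q], which contribute a bounded
    amount. *)
Lemma sum_Lsum_ln : bounded_seq (fun x => \sum_g Lsum g x - ln x%:R).
Proof.
have q0 : (0 < q)%N by apply: ltnW.
exists (4 + ((size (primes q))%:R * (ln q%:R * (2 / 1)) + 1)) => x.
case: (posnP x) => [->|x0].
  rewrite ln0 // subr0 big1 ?normr0; last by move=> g _; rewrite /Lsum big_geq.
  have h1 := ln_nat_ge0 R q; have h2 : 0 <= (size (primes q))%:R :> R by [].
  have := mulr_ge0 h2 h1; rewrite divr1; move: ((size _)%:R : R) (ln q%:R : R) => u w; lra.
have -> : \sum_g Lsum g x = mert R x - \sum_(1 <= d < x.+1 | ~~ coprime q d) vonM R d / d%:R.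
  apply/eqP; rewrite eq_sym subr_eq /mert (bigID (coprime q)) /=; apply/eqP; congr (_ + _).
  have := sum_Lsum (fun=> 1) x; under [in X in _ = X -> _]eq_bigr do rewrite mul1r.
  move=> <-; rewrite big_mkcond; apply: eq_bigr => d _; case: ifPn; rewrite -(unitZpE _ q1) => u.
    by have [g Eg] := unit_class u; rewrite (hatE _ Eg) mul1r.
  by rewrite hat_nunit // mul0r mulr0.
set B := \sum_(1 <= d < x.+1 | _) _; have B0 : 0 <= B by apply: sumr_ge0 => d _; rewrite divr_ge0 ?vonM_ge0.
have B1 : B <= (size (primes q))%:R * (ln q%:R * (2 / 1)).
  have xM : (x <= 2 ^ x)%N by apply: ltnW; exact: ltn_expl.
  apply: le_trans (bad_prime_powers R x q0 (ltn0Sn 0)).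
  rewrite [leRHS](@big_cat_nat _ _ _ x.+1) //= -[leLHS]addr0 lerD //; last first.
    by apply: sumr_ge0 => d _; rewrite divr_ge0 ?vonM_ge0.
  rewrite /B [leLHS]big_mkcond [leRHS]big_mkcond /=; apply: ler_sum_nat => d /andP[d0 dx].
  case: ifPn => cq; last by case: ifP => // _; rewrite divr_ge0 ?vonM_ge0.
  have [->|/vonM_neq0[p [k [pp k0 Ed]]]] := eqVneq (vonM R d) 0; first by rewrite mul0r; case: ifP.
  move: cq; rewrite Ed pdiv_pexp // coprime_sym coprime_pexpl // prime_coprime // negbK => ->.
  by rewrite expn_gt0 prime_gt0.
have := mert_ge R x0; have := mert_le R x0; move: (mert R x) B0 B1 => m B0 B1 h1 h2.
by rewrite ler_norml; apply/andP; split; lra.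
Qed.

Lemma Gam_lin (I : finType) (c : I -> R) (u : I -> G -> R) : (forall i, sum_zero (u i)) ->
  Gam (fun g => \sum_i c i * u i g) = \sum_i c i * Gam (u i).
Proof.
move=> u0; apply: (@Gam_unique R q q1 _ _ (\sum_i `|c i| * (2 * (q%:R * norm1 (u i))))).
  rewrite /sum_zero exchange_big /= big1 // => i _; by rewrite -mulr_sumr (u0 i) mulr0.
move=> n; have -> : Asum (fun g => \sum_i c i * u i g) n = \sum_i c i * Asum (u i) n.
  under [RHS]eq_bigr do rewrite /Asum mulr_sumr.
  rewrite exchange_big /=; apply: eq_bigr => m _; rewrite /hat exchange_big /= mulr_suml.
  by apply: eq_bigr => i _; rewrite -mulr_sumr mulrA.
rewrite -sumrB mulr_suml; apply: le_trans (ler_norm_sum _ _ _) _; apply: ler_sum => i _.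
rewrite -mulrBr normrM -[leRHS]mulrA ler_wpM2l //; apply: le_trans (GamP q1 (u0 i) n) _.
by rewrite -[leRHS]mulrA [n.+1%:R^-1 * _]mulrC.
Qed.

Lemma sum_zero_lin (I : finType) (c : I -> R) (u : I -> G -> R) : (forall i, sum_zero (u i)) ->
  sum_zero (fun g => \sum_i c i * u i g).
Proof.
by move=> u0; rewrite /sum_zero exchange_big /= big1 // => i _; rewrite -mulr_sumr (u0 i) mulr0.
Qed.

Lemma kernel_lin (I : finType) (c : I -> R) (u : I -> G -> R) : (forall i, in_kernel (u i)) ->
  in_kernel (fun g => \sum_i c i * u i g).
Proof.
move=> Wu; split; first by apply: sum_zero_lin => i; case: (Wu i).
move=> g; rewrite /shift (@Gam_lin I c (fun i => shift (u i) g)).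
  by rewrite big1 // => i _; case: (Wu i) => _ ->; rewrite mulr0.
by move=> i; apply: sum_zero_shift; case: (Wu i).
Qed.

Lemma kernel_shift v h : in_kernel v -> in_kernel (shift v h).
Proof.
move=> [v0 Wv]; split; first exact: sum_zero_shift.
move=> g; rewrite -[RHS](Wv (h * g)%g); congr (Gam _); apply/funext => k.
by rewrite /shift mulgA.
Qed.

(** For [u h = v g * v (g h)], again in the kernel, [kernel_Lsum] plus [u 1] times [sum_Lsum_ln]
    bounds the sum of [(u h + u 1) * Lsum h]. As [u 1 = (v g)^2] dominates [|u|], all terms are
    nonnegative, and the coefficient of an unbounded [Lsum s] must vanish. *)
Lemma kernel_max v g s : in_kernel v -> (forall h, `|v h| <= `|v g|) -> ~ bounded_seq (Lsum s) ->
  v (g * s)%g = - v g.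
Proof.
(* The sum over the one-element type [unit] is a scalar multiple in the form that [kernel_lin]
   accepts. *)
move=> Wv vmax Ls; pose u h := \sum_(i : unit) v g * shift v g h.
have uE h : u h = v g * v (g * h)%g by rewrite /u big_const card_unit /= addr0.
have Wu : in_kernel u by apply: kernel_lin => i; exact: kernel_shift.
have [C HC] : bounded_seq (fun x => \sum_h (u h + u 1%g) * Lsum h x).
  apply: bounded_seq_eq (bounded_seqD (kernel_Lsum Wu) (bounded_seqZ (u 1%g) sum_Lsum_ln)) => x /=.
  rewrite [RHS](eq_bigr (fun h => u h * Lsum h x + u 1%g * Lsum h x)); last by move=> h _; rewrite mulrDl.
  by rewrite big_split /= -mulr_sumr; ring.
have nn h : 0 <= u h + u 1%g.
  rewrite !uE mulg1 -expr2 -[v g ^+ 2]real_normK ?num_real // addrC -lerBlDr sub0r.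
  rewrite expr2; apply: le_trans (_ : `|v g * v (g * h)%g| <= _); last first.
    by rewrite normrM ler_wpM2l.
  by rewrite -normrN ler_norm.
have E : u s + u 1%g = 0.
  apply/eqP; rewrite -normr_le0 leNgt; apply/negP => us; apply: Ls.
  rewrite ger0_norm // in us; exists (C / (u s + u 1%g)) => x.
  rewrite ger0_norm ?Lsum_ge0 // ler_pdivlMr // mulrC.
  apply: le_trans (HC x); apply: le_trans (ler_norm _).
  by rewrite (bigD1 s) //= lerDl sumr_ge0 // => h _; rewrite mulr_ge0 ?Lsum_ge0.
move: E; rewrite !uE mulg1 -mulrDr => /eqP; rewrite mulf_eq0 => /orP[/eqP z|/eqP/addr0_eq].
  by have := vmax (g * s)%g; rewrite z normr0 oppr0 normr_le0 => /eqP.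
by move=> <-; rewrite opprK.
Qed.

End ClassSums.

(** * The Fredholm alternative in finite dimension *)

Section Fredholm.
Variable R : realType.

(** Membership in the row space of a matrix is tested by the columns of its cokernel. *)
Lemma fredholm (I : finType) (K : I -> I -> R) (f : I -> R) :
  (forall c : I -> R, (forall k, \sum_g K k g * c g = 0) -> \sum_g f g * c g = 0) ->
  exists v : I -> R, forall g, f g = \sum_k v k * K k g.
Proof.
move=> H; pose A : 'M[R]_#|I| := \matrix_(i, j) K (enum_val i) (enum_val j).
pose F : 'rV[R]_#|I| := \row_j f (enum_val j).
have ev (h : I -> R) : \sum_(i < #|I|) h (enum_val i) = \sum_g h g.
  by rewrite [RHS](reindex (@enum_val I predT)) //; apply: onW_bij; exact: enum_val_bij.
have /submxP[D HD] : (F <= A)%MS.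
  rewrite submxE; apply/eqP/rowP => j; rewrite [LHS]mxE [RHS]mxE.
  have := H (fun g => cokermx A (enum_rank g) j).
  rewrite -ev; under eq_bigr do rewrite enum_valK; move=> H'.
  rewrite -[RHS]H' => [|k]; first by apply: eq_bigr => i _; rewrite [F _ _]mxE.
  have /matrixP/(_ (enum_rank k) j) := mulmx_coker A; rewrite [LHS]mxE [RHS]mxE => E.
  by rewrite -[RHS]E -ev; apply: eq_bigr => i _; rewrite [A _ _]mxE enum_rankK enum_valK.
exists (fun k => D 0 (enum_rank k)) => g.
have /rowP/(_ (enum_rank g)) := HD; rewrite [LHS]mxE [RHS]mxE enum_rankK => ->.
by rewrite -ev; apply: eq_bigr => i _; rewrite [A _ _]mxE enum_rankK enum_valK.
Qed.

Lemma ex_max (I : finType) (i0 : I) (F : I -> R) : exists i, forall j, F j <= F i.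
Proof.
by exists [arg max_(i > i0) F i]%O; case: Order.TotalTheory.arg_maxP => // i _ H j; exact: H.
Qed.

End Fredholm.

(** * From a nonzero kernel to a real character *)

Section GoodSubgroup.
Variable R : realType.
Variable q : nat.
Hypothesis q1 : (1 < q)%N.
Local Notation G := {unit 'Z_q}.
Implicit Types (v w : G -> R) (g h s : G).

Lemma unitZ_mulC g h : (g * h = h * g)%g.
Proof. by apply: val_inj; rewrite /= mulrC. Qed.

(** By the Fredholm alternative [f] is the image of some [V] of sum zero, and [Gam_Lsum_bounded]
    applies to [V]. The rows come from the point masses [dl k], centred so that their series
    converge. *)
Lemma orth_Lsum_bounded (f : G -> R) : sum_zero f ->
  (forall w, in_kernel w -> \sum_g f g * w (g^-1)%g = 0) ->
  bounded_seq (fun x => \sum_g f g * Lsum R g x).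
Proof.
move=> f0 Hf; pose n : R := #|{: G}|%:R.
have n0 : n != 0 by rewrite pnatr_eq0 -lt0n; apply/card_gt0P; exists 1%g.
pose dl k : G -> R := fun g => (g == k)%:R - n^-1.
have dl0 k : sum_zero (dl k).
  rewrite /sum_zero /dl sumrB sumr_const -[n^-1 *+ _]mulr_natl -/n mulfV //.
  by rewrite (bigD1 k) //= eqxx big1 ?addr0 ?subrr // => g /negPf ->.
have sl k g := @sum_zero_shift R q (dl k) g (dl0 k).
have [v Hv] : exists v : G -> R, forall g, f g = \sum_k v k * Gam (shift (dl k) g).
  apply: fredholm => c Hc; pose m := n^-1 * \sum_g c g.
  (* A vector [c] annihilated by all rows, reflected and centred, lies in the kernel; commutativity
     of the group enters here. *)
  pose w h := c (h^-1)%g - m.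
  have w0 : sum_zero w.
    rewrite /sum_zero /w sumrB sumr_const -[m *+ _]mulr_natl -/n mulrA mulfV // mul1r.
    by rewrite [X in _ - X](reindex_inj (@invg_inj {unit 'Z_q})) subrr.
  have ww : in_kernel w.
    split => // k; rewrite -[RHS](Hc (k^-1)%g).
    transitivity (\sum_g c g * Gam (shift (dl (k^-1)%g) g)); last by apply: eq_bigr => *; rewrite mulrC.
    rewrite -(Gam_lin q1) //; congr Gam; apply/funext => h.
    rewrite /shift /w /dl (eq_bigr (fun g => c g * (g == (k * h)^-1)%g%:R - c g * n^-1)).
      rewrite sumrB -mulr_suml (bigD1 ((k * h)^-1)%g) //= eqxx mulr1 big1 ?addr0; last first.
        by move=> g /negPf ->; rewrite mulr0.
      by rewrite /m mulrC.
    move=> g _; rewrite mulrBr; congr (_ * (nat_of_bool _)%:R - _).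
    apply/eqP/eqP => [E|->]; first by rewrite invgM unitZ_mulC -E mulgK.
    by rewrite invgM -mulgA [(k^-1 * h)%g]unitZ_mulC mulKg.
  have := Hf w ww; rewrite /w; under eq_bigr do rewrite invgK mulrBr.
  by rewrite sumrB -mulr_suml f0 mul0r subr0.
pose V g := \sum_k v k * dl k g.
have V0 : sum_zero V by apply: sum_zero_lin.
apply: bounded_seq_eq (Gam_Lsum_bounded q1 V0) => x; apply: eq_bigr => g _; congr (_ * _).
by rewrite Hv -(Gam_lin q1).
Qed.

Definition is_max v g := forall h, `|v h| <= `|v g|.
(* If [Lsum h] is unbounded then [h] is good with [e = -1] ([kernel_max]); good
   elements form a subgroup, which turns out to be the whole group, so that a
   function of maximal modulus in the kernel is a multiple of a real character. *)
Definition good h := exists2 e : R, `|e| = 1 & forall v g, in_kernel v -> is_max v g -> v (g * h)%g = e * v g.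

Lemma is_max_mul v g h e : `|e| = 1 -> is_max v g -> v (g * h)%g = e * v g -> is_max v (g * h)%g.
Proof. by move=> e1 m E k; rewrite E normrM e1 mul1r. Qed.

Lemma good1 : good 1%g.
Proof. by exists 1; rewrite ?normr1 // => v g _ _; rewrite mulg1 mul1r. Qed.

Lemma goodM h k : good h -> good k -> good (h * k)%g.
Proof.
move=> [e e1 He] [d d1 Hd]; exists (d * e); first by rewrite normrM e1 d1 mulr1.
move=> v g Wv m; have E := He v g Wv m; have m' := is_max_mul e1 m E.
by rewrite mulgA (Hd v _ Wv m') E mulrA.
Qed.

Lemma good_unbounded s : ~ bounded_seq (Lsum R s) -> good s.
Proof.
by move=> Ls; exists (-1); rewrite ?normrN1 // => v g Wv m; rewrite mulN1r; apply: (@kernel_max R q q1).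
Qed.

Lemma exists_unbounded : exists s, ~ bounded_seq (Lsum R s).
Proof.
apply: contrapT => H; have bL : bounded_seq (fun x => \sum_(g : G) Lsum R g x).
  have Hb g : bounded_seq (Lsum R g) by apply: contrapT => h; apply: H; exists g.
  exact (bounded_seq_sum (P := xpredT) (fun g _ => Hb g)).
have [C HC] : bounded_seq (fun x => 1 * ln x%:R : R).
  apply: bounded_seq_eq (bounded_seqD bL (bounded_seqZ (-1) (sum_Lsum_ln R q1))) => x /=.
  by ring.
have /eqP := @ln_unbounded R 1 (ex_intro _ C HC); by rewrite oner_eq0.
Qed.

Definition goodset : {set G} := [set h | `[< good h >]].

Lemma goodsetP h : reflect (good h) (h \in goodset).
Proof. by rewrite inE; exact: asboolP. Qed.

Lemma goodset_group : group_set goodset.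
Proof.
apply/group_setP; split; first by apply/goodsetP; exact: good1.
by move=> h k /goodsetP Hh /goodsetP Hk; apply/goodsetP; exact: goodM.
Qed.

(** The average [u] over translates by good elements is in the kernel and invariant under them. A
    good [s] with [Lsum s] unbounded also changes its sign at a maximum of [|u|], so [u]
    vanishes. *)
Lemma good_average w : in_kernel w -> \sum_(h in goodset) w h = 0.
Proof.
move=> Ww; pose H := Group goodset_group.
pose u g := \sum_h (h \in goodset)%:R * shift w h g.
have uE g : u g = \sum_(h in goodset) w (g * h)%g.
  rewrite /u [RHS]big_mkcond; apply: eq_bigr => h _; rewrite /shift unitZ_mulC.
  by case: (h \in goodset); rewrite ?mul1r ?mul0r.
have Wu : in_kernel u by apply: (@kernel_lin R q q1) => h; exact: kernel_shift.
have [g Hg] := ex_max (1%g : G) (fun g => `|u g|).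
have [s Ls] := exists_unbounded.
have us := kernel_max q1 Wu Hg Ls.
have sH : s \in H by apply/goodsetP; exact: good_unbounded.
have : u (g * s)%g = u g.
  rewrite !uE [RHS](reindex_inj (mulgI s)) /=; apply: eq_big => [h|h _]; last by rewrite mulgA.
  by rewrite -[LHS](groupMl h sH).
rewrite us => /eqP; rewrite -subr_eq0 -opprD oppr_eq0 -mulr2n mulrn_eq0 /= => /eqP ug.
have := Hg 1%g; rewrite ug normr0 normr_le0 uE => /eqP e; rewrite -[RHS]e.
by apply: eq_bigr => h _; rewrite mul1g.
Qed.

(** By [good_average], the centred indicator of the good elements is orthogonal to the reflected
    kernel, so the sum of [Lsum] over them is [r * ln x] up to a bounded error, [r] being their
    proportion. Off them every [Lsum] is bounded and the total is [ln x], whence [r = 1]. *)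
Lemma all_good h : good h.
Proof.
apply/goodsetP; pose H := Group goodset_group.
pose n : R := #|{: G}|%:R; pose r : R := #|goodset|%:R / n.
have n0 : n != 0 by rewrite pnatr_eq0 -lt0n; apply/card_gt0P; exists 1%g.
pose f g : R := (g \in goodset)%:R - r.
have sumH (F : G -> R) : \sum_g (g \in goodset)%:R * F g = \sum_(g in goodset) F g.
  by rewrite [RHS]big_mkcond; apply: eq_bigr => g _; case: (g \in goodset); rewrite ?mul1r ?mul0r.
have f0 : sum_zero f.
  rewrite /sum_zero /f sumrB; have := sumH (fun=> 1); under eq_bigr do rewrite mulr1.
  move=> ->; rewrite !sumr_const -[r *+ _]mulr_natl -/n /r mulrCA mulfV // mulr1; exact: subrr.
have fW w : in_kernel w -> \sum_g f g * w (g^-1)%g = 0.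
  move=> Ww; rewrite (eq_bigr (fun g => (g \in goodset)%:R * w (g^-1)%g - r * w (g^-1)%g)); last first.
    by move=> g _; rewrite mulrBl.
  rewrite sumrB sumH -mulr_sumr; have [w0 _] := Ww.
  have -> : \sum_g w (g^-1)%g = 0 by rewrite -[RHS]w0 [RHS](reindex_inj (@invg_inj {unit 'Z_q})).
  rewrite mulr0 subr0 -[RHS](good_average Ww) [RHS](reindex_inj (@invg_inj {unit 'Z_q})).
  by apply: eq_bigl => g; rewrite (@groupV _ H).
have B1 := orth_Lsum_bounded f0 fW.
have B2 : bounded_seq (fun x => \sum_(g : G | g \notin goodset) Lsum R g x).
  have Hb g : g \notin goodset -> bounded_seq (Lsum R g).
    by move=> /goodsetP ng; apply: contrapT => h'; apply: ng; exact: good_unbounded.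
  exact (bounded_seq_sum (P := fun g => g \notin goodset) Hb).
have r1 : 1 - r = 0.
  apply: (@ln_unbounded R).
  apply: bounded_seq_eq (bounded_seqD (bounded_seqD B1 B2) (bounded_seqZ (r - 1) (sum_Lsum_ln R q1))) => x /=.
  rewrite (eq_bigr (fun g => (g \in goodset)%:R * Lsum R g x - r * Lsum R g x)); last by move=> *; rewrite mulrBl.
  rewrite sumrB sumH -mulr_sumr [in (r - 1) * _](bigID (mem goodset)) /=.
  rewrite [X in r * X](bigID (mem goodset)) /=; ring.
have E : (#|goodset| = #|{: G}|)%N.
  by move/eqP: r1; rewrite subr_eq0 eq_sym /r -(inj_eq (mulIf n0)) mulfVK // mul1r eqr_nat => /eqP.
by have /(subset_cardP E)/(_ h) -> := subset_predT goodset.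
Qed.

Lemma kernel_character v : in_kernel v -> (exists g, v g != 0) ->
  exists chi : G -> R, [/\ in_kernel chi, chi 1%g = 1, forall g, `|chi g| = 1
    & forall g h, chi (g * h)%g = chi g * chi h].
Proof.
move=> Wv [k vk]; have [g Hg] := ex_max (1%g : G) (fun g => `|v g|).
have vg : v g != 0 by rewrite -normr_gt0; apply: lt_le_trans (Hg k); rewrite normr_gt0.
exists (fun h => \sum_(i : unit) (v g)^-1 * shift v g h).
have E h : \sum_(i : unit) (v g)^-1 * shift v g h = (v g)^-1 * v (g * h)%g.
  by rewrite big_const card_unit /= addr0.
split.
- by apply: (@kernel_lin R q q1) => i; exact: kernel_shift.
- by rewrite E mulg1 mulVf.
- by move=> h; rewrite E; have [e e1 He] := all_good h; rewrite He // mulrCA mulVf // mulr1.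
- move=> h1 h2; rewrite !E; have [e e1 He] := all_good h1; have [d d1 Hd] := all_good h2.
  have m := is_max_mul e1 Hg (He v g Wv Hg).
  by rewrite mulgA (Hd v _ Wv m) (Hd v g) // He //; field.
Qed.

End GoodSubgroup.

(** * Nonvanishing of L(1, chi) *)
Section Hyperbola.
Variable R : realType.
Implicit Types (a b n m y x : nat).

Definition rsum n : R := \sum_(1 <= a < n.+1) (Num.sqrt a%:R)^-1.

Lemma sqrt_nat_gt0 n : (0 < n)%N -> 0 < Num.sqrt n%:R :> R.
Proof. by move=> n0; rewrite sqrtr_gt0 ltr0n. Qed.

Lemma rsum_step n : (0 < n)%N ->
  0 <= (rsum n - 2 * Num.sqrt n%:R) - (rsum n.+1 - 2 * Num.sqrt n.+1%:R) <= (Num.sqrt n%:R)^-1 - (Num.sqrt n.+1%:R)^-1.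
Proof.
move=> n0; rewrite /rsum [\sum_(1 <= a < n.+2) _]big_nat_recr //=.
have u0 := sqrt_nat_gt0 n0; have v0 := sqrt_nat_gt0 (ltn0Sn n).
have uu : Num.sqrt n%:R ^+ 2 = n%:R :> R by rewrite sqr_sqrtr.
have vv : Num.sqrt n.+1%:R ^+ 2 = n%:R + 1 :> R by rewrite sqr_sqrtr // natr1.
have uv : Num.sqrt n%:R <= Num.sqrt n.+1%:R :> R by rewrite ler_sqrt // ler_nat.
move: (Num.sqrt n%:R) (Num.sqrt n.+1%:R) u0 v0 uu vv uv => u v u0 v0 uu vv uv.
have h : (v - u) * (v + u) = 1 by rewrite -subr_sqr vv uu; ring.
have h1 : v^-1 <= 2 * (v - u).
  by rewrite -(ler_pM2r v0) mulVf ?gt_eqF //; nra.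
have h2 : 2 * (v - u) <= u^-1.
  by rewrite -(ler_pM2r u0) mulVf ?gt_eqF //; nra.
by apply/andP; split; lra.
Qed.

(** The sequence [rsum n - 2 * sqrt n] decreases, and its decrements are dominated by those of
    [1 / sqrt n]. *)
Lemma rsum_close n m : (0 < n)%N -> (n <= m)%N ->
  0 <= (rsum n - 2 * Num.sqrt n%:R) - (rsum m - 2 * Num.sqrt m%:R) <= (Num.sqrt n%:R)^-1.
Proof.
move=> n0 nm; suff : 0 <= (rsum n - 2 * Num.sqrt n%:R) - (rsum m - 2 * Num.sqrt m%:R)
   <= (Num.sqrt n%:R)^-1 - (Num.sqrt m%:R)^-1.
  by move=> /andP[-> /le_trans]; apply; rewrite gerDl oppr_le0 invr_ge0 sqrtr_ge0.
have [k ->] : exists k, m = (n + k)%N by exists (m - n)%N; rewrite subnKC.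
elim: k => [|k IHk]; first by rewrite addn0 !subrr lexx.
have := rsum_step (ltn_addr k n0); rewrite addnS.
by move: IHk => /andP[p1 p2] /andP[p3 p4]; apply/andP; split; lra.
Qed.

Lemma rsum_le n : rsum n <= 2 * Num.sqrt n%:R.
Proof.
case: n => [|n]; first by rewrite /rsum big_geq // sqrtr0 mulr0.
have /andP[] := @rsum_close 1 n.+1 isT isT; rewrite /rsum big_nat1 sqrtr1 invr1; lra.
Qed.

(** Here [rsum (y ^ 2) - 2 * y] plays the part of the constant term in the expansion of [rsum]; the
    floor in [y ^ 2 %/ b] costs one more error of the same order. *)
Lemma rsum_floor b y : (0 < b)%N -> (b <= y)%N ->
  `|rsum (y ^ 2 %/ b) - 2 * (y%:R / Num.sqrt b%:R) - (rsum (y ^ 2) - 2 * y%:R)|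
    <= 6 * (Num.sqrt b%:R / y%:R).
Proof.
move=> b0 by_; have y0 : (0 < y)%N by apply: leq_trans by_.
set n := (y ^ 2 %/ b)%N.
have nb : (n * b <= y ^ 2)%N by exact: leq_divM.
have n0 : (0 < n)%N.
  by rewrite divn_gt0 //; apply: leq_trans by_ _; rewrite -mulnn leq_pmulr.
have nb2 : (y ^ 2 < n * b + b)%N by rewrite addnC -mulSn ltn_ceil.
have := rsum_close n0 (_ : n <= y ^ 2)%N; rewrite leq_div => /(_ isT).
have -> : Num.sqrt (y ^ 2)%:R = y%:R :> R by rewrite natrX sqrtr_sqr normr_nat.
have u0 := sqrt_nat_gt0 n0; have v0 := sqrt_nat_gt0 b0; have Y0 : 0 < y%:R :> R by rewrite ltr0n.
have uu : Num.sqrt n%:R ^+ 2 = n%:R :> R by rewrite sqr_sqrtr.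
have vv : Num.sqrt b%:R ^+ 2 = b%:R :> R by rewrite sqr_sqrtr.
rewrite -(ler_nat R) natrM natrX -uu -vv in nb.
rewrite -(ltr_nat R) natrD natrM natrX -uu -vv in nb2.
have n1 : 1 <= Num.sqrt n%:R ^+ 2 :> R by rewrite uu ler1n.
move: nb nb2.
move: (Num.sqrt n%:R) (Num.sqrt b%:R) (y%:R) (rsum n) (rsum (y ^ 2)) u0 v0 Y0 {uu vv} n1.
clear => u v Y rn ry u0 v0 Y0 n1 nb nb2 /andP[h1 h2].
have uvY : u * v <= Y.
  by rewrite -(@ler_pXn2r _ 2) ?nnegrE ?mulr_ge0 ?(ltW u0) ?(ltW v0) ?(ltW Y0) // exprMn.
have w0 : 0 < u * v by rewrite mulr_gt0.
have uvY2 : Y <= 2 * (u * v).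
  rewrite -(@ler_pXn2r _ 2) ?nnegrE ?mulr_ge0 ?(ltW u0) ?(ltW v0) ?(ltW Y0) //.
  have : v ^+ 2 <= u ^+ 2 * v ^+ 2 by rewrite ler_peMl // sqr_ge0.
  by rewrite !exprMn; lra.
have d0 : 0 <= Y / v - u by rewrite subr_ge0 ler_pdivlMr.
have d1 : Y / v - u <= u^-1.
  rewrite -(ler_pM2r w0) mulrBl.
  have -> : Y / v * (u * v) = Y * u by field; rewrite gt_eqF.
  have -> : u^-1 * (u * v) = v by field; rewrite gt_eqF.
  rewrite -(ler_pM2r v0); nra.
have d2 : u^-1 <= 2 * (v / Y).
  rewrite -(ler_pM2r u0) mulVf ?gt_eqF // -mulrA mulrAC -!mulrA mulrA mulrA.
  by rewrite ler_pdivlMr // mul1r; lra.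
move: d0 d1 d2 h1 h2; move: (Y / v) (v / Y) (u^-1) => s t r d0 d1 d2 h1 h2.
by rewrite ler_norml; clear - d0 d1 d2 h1 h2; apply/andP; split; lra.
Qed.

End Hyperbola.

Section LNonvanishing.
Variable R : realType.
Variable q : nat.
Hypothesis q1 : (1 < q)%N.
Local Notation G := {unit 'Z_q}.
Variable chi : G -> R.
Hypothesis Wchi : in_kernel chi.
Hypothesis chi1 : chi 1%g = 1.
Hypothesis chi_norm : forall g, `|chi g| = 1.
Hypothesis chiM : forall g h, chi (g * h)%g = chi g * chi h.
Local Notation X := (hat chi).

Lemma hat1 : X 1 = 1.
Proof. by rewrite (@hatE R q chi 1%g). Qed.

Lemma hatM m n : X (m * n) = X m * X n.
Proof.
case: (boolP ((m%:R : 'Z_q) \is a GRing.unit)) => [/unit_class[g Eg]|nu]; last first.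
  by rewrite hat_mul_nunit // hat_nunit // mul0r.
rewrite (hat_mul _ _ Eg) (hatE _ Eg).
case: (boolP ((n%:R : 'Z_q) \is a GRing.unit)) => [/unit_class[h Eh]|nu].
  by rewrite !(hatE _ Eh) /shift chiM.
by rewrite !hat_nunit // mulr0.
Qed.

Lemma hat_val n : [\/ X n = 0, X n = 1 | X n = -1].
Proof.
case: (boolP ((n%:R : 'Z_q) \is a GRing.unit)) => [/unit_class[h Eh]|nu]; last first.
  by apply: Or31; rewrite hat_nunit.
rewrite (hatE _ Eh); have /eqP := chi_norm h; rewrite eqr_norml ler01 andbT.
by move=> /orP[/eqP|/eqP] ?; [apply: Or32 | apply: Or33].
Qed.

(** The coefficients of [zeta(s) L(s, chi)]. *)
Definition divsum n : R := \sum_(d <- divisors n) X d.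

Lemma geometric_sign (c : R) n : [\/ c = 0, c = 1 | c = -1] ->
  0 <= \sum_(0 <= i < n.+1) c ^+ i /\ (~~ odd n -> 1 <= \sum_(0 <= i < n.+1) c ^+ i).
Proof.
case=> ->.
- suff -> : \sum_(0 <= i < n.+1) 0 ^+ i = 1 :> R by split.
  rewrite big_ltn // expr0 big_nat big1 ?addr0 // => i /andP[i0 _]; by rewrite expr0n gtn_eqF.
- have -> : \sum_(0 <= i < n.+1) 1 ^+ i = n.+1%:R :> R.
    by under eq_bigr do rewrite expr1n; rewrite sumr_const_nat subn0.
  by split => // _; rewrite ler1n.
- have E k : \sum_(0 <= i < k) (-1) ^+ i = (odd k)%:R :> R.
    elim: k => [|k IHk]; first by rewrite big_geq.
    rewrite big_nat_recr //= IHk -signr_odd; case: (odd k) => /=; ring.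
  by rewrite E /=; split; [case: odd | move=> ->].
Qed.

Lemma divsum_ppart p k m : prime p -> ~~ (p %| m)%N -> (0 < m)%N ->
  divsum (p ^ k * m) = (\sum_(0 <= i < k.+1) X p ^+ i) * divsum m.
Proof.
move=> pp pm m0; rewrite /divsum (sum_divisors_ppart _ _ pp pm m0) mulr_suml.
apply: eq_bigr => i _; rewrite mulr_sumr; apply: eq_bigr => d _; rewrite hatM; congr (_ * _).
by elim: i => [|i IHi]; rewrite ?hat1 // expnS hatM IHi exprS.
Qed.

(** The factor at [p] is [1 + c + ... + c^k] with [c] among 0, 1 and -1: nonnegative, and at least 1
    when [k] is even. *)
Lemma divsum_sign n : (0 < n)%N -> 0 <= divsum n /\ 1 <= divsum (n ^ 2).
Proof.
have d1 : divsum 1 = 1 by rewrite /divsum /divisors /= big_seq1 hat1.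
elim/ltn_ind: n => n IHn n0; case: (ltngtP n 1) => h; first by move: n0 h; clear; lia.
  have [p [k [m [pp pm m0 k0 En]]]] := ppart_decomp h.
  have mn : (m < n)%N by rewrite En ltn_Pmull // -(expn0 p) ltn_exp2l // prime_gt1.
  have [i1 i2] := IHn m mn m0; have [g1 _] := geometric_sign k (hat_val p).
  have [_ g2] := geometric_sign (k * 2) (hat_val p).
  split; first by rewrite En divsum_ppart // mulr_ge0.
  rewrite En expnMn -expnM divsum_ppart ?expn_gt0 ?m0 //; last by rewrite Euclid_dvdX // (negPf pm).
  have g3 : 1 <= \sum_(0 <= i < (k * 2).+1) X p ^+ i by apply: g2; rewrite oddM andbF.
  by rewrite -[1]mulr1 ler_pM.
by rewrite h d1.
Qed.

Let K : R := q%:R * norm1 chi.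

Lemma K_ge0 : 0 <= K.
Proof. by rewrite mulr_ge0 // norm1_ge0. Qed.

Lemma hat_sqrt_sum i j : (0 < i)%N ->
  `|\sum_(i <= m < j) X m / Num.sqrt m%:R| <= 2 * ((Num.sqrt i%:R)^-1 * K).
Proof.
move=> i0; under eq_bigr do rewrite mulrC.
apply: (@abel_decr R (fun m => (Num.sqrt m%:R)^-1)) => [m im|m _|i' j'].
- have m0 : (0 < m)%N by apply: leq_trans im.
  by rewrite lef_pV2 ?posrE ?sqrt_nat_gt0 // ler_sqrt // ler_nat.
- by rewrite invr_ge0 sqrtr_ge0.
- by apply: hat_sum_bound => //; case: Wchi.
Qed.

Lemma Asum_chi y : `|Asum chi y| <= 2 * (y.+1%:R^-1 * K).
Proof.
have [c0 cW] := Wchi; have := GamP q1 c0 y.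
have -> : Gam chi = 0.
  by rewrite -[RHS](cW 1%g); congr Gam; apply/funext => h; rewrite /shift mul1g.
by rewrite subr0.
Qed.

(** Dirichlet's hyperbola method with both variables cut at [y]. The main term [2 * y * Asum chi y]
    is bounded precisely because the series of [chi] sums to 0, so that [Asum chi y] is its tail. *)
Lemma sum_divsum_sqrt y : (0 < y)%N ->
  \sum_(1 <= n < (y ^ 2).+1) divsum n / Num.sqrt n%:R <= 12 * K + 6.
Proof.
move=> y0; set x := (y ^ 2)%N.
have yx : (y <= x)%N by rewrite /x -mulnn leq_pmulr.
have Y0 : 0 < y%:R :> R by rewrite ltr0n.
pose F a b : R := X b / Num.sqrt b%:R * (Num.sqrt a%:R)^-1.
have -> : \sum_(1 <= n < x.+1) divsum n / Num.sqrt n%:R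
  = \sum_(1 <= b < x.+1) \sum_(1 <= a < (x %/ b).+1) F a b.
  rewrite (eq_big_nat _ _ (F2 := fun n => \sum_(1 <= b < x.+1 | (b %| n)%N) X b / Num.sqrt n%:R)).
    rewrite (sum_dvd_swap (fun b n => X b / Num.sqrt n%:R)); apply: eq_bigr => b _; apply: eq_bigr => a _.
    by rewrite /F natrM sqrtrM // invfM mulrA.
  move=> n /andP[n0 nx]; rewrite /divsum (@sum_divisors_range _ _ _ x) // mulr_suml //.
rewrite (@big_cat_nat _ _ _ y.+1) //=.
have -> : \sum_(y.+1 <= b < x.+1) \sum_(1 <= a < (x %/ b).+1) F a b
  = \sum_(1 <= a < y.+1) (Num.sqrt a%:R)^-1 * \sum_(y.+1 <= b < (x %/ a).+1) X b / Num.sqrt b%:R.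
  transitivity (\sum_(y.+1 <= b < x.+1) \sum_(1 <= a < y.+1 | (a * b <= x)%N) F a b).
    apply: eq_big_nat => b /andP[yb bx].
    have b0 : (0 < b)%N by apply: leq_trans yb.
    rewrite (@big_nat_widen _ _ _ _ _ y.+1) /=; last first.
      by rewrite ltnS; apply: leq_trans (leq_div2l _ y0 (ltnW yb)) _; rewrite /x -mulnn mulnK.
    by apply: eq_bigl => a; rewrite ltnS leq_divRL.
  rewrite (exchange_big_dep_nat xpredT) //=; apply: eq_big_nat => a /andP[a0 ay].
  rewrite [in RHS](@big_nat_widen _ _ _ _ _ x.+1) /=; last by rewrite ltnS leq_div.
  rewrite mulr_sumr; apply: eq_big => [b|b _]; last by rewrite /F mulrC.
  by rewrite ltnS leq_divRL // mulnC.
pose c : R := rsum R x - 2 * y%:R.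
have c2 : `|c| <= 2.
  have /andP[] := @rsum_close R 1 x isT (leq_trans y0 yx).
  have -> : Num.sqrt x%:R = y%:R :> R by rewrite natrX sqrtr_sqr normr_nat.
  by rewrite {1 3}/rsum big_nat1 sqrtr1 invr1 -/c ler_norml => h1 h2; apply/andP; split; lra.
have E1 : \sum_(1 <= b < y.+1) \sum_(1 <= a < (x %/ b).+1) F a b
  = 2 * y%:R * Asum chi y + c * \sum_(1 <= b < y.+1) X b / Num.sqrt b%:R
    + \sum_(1 <= b < y.+1) X b / Num.sqrt b%:R * (rsum R (x %/ b) - 2 * (y%:R / Num.sqrt b%:R) - c).
  rewrite /Asum !mulr_sumr -!big_split /=; apply: eq_big_nat => b /andP[b0 _].
  rewrite /F -mulr_sumr -/(rsum R _).
  have -> : X b / b%:R = X b / Num.sqrt b%:R / Num.sqrt b%:R.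
    by rewrite -mulrA -invfM -expr2 sqr_sqrtr.
  ring.
have B1 : `|2 * y%:R * Asum chi y| <= 4 * K.
  rewrite normrM ger0_norm ?mulr_ge0 //.
  apply: le_trans (ler_wpM2l _ (Asum_chi y)) _; first by rewrite mulr_ge0.
  have : y%:R / y.+1%:R <= 1 :> R by rewrite ler_pdivrMr ?ltr0n // mul1r ler_nat.
  move=> h; have := ler_wpM2r K_ge0 h; move: (y%:R : R) (y.+1%:R^-1 : R) => u v; nra.
have B2 : `|c * \sum_(1 <= b < y.+1) X b / Num.sqrt b%:R| <= 4 * K.
  have h := hat_sqrt_sum y.+1 (ltn0Sn 0); rewrite sqrtr1 invr1 mul1r in h.
  rewrite normrM (_ : 4 * K = 2 * (2 * K)); last by ring.
  by apply: ler_pM.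
have B3 : `|\sum_(1 <= b < y.+1) X b / Num.sqrt b%:R * (rsum R (x %/ b) - 2 * (y%:R / Num.sqrt b%:R) - c)| <= 6.
  apply: le_trans (ler_norm_sum _ _ _) _.
  apply: le_trans (_ : \sum_(1 <= b < y.+1) 6 / y%:R <= _); last first.
    by rewrite sumr_const_nat subn1 /= -[leLHS]mulr_natl mulrCA mulfV ?mulr1 // gt_eqF.
  apply: ler_sum_nat => b /andP[b0 by_]; rewrite normrM.
  have sb := sqrt_nat_gt0 R b0.
  apply: le_trans (_ : (Num.sqrt b%:R)^-1 * (6 * (Num.sqrt b%:R / y%:R)) <= _).
    apply: ler_pM => //; last exact: rsum_floor.
    rewrite normrM normfV (ger0_norm (ltW sb)) ler_piMl ?invr_ge0 ?(ltW sb) //.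
    by case: (hat_val b) => ->; rewrite ?normrN ?normr0 ?normr1.
  by rewrite le_eqVlt; apply/orP; left; apply/eqP; field; rewrite !gt_eqF.
have B4 : `|\sum_(1 <= a < y.+1) (Num.sqrt a%:R)^-1 * \sum_(y.+1 <= b < (x %/ a).+1) X b / Num.sqrt b%:R| <= 4 * K.
  apply: le_trans (ler_norm_sum _ _ _) _.
  apply: le_trans (_ : rsum R y * (2 * ((Num.sqrt y.+1%:R)^-1 * K)) <= _).
    rewrite /rsum mulr_suml; apply: ler_sum_nat => a _.
    rewrite normrM ger0_norm ?invr_ge0 ?sqrtr_ge0 // ler_wpM2l ?invr_ge0 ?sqrtr_ge0 //.
    exact: hat_sqrt_sum.
  have s0 := sqrt_nat_gt0 R (ltn0Sn y).
  have h0 : 0 <= 2 * ((Num.sqrt y.+1%:R)^-1 * K) by rewrite mulr_ge0 // mulr_ge0 ?invr_ge0 ?sqrtr_ge0 // K_ge0.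
  apply: le_trans (ler_wpM2r h0 (rsum_le R y)) _.
  have : Num.sqrt y%:R / Num.sqrt y.+1%:R <= 1 :> R.
    by rewrite ler_pdivrMr // mul1r ler_sqrt // ler_nat.
  move=> h; have := ler_wpM2r K_ge0 h; move: (Num.sqrt y%:R) ((Num.sqrt y.+1%:R)^-1) => u v; nra.
rewrite E1; apply: le_trans (ler_norm _) _.
apply: le_trans (ler_normD _ _) _.
apply: le_trans (lerD (le_trans (ler_normD _ _) (lerD (le_trans (ler_normD _ _) (lerD B1 B2)) B3)) B4) _.
by clearbody K; lra.
Qed.

(** The squares alone contribute a harmonic sum to the sum that [sum_divsum_sqrt] bounds. *)
Lemma character_contradiction : False.
Proof.
have [n Hn] : exists n, 12 * K + 6 < n%:R.
  by exists (Num.truncn (12 * K + 6)).+1; exact: truncnS_gt.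
have y0 : (0 < 2 ^ (2 * n))%N by rewrite expn_gt0.
have := sum_divsum_sqrt y0; set y := (2 ^ (2 * n))%N in y0 *; apply/negP; rewrite -ltNge.
apply: lt_le_trans Hn _; apply: le_trans (_ : ln y.+1%:R <= _).
  apply: le_trans (_ : ln y%:R <= _); last exact: ln_nat_le.
  rewrite /y natrX lnXn // -[leRHS]mulr_natl natrM.
  by have := ler_wpM2l (ler0n R (2 * n)) (ln2_ge_half R); rewrite natrM; lra.
apply: le_trans (harm_ge R y) _; rewrite /harm.
apply: le_trans (_ : \sum_(1 <= k < y.+1) divsum (k ^ 2) / Num.sqrt (k ^ 2)%:R <= _).
  apply: ler_sum_nat => k /andP[k0 _]; rewrite natrX sqrtr_sqr normr_nat.
  by rewrite ler_peMl ?invr_ge0 //; case: (divsum_sign k0).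
pose g n := divsum n / Num.sqrt n%:R.
have g0 m : (0 < m)%N -> 0 <= g m by move=> m0; rewrite divr_ge0 ?sqrtr_ge0 //; case: (divsum_sign m0).
elim: (y) => [|k IHk]; first by rewrite !big_geq.
have kk : (k ^ 2 < k.+1 ^ 2)%N by rewrite ltn_exp2r.
rewrite big_nat_recr //= (@big_cat_nat _ _ _ (k ^ 2).+1 1 (k.+1 ^ 2).+1) //=; last exact: ltnW.
apply: lerD => //; rewrite big_nat_recr //= lerDr big_nat.
by apply: sumr_ge0 => m /andP[m0 _]; apply: g0; apply: leq_trans m0.
Qed.

End LNonvanishing.

(** * Primes in residue classes *)
Section Nonprime.
Variable R : realType.

(** A proper prime power up to [2 ^ N] has its base at most [2 ^ (N / 2)]. *)
Lemma nonprime_sum_le N :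
  \sum_(1 <= d < (2 ^ N).+1 | ~~ prime d) vonM R d <= ((2 ^ uphalf N).+1 * N.+1 * N)%:R.
Proof.
apply: le_trans (vonM_small_primes R (2 ^ uphalf N) N).
rewrite [leLHS]big_mkcond [leRHS]big_mkcond /=; apply: ler_sum_nat => d /andP[d0 dx].
case: ifPn => [np|_]; last by case: ifP => // _; exact: vonM_ge0.
have [->|/vonM_neq0[p [k [pp k0 Ed]]]] := eqVneq (vonM R d) 0; first by rewrite if_same.
suff -> : (pdiv d <= 2 ^ uphalf N)%N by [].
rewrite Ed pdiv_pexp // -(leq_exp2r _ _ (ltn0Sn 1)) //.
have k2 : (1 < k)%N.
  rewrite ltnNge; apply/negP => k1; move: np; rewrite Ed.
  have -> : k = 1%N by clear - k1 k0; lia.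
  by rewrite expn1 => /negP[].
apply: (@leq_trans d); first by rewrite Ed leq_exp2l // prime_gt1.
apply: leq_trans (ltnSE dx) _; rewrite -expnM leq_exp2l //.
by rewrite muln2 -leq_uphalf_double.
Qed.

Lemma nonprime_small E : (0 < E)%N -> exists N0, forall N, (N0 <= N)%N ->
  \sum_(1 <= d < (2 ^ N).+1 | ~~ prime d) vonM R d <= (2 ^ N)%:R / E%:R.
Proof.
move=> E0; have [k0 Hk0] := exp_beats_poly (E * 16) 2.
exists (2 * k0)%N => N hN; apply: le_trans (nonprime_sum_le N) _.
rewrite ler_pdivlMr ?ltr0n // -natrM ler_nat.
set h := (N./2)%N.
have hk : (k0 <= h)%N by rewrite /h; clear - hN; lia.
have hp := Hk0 h hk; have hu : (uphalf N <= h.+1)%N by rewrite /h; clear; lia.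
have N2 : (2 * h <= N)%N by rewrite /h; clear; lia.
have c1 : ((2 ^ uphalf N).+1 <= 4 * 2 ^ h)%N.
  have : (2 ^ uphalf N <= 2 ^ h.+1)%N by rewrite leq_exp2l.
  by have : (0 < 2 ^ h)%N; [rewrite expn_gt0 | rewrite expnS; clear; lia].
have c2 : (N.+1 <= 2 * h.+1)%N by rewrite /h; clear; lia.
apply: leq_trans (_ : 4 * 2 ^ h * (2 * h.+1) * (2 * h.+1) * E <= _)%N.
  by rewrite leq_mul // leq_mul ?(ltnW c2) // leq_mul.
apply: leq_trans (_ : 2 ^ h * (E * 16 * h.+1 ^ 2) <= _)%N.
  by apply: eq_leq; move: (h.+1) (2 ^ h)%N => i j; clear; ring.
apply: leq_trans (leq_mul (leqnn _) hp) _; rewrite -expnD leq_exp2l //.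
by clear - N2; lia.
Qed.

End Nonprime.

(** * Positive lower density of the primes in a class *)

Section Dirichlet.
Variable R : realType.
Variable q : nat.
Hypothesis q1 : (1 < q)%N.
Local Notation G := {unit 'Z_q}.

Lemma kernel_eq0 (w : G -> R) : in_kernel w -> forall g, w g = 0.
Proof.
move=> Ww g; apply/eqP/negP => /negP wg.
have [chi [W1 c1 cn cm]] := kernel_character q1 Ww (ex_intro _ g wg).
exact: (@character_contradiction R q q1 chi).
Qed.

Lemma Lsum_asymptotic (g : G) :
  bounded_seq (fun x => Lsum R g x - (#|{: G}|%:R)^-1 * ln x%:R).
Proof.
set n : R := #|{: G}|%:R.
have n0 : n != 0 by rewrite pnatr_eq0 -lt0n; apply/card_gt0P; exists 1%g.
pose f h : R := (h == g)%:R - n^-1.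
have dE (F : G -> R) : \sum_h (h == g)%:R * F h = F g.
  by rewrite (bigD1 g) //= eqxx mul1r big1 ?addr0 // => h /negPf ->; rewrite mul0r.
have f0 : sum_zero f.
  rewrite /sum_zero /f sumrB sumr_const -[n^-1 *+ _]mulr_natl -/n mulfV //.
  by have := dE (fun=> 1); under eq_bigr do rewrite mulr1; move=> ->; rewrite subrr.
have fW w : in_kernel w -> \sum_h f h * w (h^-1)%g = 0.
  by move=> Ww; rewrite big1 // => h _; rewrite (kernel_eq0 Ww) mulr0.
have B1 := orth_Lsum_bounded q1 f0 fW.
apply: bounded_seq_eq (bounded_seqD B1 (bounded_seqZ n^-1 (sum_Lsum_ln R q1))) => x /=.
rewrite (eq_bigr (fun h => (h == g)%:R * Lsum R h x - n^-1 * Lsum R h x)); last by move=> *; rewrite mulrBl.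
by rewrite sumrB dE -mulr_sumr; ring.
Qed.

Lemma class_lower (g : G) : exists r, forall N, (r <= N)%N ->
  (2 ^ N)%:R / (2 ^ r)%:R <= \sum_(1 <= d < (2 ^ N).+1 | FinRing.uval g == d%:R) vonM R d.
Proof.
have [C HC] := Lsum_asymptotic g; set n : R := #|{: G}|%:R in HC.
have n0 : 0 < n by rewrite ltr0n; apply/card_gt0P; exists 1%g.
(* So large that [Lsum g] grows by at least 1 from [2 ^ (N - r)] to [2 ^ N]: the error [C] occurs at
   both ends, and the factor 2 comes from [ln 2 >= 1 / 2]. Each [d] in between exceeds
   [2 ^ (N - r)], which converts [Lambda(d) / d] into [Lambda(d)]. *)
have [r Hr] : exists r, (1 + 2 * C) * n * 2 < r%:R.
  by exists (Num.truncn ((1 + 2 * C) * n * 2)).+1; exact: truncnS_gt.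
exists r => N rN; set y := (2 ^ (N - r))%N; set x := (2 ^ N)%N.
have xy : x = (y * 2 ^ r)%N by rewrite /x /y -expnD subnK.
have yx : (y <= x)%N by rewrite xy leq_pmulr // expn_gt0.
have y0 : (0 < y)%N by rewrite expn_gt0.
have y0' : 0 < y%:R :> R by rewrite ltr0n.
have -> : x%:R / (2 ^ r)%:R = y%:R :> R.
  by rewrite xy natrM mulfK // pnatr_eq0 -lt0n expn_gt0.
have h1 : 1 <= Lsum R g x - Lsum R g y.
  have := HC x; have := HC y; rewrite !ler_norml => /andP[_ p1] /andP[p2 _].
  have : ln x%:R = ln y%:R + r%:R * ln 2 :> R.
    rewrite xy natrM lnM ?posrE ?ltr0n ?expn_gt0 //; congr (_ + _).
    by rewrite natrX lnXn // mulr_natl.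
  have h2 : 1 + 2 * C <= n^-1 * (r%:R * ln 2).
    rewrite [leRHS]mulrC ler_pdivlMr //.
    move: (ler_wpM2l (ler0n R r) (ln2_ge_half R)) Hr; move: ((1 + 2 * C) * n) (r%:R * ln 2 : R) (r%:R : R).
    by clear => *; lra.
  move=> E; move: p1 p2; rewrite E mulrDr; move: h2; clear; move: (n^-1 * ln _) (n^-1 * (_ * _)) (Lsum _ _ x) (Lsum _ _ y) => *; lra.
apply: le_trans (_ : (Lsum R g x - Lsum R g y) * y%:R <= _); first by rewrite ler_peMl // ltW.
have -> : Lsum R g x - Lsum R g y = \sum_(y.+1 <= d < x.+1 | FinRing.uval g == d%:R) vonM R d / d%:R.
  by apply/eqP; rewrite subr_eq addrC /Lsum -big_cat_nat.
rewrite mulr_suml [leRHS](@big_cat_nat _ _ _ y.+1) //= -[leLHS]add0r lerD //.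
  by apply: sumr_ge0 => d _; exact: vonM_ge0.
rewrite big_nat_cond [leRHS]big_nat_cond; apply: ler_sum => d /andP[/andP[yd _] _].
rewrite -mulrA ler_piMr ?vonM_ge0 // mulrC ler_pdivrMr ?mul1r ?ler_nat ?(ltnW yd) //.
by rewrite ltr0n (leq_trans _ yd).
Qed.

Lemma prime_class_lower u : coprime q u -> exists r N0, forall N, (N0 <= N)%N ->
  (2 ^ N)%:R / (2 ^ r)%:R <= \sum_(1 <= d < (2 ^ N).+1 | prime d && (d == u %[mod q])) vonM R d.
Proof.
move=> cu; have uu : (u%:R : 'Z_q) \is a GRing.unit by rewrite unitZpE.
have [g Eg] := unit_class uu; have [r Hr] := class_lower g.
have r0 : (0 < 2 ^ r.+1)%N by rewrite expn_gt0.
have [k0 Hk0] := nonprime_small R r0.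
(* Half of the bound of [class_lower] is given up to the proper prime powers. *)
exists r.+1, (r + k0)%N => N hN.
have Eq d : (FinRing.uval g == d%:R) = (d == u %[mod q]).
  rewrite Eg -(inj_eq val_inj) /= !val_Zp_nat // eq_sym //.
have rN : (r <= N)%N by clear - hN; lia.
have := Hr N rN; rewrite (bigID prime) /=.
rewrite (eq_bigl (fun d => prime d && (d == u %[mod q]))); last by move=> d; rewrite andbC Eq.
set A := \sum_(_ <= _ < _ | prime _ && _) _; set B := \sum_(_ <= _ < _ | _ && ~~ _) _ => H.
have HB : B <= (2 ^ N)%:R / (2 ^ r.+1)%:R.
  apply: le_trans (Hk0 N _); last by clear - hN; lia.
  rewrite /B [leLHS]big_mkcond [leRHS]big_mkcond /=; apply: ler_sum_nat => d _.
  by case: (prime d); rewrite ?andbF //= andbT; case: ifP => // _; exact: vonM_ge0.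
move: HB; rewrite expnS natrM invfM mulrA mulrAC.
by move: H; move: (_ / _) => x; lra.
Qed.

End Dirichlet.

(** * Weights on shifted primes *)
Section Approximation.
Variable R : realType.
Implicit Types (a b k n q Q : nat) (x y w th : R).

Lemma norm_sin_le x : `|sin x| <= `|x|.
Proof.
have H y : 0 <= y -> `|sin y| <= y.
  move=> y0; rewrite ler_norml; apply/andP; split; last exact: sin_le_id.
  case: (leP y 1) => y1; last by apply: le_trans (sin_geN1 _); lra.
  have := sin_ge_quarter y0; have := pi_ge2 R => p2 /(_ _); move=> h.
  by apply: le_trans (h _); [lra|lra].
case: (leP 0 x) => x0; first by rewrite (ger0_norm x0) H.
by rewrite -normrN -sinN (ltr0_norm x0); apply: H; rewrite oppr_ge0 ltW.
Qed.

Lemma cos_lipschitz x y : `|cos x - cos y| <= `|x - y|.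
Proof.
have -> : cos x - cos y = - 2 * (sin ((x + y) / 2) * sin ((x - y) / 2)).
  have Ex : cos x = cos ((x + y) / 2 + (x - y) / 2) by congr cos; field.
  have Ey : cos y = cos ((x + y) / 2 - (x - y) / 2) by congr cos; field.
  by rewrite Ex Ey cosD cosB; ring.
rewrite normrM normrN (ger0_norm (ler0n R 2)) normrM.
have h1 : `|sin ((x + y) / 2)| <= 1 by exact: sin_max.
have h2 := norm_sin_le ((x - y) / 2).
rewrite normrM (ger0_norm (_ : 0 <= 2^-1 :> R)) ?invr_ge0 // in h2.
apply: le_trans (_ : 2 * (1 * `|sin ((x - y) / 2)|) <= _); first by rewrite ler_wpM2l // ler_wpM2r.
by rewrite mul1r; lra.
Qed.

Lemma cos_sum_telescope n al w :
  2 * sin (al / 2) * \sum_(0 <= j < n) cos (j%:R * al + w)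
  = sin (n%:R * al + (w - al / 2)) - sin (w - al / 2).
Proof.
elim: n => [|n IHn]; first by rewrite big_geq // mulr0 mul0r add0r subrr.
rewrite big_nat_recr //= mulrDr IHn.
have -> : n.+1%:R * al + (w - al / 2) = (n%:R * al + w) + al / 2 by rewrite -(natr1 n); field.
have -> : n%:R * al + (w - al / 2) = (n%:R * al + w) - al / 2 by ring.
by move: (sin (w - al / 2)) (n%:R * al + w) => c u; rewrite sinB sinD; ring.
Qed.

Lemma cos_sum_class q m w : (0 < q)%N ->
  \sum_(0 <= j < q) cos (j%:R * (2 * pi * (m%:R / q%:R)) + w) = (if (q %| m)%N then q%:R * cos w else 0).
Proof.
move=> q0; have q0' : q%:R != 0 :> R by rewrite pnatr_eq0 -lt0n.
case: ifPn => [/dvdnP[c ->]|nd].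
  rewrite (eq_bigr (fun=> cos w)); first by rewrite sumr_const_nat subn0 mulr_natl.
  move=> j _; rewrite addrC -[in RHS](cosD2pin w (j * c)); congr (cos (_ + _)).
  by rewrite !natrM; field.
have := cos_sum_telescope q (2 * pi * (m%:R / q%:R)) w; set al := 2 * pi * _.
have -> : q%:R * al + (w - al / 2) = (w - al / 2) + 2 * pi * m%:R by rewrite /al; field.
have -> : sin ((w - al / 2) + 2 * pi * m%:R) = sin (w - al / 2).
  have := cosD2pin (w - al / 2 - pi / 2) m.
  have E z : cos (z - pi / 2) = sin z :> R by rewrite cosB cos_pihalf sin_pihalf mulr0 add0r mulr1.
  by rewrite addrAC !E.
move/eqP; rewrite subrr !mulf_eq0 pnatr_eq0 /= => /orP[/eqP h|/eqP //].
have := sin_ndvd_ge R q0 nd; have -> : pi * (m%:R / q%:R) = al / 2 by rewrite /al; field.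
by rewrite h normr0 leNgt invr_gt0 mulr_gt0 // ltr0n.
Qed.

(** Dirichlet's box argument for the fractional parts of [k * th]; reduction to lowest terms only
    decreases the denominator. *)
Lemma dirichlet_approx th Q : 0 <= th -> (0 < Q)%N ->
  exists a b, [/\ (0 < b)%N, (b <= Q)%N, coprime a b & `|th - a%:R / b%:R| <= (b%:R * Q%:R)^-1].
Proof.
move=> th0 Q0; have Q0' : 0 < Q%:R :> R by rewrite ltr0n.
pose t k := Num.truncn (k%:R * th); pose fr k : R := k%:R * th - (t k)%:R.
have kth k : 0 <= k%:R * th by rewrite mulr_ge0.
have fr0 k : 0 <= fr k by rewrite subr_ge0 truncn_le ?kth.
have fr1 k : fr k < 1 by rewrite ltrBlDr addrC natr1 truncnS_gt.
have box k : (Num.truncn (Q%:R * fr k) < Q)%N.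
  have /andP[h _] := truncn_itv (mulr_ge0 (ltW Q0') (fr0 k)).
  by rewrite -(ltr_nat R); apply: le_lt_trans h _; rewrite -[ltRHS]mulr1 ltr_pM2l.
pose f (k : 'I_Q.+1) : 'I_Q := Ordinal (box k).
have [i [j [ij Eij]]] : exists i j : 'I_Q.+1, (i < j)%N /\ f i = f j.
  have : ~~ injectiveb f.
    apply/negP => /injectiveP /leq_card; by rewrite !card_ord ltnn.
  move=> /injectivePn[i [j ne E]]; case: (ltngtP i j) => h.
  - by exists i, j.
  - by exists j, i.
  - by case/eqP: ne; apply: val_inj.
have h : `|fr j - fr i| <= Q%:R^-1.
  have /(congr1 val) /= E := Eij.
  have := truncn_itv (mulr_ge0 (ltW Q0') (fr0 i)); have := truncn_itv (mulr_ge0 (ltW Q0') (fr0 j)).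
  rewrite E; move: (Num.truncn _) => z h1 h2; rewrite -(ler_pM2l Q0') mulfV ?gt_eqF // -{1}(ger0_norm (ltW Q0')) -normrM mulrBr.
  move: h1 h2; rewrite -(natr1 z); move: (z%:R : R) => zz /andP[p1 p2] /andP[p3 p4].
  by rewrite ler_norml; apply/andP; split; lra.
have tij : (t i <= t j)%N.
  by rewrite /t le_truncn // ler_wpM2r // ler_nat ltnW.
pose k := (j - i)%N; pose A := (t j - t i)%N.
have k0 : (0 < k)%N by rewrite subn_gt0.
have E : k%:R * th - A%:R = fr j - fr i.
  by rewrite /fr natrB ?(ltnW ij) // natrB //; ring.
have g0 : (0 < gcdn A k)%N by rewrite gcdn_gt0 k0 orbT.
have kg : (k %/ gcdn A k * gcdn A k = k)%N by rewrite divnK ?dvdn_gcdr.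
have Ag : (A %/ gcdn A k * gcdn A k = A)%N by rewrite divnK ?dvdn_gcdl.
have b0 : (0 < k %/ gcdn A k)%N by rewrite divn_gt0 // dvdn_leq ?dvdn_gcdr.
have k0' : 0 < k%:R :> R by rewrite ltr0n.
exists (A %/ gcdn A k)%N, (k %/ gcdn A k)%N; split => //.
- by apply: leq_trans (leq_div _ _) _; apply: leq_trans (leq_subr _ _) _; rewrite -ltnS.
- by rewrite /coprime -(eqn_pmul2r g0) mul1n muln_gcdl kg Ag.
have -> : (A %/ gcdn A k)%:R / (k %/ gcdn A k)%:R = A%:R / k%:R :> R.
  apply/eqP; rewrite eqr_div ?pnatr_eq0 -?lt0n // -!natrM eqr_nat; apply/eqP.
  move: Ag kg; move: (gcdn A k) (A %/ gcdn A k)%N (k %/ gcdn A k)%N => z u v <- <-; ring.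
apply: le_trans (_ : (k%:R * Q%:R)^-1 <= _); last first.
  by rewrite lef_pV2 ?posrE ?mulr_gt0 ?ltr0n // ler_wpM2r // ler_nat leq_div.
have -> : th - A%:R / k%:R = (fr j - fr i) / k%:R.
  by rewrite -E; field; rewrite gt_eqF.
by rewrite normrM normfV (ger0_norm (ltW k0')) invfM mulrC ler_wpM2l // invr_ge0 ltW.
Qed.

End Approximation.

(* [d - 1] or [d + 1]: the two shifts of the primes needed for the colouring. *)
Definition pshift (s : bool) (d : nat) : nat := if s then d.-1 else d.+1.

(** * Cosine sums over shifted primes at rational points *)

Section RationalBound.
Variable R : realType.
Implicit Types (a b k n q d N : nat) (th w : R) (s : bool).

Definition Psum s q N th : R :=
  \sum_(1 <= d < (2 ^ N).+1 | prime d && (q %| pshift s d)%N)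
    vonM R d * cos (2 * pi * th * (pshift s d)%:R).
Definition Pmass s q N : R :=
  \sum_(1 <= d < (2 ^ N).+1 | prime d && (q %| pshift s d)%N) vonM R d.

Lemma Psum_le s q N th : `|Psum s q N th| <= Pmass s q N.
Proof.
apply: le_trans (ler_norm_sum _ _ _) _; apply: ler_sum => d _.
by rewrite normrM ger0_norm ?vonM_ge0 // ler_piMr ?vonM_ge0 // cos_max.
Qed.

Lemma pshift_class s q d : (1 < q)%N -> (0 < d)%N ->
  (q %| pshift s d)%N = (d == (if s then 1 else q.-1) %[mod q]).
Proof.
move=> q1 d0; case: s => /=.
  by rewrite eqn_mod_dvd // subn1.
rewrite -(eqn_modDr 1) !addn1 prednK ?(ltnW q1) // modnn; exact.
Qed.

Lemma pshiftE s d : (0 < d)%N -> (pshift s d)%:R = d%:R - (if s then 1 else -1) :> R.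
Proof. by case: s d => [] [|d] //= _; rewrite -?natr1 ?opprK // addrK. Qed.

Lemma Pmass_lower s q : (1 < q)%N ->
  exists r N0, forall N, (N0 <= N)%N -> (2 ^ N)%:R / (2 ^ r)%:R <= Pmass s q N.
Proof.
move=> q1; have cu : coprime q (if s then 1 else q.-1)%N.
  by case: s; [rewrite coprimen1 | rewrite coprime_sym coprimePn //; exact: ltnW].
have [r [N0 H]] := prime_class_lower R q1 cu.
exists r, N0 => N /H; rewrite /Pmass big_nat_cond [in X in _ -> X]big_nat_cond.
rewrite (eq_bigl (fun d => (0 < d < (2 ^ N).+1)%N && (prime d && (q %| pshift s d)%N))) //.
by move=> d; case: (posnP d) => // d0; rewrite (pshift_class _ q1 d0).
Qed.

(** Adding a multiple of [1 / q] changes the reduced denominator by a factor of at most [q] in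
    either direction. *)
Lemma reduce_frac a b q j : (0 < b)%N -> (0 < q)%N -> coprime a b ->
  exists a' b', [/\ coprime a' b', (0 < b')%N, (a'%:R / b'%:R : R) = a%:R / b%:R + j%:R / q%:R,
    (b <= b' * q)%N & (b' <= b * q)%N].
Proof.
move=> b0 q0 cab; set A := (a * q + j * b)%N; set D := (b * q)%N.
have D0 : (0 < D)%N by rewrite muln_gt0 b0.
have g0 : (0 < gcdn A D)%N by rewrite gcdn_gt0 D0 orbT.
have Ag : (A %/ gcdn A D * gcdn A D = A)%N by rewrite divnK ?dvdn_gcdl.
have Dg : (D %/ gcdn A D * gcdn A D = D)%N by rewrite divnK ?dvdn_gcdr.
have b'0 : (0 < D %/ gcdn A D)%N by rewrite divn_gt0 // dvdn_leq ?dvdn_gcdr.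
exists (A %/ gcdn A D)%N, (D %/ gcdn A D)%N.
have E : (A %/ gcdn A D * D = D %/ gcdn A D * A)%N.
  by move: Ag Dg; move: (gcdn A D) (A %/ gcdn A D)%N (D %/ gcdn A D)%N => z u v e1 e2; rewrite -e2 -e1; ring.
have nz n : (0 < n)%N -> n%:R != 0 :> R by move=> n0; rewrite pnatr_eq0 -lt0n.
split => //.
- by rewrite /coprime -(eqn_pmul2r g0) mul1n muln_gcdl Dg Ag.
- have -> : a%:R / b%:R + j%:R / q%:R = A%:R / D%:R :> R.
    by rewrite /A /D natrD !natrM; field; rewrite !nz.
  by apply/eqP; rewrite eqr_div ?nz // -!natrM E mulnC.
- apply: dvdn_leq; first by rewrite muln_gt0 b'0.
  move: E; set u := (A %/ _)%N; set v := (D %/ _)%N => E.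
  rewrite -(Gauss_dvdl _ (_ : coprime b a)) 1?coprime_sym //.
  have := dvdn_mull u (dvdn_mulr q (dvdnn b)); rewrite -/D E /A mulnDr.
  rewrite dvdn_addl; last by rewrite mulnA dvdn_mull.
  by rewrite mulnA mulnAC.
- by rewrite leq_div.
Qed.

(** The condition modulo [q] is detected by averaging over the frequencies [j / q]. This moves
    [a / b] to [a / b + j / q], whose denominator is still in the range of [minor_arc_bound]; the
    shift of the primes goes into the phase. *)
Lemma Psum_rational_small E m s q : (0 < E)%N -> (1 < q)%N ->
  exists B z0, forall ze N a b, (z0 <= ze)%N -> (16 * ze <= N)%N -> (N <= m * ze)%N ->
    coprime a b -> (B <= b)%N -> (b * 2 ^ (8 * ze) <= 2 ^ N)%N ->
    `|Psum s q N (a%:R / b%:R)| <= Pmass s q N / E%:R.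
Proof.
move=> E0 q1; have q0 : (0 < q)%N by apply: ltnW.
have q0' : 0 < q%:R :> R by rewrite ltr0n.
have [r [N0 HN0]] := Pmass_lower s q1.
(* The factor 2 is for two error terms, the exponential sum and the proper prime powers; [2 ^ r]
   compares [2 ^ N] with the mass. *)
pose E' := (2 * E * 2 ^ r)%N; have E'0 : (0 < E')%N by rewrite !muln_gt0 E0 expn_gt0.
have [N1 HN1] := nonprime_small R E'0.
have [B0 [z0 Hz0]] := minor_arc_bound R m E'0.
exists (q * B0 + 1)%N, (z0 + N0 + N1 + q)%N => ze N a b hze N16 Nm cab Bb bu.
have b0 : (0 < b)%N by apply: leq_trans Bb; rewrite addn1.
have HM := HN0 N (_ : N0 <= N)%N; have {HM} HM := HM (ltac:(clear - hze N16; lia)).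
have HP := HN1 N (_ : N1 <= N)%N; have {HP} HP := HP (ltac:(clear - hze N16; lia)).
pose C j d : R := cos (2 * pi * (a%:R / b%:R + j%:R / q%:R) * (pshift s d)%:R).
have -> : Psum s q N (a%:R / b%:R)
  = q%:R^-1 * \sum_(0 <= j < q) \sum_(1 <= d < (2 ^ N).+1 | prime d) vonM R d * C j d.
  rewrite exchange_big /= /Psum big_mkcondr mulr_sumr /=; apply: eq_bigr => d _.
  rewrite -mulr_sumr [RHS]mulrCA.
  rewrite (eq_bigr (fun j => cos (j%:R * (2 * pi * ((pshift s d)%:R / q%:R)) + 2 * pi * (a%:R / b%:R) * (pshift s d)%:R))).
    rewrite (@cos_sum_class R q _ _ q0); case: ifP => _; rewrite ?mulr0 //.
    by rewrite mulKf // gt_eqF.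
  by move=> j _; congr cos; ring.
have HS j : `|\sum_(1 <= d < (2 ^ N).+1 | prime d) vonM R d * C j d| <= Pmass s q N / E%:R.
  have [a' [b' [cab' b'0 Eab bb' b'b]]] := reduce_frac j b0 q0 cab.
  pose sg : R := if s then 1 else -1.
  have CE d : (0 < d)%N -> C j d = cosw a' b' (- sg * alpha R a' b') d.
    by move=> d0; rewrite /C /cosw /alpha -Eab pshiftE // -/sg; congr cos; ring.
  have -> : \sum_(1 <= d < (2 ^ N).+1 | prime d) vonM R d * C j d
    = \sum_(1 <= d < (2 ^ N).+1) vonM R d * cosw a' b' (- sg * alpha R a' b') d
      - \sum_(1 <= d < (2 ^ N).+1 | ~~ prime d) vonM R d * C j d.
    apply/eqP; rewrite -subr_eq opprK; apply/eqP.
    rewrite [RHS](eq_big_nat _ _ (F2 := fun d => vonM R d * C j d)).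
      by rewrite [RHS](bigID prime).
    by move=> d /andP[d0 _]; rewrite CE.
  apply: le_trans (ler_normB _ _) _.
  apply: le_trans (_ : (2 ^ N)%:R / E'%:R + (2 ^ N)%:R / E'%:R <= _).
    apply: lerD.
      apply: (Hz0 ze) => //; first by clear - hze; lia.
        rewrite -(leq_pmul2l q0) [leqRHS]mulnC; apply: leq_trans bb'; apply: leq_trans Bb.
        by rewrite leq_addr.
      apply: leq_trans bu; apply: leq_trans (leq_mul b'b (leqnn _)) _.
      rewrite -mulnA leq_mul //; apply: leq_trans (_ : 2 ^ q * 2 ^ (4 * ze) <= _)%N.
        by rewrite leq_mul // ltnW // ltn_expl.
      by rewrite -expnD leq_exp2l //; clear - hze; lia.
    apply: le_trans HP; apply: le_trans (ler_norm_sum _ _ _) _; apply: ler_sum => d _.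
    by rewrite normrM ger0_norm ?vonM_ge0 // ler_piMr ?vonM_ge0 // cos_max.
  apply: le_trans (ler_wpM2r _ HM); last by rewrite invr_ge0.
  rewrite le_eqVlt; apply/orP; left; apply/eqP.
  by rewrite /E' !natrM; field; rewrite !pnatr_eq0 -!lt0n E0 expn_gt0.
rewrite normrM ger0_norm ?invr_ge0 ?(ltW q0') // mulrC ler_pdivrMr //.
apply: le_trans (ler_norm_sum _ _ _) _.
apply: le_trans (_ : \sum_(0 <= j < q) Pmass s q N / E%:R <= _); first by apply: ler_sum => j _.
by rewrite sumr_const_nat subn0 mulr_natr.
Qed.

End RationalBound.

(** * The tower of moduli and scales *)

Section Weights.
Variable R : realType.
Implicit Types (a b k n q d N i : nat) (th w : R) (s : bool).

Lemma Psum_near s q N z th x : `|th - x| <= ((2 ^ N)%:R * (2 ^ z)%:R)^-1 ->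
  `|Psum s q N th - Psum s q N x| <= Pmass R s q N * (16 / (2 ^ z)%:R).
Proof.
move=> H; rewrite /Psum /Pmass -sumrB mulr_suml; apply: le_trans (ler_norm_sum _ _ _) _.
rewrite big_nat_cond [leRHS]big_nat_cond; apply: ler_sum => d /andP[/andP[d0 dx] _].
rewrite -mulrBr normrM ger0_norm ?vonM_ge0 // ler_wpM2l ?vonM_ge0 //.
apply: le_trans (cos_lipschitz _ _) _.
have -> : 2 * pi * th * (pshift s d)%:R - 2 * pi * x * (pshift s d)%:R
  = 2 * pi * (pshift s d)%:R * (th - x) by ring.
have p0 : 0 <= pi :> R by exact: pi_ge0.
have p4 : pi <= 4 :> R by have := pihalf_lt2 R; lra.
rewrite normrM (ger0_norm (_ : 0 <= 2 * pi * (pshift s d)%:R)) ?mulr_ge0 //.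
have hd : (pshift s d)%:R <= 2 * (2 ^ N)%:R :> R.
  rewrite -natrM ler_nat; move: dx d0; rewrite /pshift; have : (0 < 2 ^ N)%N by rewrite expn_gt0.
  by case: s; clear; lia.
apply: le_trans (_ : 2 * 4 * (2 * (2 ^ N)%:R) * ((2 ^ N)%:R * (2 ^ z)%:R)^-1 <= _).
  apply: ler_pM => //; first by rewrite !mulr_ge0.
  by apply: ler_pM => //; [rewrite mulr_ge0|rewrite ler_wpM2l].
rewrite le_eqVlt; apply/orP; left; apply/eqP; field.
by rewrite !pnatr_eq0 -!lt0n !expn_gt0.
Qed.

Lemma Psum_div s q N a b : (0 < b)%N -> (b %| q)%N -> Psum s q N (a%:R / b%:R) = Pmass R s q N.
Proof.
move=> b0 bq; rewrite /Psum /Pmass; apply: eq_bigr => d /andP[_ qd].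
have /dvdnP[c ->] := dvdn_trans bq qd.
have -> : 2 * pi * (a%:R / b%:R) * (c * b)%:R = 0 + 2 * pi * (a * c)%:R :> R.
  by rewrite !natrM; field; rewrite pnatr_eq0 -lt0n.
by rewrite cosD2pin cos0 mulr1.
Qed.

Section Tower.
Variables (Bf : nat -> nat).

(** The factorial makes every positive [b] below the threshold of one modulus a divisor of all later
    moduli. *)
Fixpoint tower i : nat := if i is i'.+1 then (tower i' * (Bf (tower i'))`!)%N else 2%N.

Lemma tower_gt1 i : (1 < tower i)%N.
Proof. by elim: i => //= i IHi; apply: leq_trans IHi _; rewrite leq_pmulr // fact_gt0. Qed.

Lemma tower_dvd b i j : (0 < b)%N -> (b < Bf (tower i))%N -> (i < j)%N -> (b %| tower j)%N.
Proof.
move=> b0 bB; elim: j => // j IHj; rewrite ltnS leq_eqVlt => /orP[/eqP <-|/IHj h] /=.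
  by rewrite dvdn_mull // dvdn_fact // b0 ltnW.
by rewrite dvdn_mulr.
Qed.
End Tower.

(* Level [i] uses primes up to [2 ^ N i] congruent to [1] (or [-1]) mod [q i],
   with [N] decreasing. If [th] is close to [a / b] with [b] small already at
   level [i0], the same [a / b] serves all later levels: it contributes little
   as long as [b] is large compared with [q i], and nonnegatively once [b]
   divides [q i]. Only [i0] and one transitional level can be bad. *)
Lemma tower_sum E s : (0 < E)%N -> exists (J : nat) (N q : nat -> nat),
  [/\ (0 < J)%N, (forall i, (i < J)%N -> 0 < Pmass R s (q i) (N i)),
     (forall i, (i < J)%N -> (N i <= N 0)%N)
   & forall th, 0 <= th -> - (J%:R / E%:R) <= \sum_(0 <= i < J) Psum s (q i) (N i) th / Pmass R s (q i) (N i)].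
Proof.
(* The errors [eta <= 1 / (2 E)] add up to at most 2 over [4 * E] levels, and the two bad levels
   cost 1 each: together 4, which is [J / E]. *)
move=> E0; pose J := (4 * E)%N; pose m := (32 * J)%N; have E4 : (0 < 4 * E)%N by rewrite muln_gt0.
have J0 : (0 < J)%N by [].
have [Bf [zf HB]] : exists Bf zf : nat -> nat, forall q, (1 < q)%N ->
  forall ze N a b, (zf q <= ze)%N -> (16 * ze <= N)%N -> (N <= m * ze)%N ->
    coprime a b -> (Bf q <= b)%N -> (b * 2 ^ (8 * ze) <= 2 ^ N)%N ->
    `|Psum s q N (a%:R / b%:R : R)| <= Pmass R s q N / (4 * E)%:R.
  have H q : exists Bz : nat * nat, (1 < q)%N ->
    forall ze N a b, (Bz.2 <= ze)%N -> (16 * ze <= N)%N -> (N <= m * ze)%N ->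
    coprime a b -> (Bz.1 <= b)%N -> (b * 2 ^ (8 * ze) <= 2 ^ N)%N ->
    `|Psum s q N (a%:R / b%:R : R)| <= Pmass R s q N / (4 * E)%:R.
    case: (boolP (1 < q)%N) => h; last by exists (0%N, 0%N).
    by have [B [z0 H]] := Psum_rational_small R m s E4 h; exists (B, z0).
  by have [f Hf] := boolp.choice H; exists (fun q => (f q).1), (fun q => (f q).2).
have [nf Hn] : exists nf : nat -> nat, forall q, (1 < q)%N -> forall N, (nf q <= N)%N -> 0 < Pmass R s q N.
  have H q : exists n, (1 < q)%N -> forall N, (n <= N)%N -> 0 < Pmass R s q N.
    case: (boolP (1 < q)%N) => h; last by exists 0%N.
    have [r [N0 H]] := Pmass_lower R s h; exists N0 => _ N hN.
    by apply: lt_le_trans (H N hN); rewrite divr_gt0 // ltr0n expn_gt0.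
  by have [f Hf] := boolp.choice H; exists f.
pose q := tower Bf; have q1 i : (1 < q i)%N by exact: tower_gt1.
(* [64 * E] is for [etaE]; the sum dominates the thresholds of all levels at once. *)
pose ze := (64 * E + \sum_(i < J) (zf (q i) + Bf (q i) + nf (q i)))%N.
have zeP i : (i < J)%N -> (zf (q i) + Bf (q i) + nf (q i) <= ze)%N.
  move=> iJ; apply: leq_trans (leq_addl _ _).
  by rewrite (bigD1 (Ordinal iJ)) //= leq_addr.
have zeE : (64 * E <= ze)%N by exact: leq_addr.
have ze0 : (0 < ze)%N by apply: leq_trans zeE; rewrite muln_gt0.
(* The gap of [32 * ze] between consecutive exponents makes a rational approximation found at one
   level sharp enough at all later ones. *)
pose N i := (32 * (J - i) * ze)%N.
have N32 i : (i < J)%N -> (32 * ze <= N i)%N.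
  by move=> iJ; rewrite /N leq_mul // leq_pmulr // subn_gt0.
have Nstep i j : (i < j)%N -> (j < J)%N -> (N j + 32 * ze <= N i)%N.
  by move=> ij jJ; rewrite /N -mulnDl leq_mul // -mulnSr leq_mul // ltn_sub2l // (ltn_trans ij).
have Nm i : (N i <= m * ze)%N by rewrite /N leq_mul // leq_mul // leq_subr.
have M0 i : (i < J)%N -> 0 < Pmass R s (q i) (N i).
  move=> iJ; apply: Hn => //; apply: leq_trans (N32 _ iJ); apply: leq_trans (_ : ze <= _)%N.
    by apply: leq_trans (zeP _ iJ); rewrite leq_addl.
  by rewrite leq_pmull.
exists J, N, q; split => //; first by move=> i _; rewrite /N leq_mul // leq_mul // leq_sub2l.
move=> th th0; pose eta : R := (4 * E)%:R^-1 + 16 / (2 ^ (8 * ze))%:R.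
have etaE : eta <= (2 * E)%:R^-1.
  have h : 16 / (2 ^ (8 * ze))%:R <= (4 * E)%:R^-1 :> R.
    rewrite ler_pdivrMr ?ltr0n ?expn_gt0 // mulrC ler_pdivlMr ?ltr0n // -natrM ler_nat.
    apply: leq_trans (_ : ze <= _)%N; first by apply: leq_trans zeE; clear; lia.
    by apply: leq_trans (ltnW (ltn_expl (8 * ze) _)) => //; rewrite leq_pmull.
  have -> : (2 * E)%:R^-1 = (4 * E)%:R^-1 + (4 * E)%:R^-1 :> R.
    by rewrite !natrM; field; rewrite pnatr_eq0 -lt0n.
  by rewrite lerD2l.
pose T i := Psum s (q i) (N i) th / Pmass R s (q i) (N i).
have minor i a b : (i < J)%N -> coprime a b -> (Bf (q i) <= b)%N -> (b * 2 ^ (8 * ze) <= 2 ^ N i)%N ->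
    `|th - a%:R / b%:R| <= ((2 ^ N i)%:R * (2 ^ (8 * ze))%:R)^-1 -> - eta <= T i.
  move=> iJ cab Bb bu near; have M := M0 i iJ.
  have N16 : (16 * ze <= N i)%N by apply: leq_trans (N32 i iJ); rewrite leq_mul.
  have zz : (zf (q i) <= ze)%N by apply: leq_trans (zeP i iJ); rewrite -addnA leq_addr.
  rewrite /T ler_pdivlMr // mulNr /eta mulrDl [_^-1 * _]mulrC [_ / _ * _]mulrC.
  have := HB (q i) (q1 i) ze (N i) a b zz N16 (Nm i) cab Bb bu; have := Psum_near s (q i) near.
  move: (Psum _ _ _ th) (Psum _ _ _ (_ / _)) (Pmass _ _ _ _ * _^-1) (Pmass _ _ _ _ * (_ / _)) => u v x y.
  by rewrite !ler_norml; clear => /andP[h1 h2] /andP[h3 h4]; lra.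
have major i a b : (i < J)%N -> (0 < b)%N -> (b %| q i)%N ->
    `|th - a%:R / b%:R| <= ((2 ^ N i)%:R * (2 ^ (8 * ze))%:R)^-1 -> - eta <= T i.
  move=> iJ b0 bq near; have M := M0 i iJ.
  rewrite /T ler_pdivlMr // mulNr /eta mulrDl [_^-1 * _]mulrC [_ / _ * _]mulrC.
  have := Psum_near s (q i) near; rewrite Psum_div // ler_norml.
  have h : 0 <= Pmass R s (q i) (N i) / (4 * E)%:R by rewrite divr_ge0 // ltW.
  move: h M; move: (Pmass _ _ _ _) (Psum _ _ _ _) (Pmass _ _ _ _ * _^-1) (Pmass _ _ _ _ * (_ / _)) => z u x y.
  by clear => hx hz /andP[h1 h2]; lra.
have trivial i : (i < J)%N -> -1 <= T i.
  move=> iJ; rewrite /T ler_pdivlMr ?M0 // mulN1r; have := Psum_le s (q i) (N i) th.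
  by rewrite ler_norml => /andP[].
have [ab Hab] : exists ab : nat -> nat * nat, forall i, [/\ (0 < (ab i).2)%N, ((ab i).2 <= 2 ^ (N i - 8 * ze))%N,
    coprime (ab i).1 (ab i).2 & `|th - (ab i).1%:R / (ab i).2%:R| <= ((ab i).2%:R * (2 ^ (N i - 8 * ze))%:R)^-1].
  suff H i : exists x : nat * nat, [/\ (0 < x.2)%N, (x.2 <= 2 ^ (N i - 8 * ze))%N,
    coprime x.1 x.2 & `|th - x.1%:R / x.2%:R| <= (x.2%:R * (2 ^ (N i - 8 * ze))%:R)^-1].
    by have [f Hf] := boolp.choice H; exists f.
  have Q0 : (0 < 2 ^ (N i - 8 * ze))%N by rewrite expn_gt0.
  by have [a [b H]] := dirichlet_approx th0 Q0; exists (a, b).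
pose P i := ((ab i).2 < 2 ^ (16 * ze))%N.
(* [find] returns [J] when no level qualifies, and then no index below [J] is exceptional. *)
pose i0 := find P (iota 0 J); pose b := (ab i0).2; pose a := (ab i0).1.
pose P1 i := (i0 < i)%N && (b < Bf (q i))%N; pose i1 := find P1 (iota 0 J).
have near_mono x y z : (0 < y)%N -> (y <= x)%N -> z <= (x%:R)^-1 -> z <= (y%:R)^-1 :> R.
  by move=> y0 yx h; apply: le_trans h _; rewrite lef_pV2 ?posrE ?ltr0n ?ler_nat // (leq_trans y0).
have Bz i : (i < J)%N -> (Bf (q i) <= 2 ^ (16 * ze))%N.
  move=> iJ; apply: leq_trans (_ : ze <= _)%N.
    by apply: leq_trans (zeP i iJ); rewrite addnAC leq_addl.
  by apply: leq_trans (ltnW (ltn_expl (16 * ze) _)) => //; rewrite leq_pmull.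
have key i : (i < J)%N -> - eta - (i == i0)%:R - (i == i1)%:R <= T i.
  move=> iJ; have eta0 : 0 <= eta by rewrite addr_ge0 ?invr_ge0 // divr_ge0.
  case: (eqVneq i i0) => [_|ni0].
    move: (trivial i iJ) eta0; move: (T i) (eta) => t e; clear.
    by case: (i == i1); rewrite /= ?mulr1n ?mulr0n => *; lra.
  case: (eqVneq i i1) => [_|ni1].
    move: (trivial i iJ) eta0; move: (T i) (eta) => t e; clear.
    by rewrite /= ?mulr1n ?mulr0n => *; lra.
  rewrite !subr0; have [ii0|i0i] : (i < i0 \/ i0 < i)%N by move: ni0; clear; lia.
    have [b0 bQ cab near] := Hab i.
    have NP : (2 ^ (16 * ze) <= (ab i).2)%N.
      by have := before_find 0%N ii0; rewrite nth_iota // add0n /P => /negbT; rewrite -leqNgt.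
    have N8 : (8 * ze <= N i)%N by apply: leq_trans (N32 i iJ); rewrite leq_mul.
    apply: (minor i (ab i).1 (ab i).2) => //.
    - by apply: leq_trans NP; exact: Bz.
    - by apply: leq_trans (leq_mul bQ (leqnn _)) _; rewrite -expnD subnK.
    - rewrite -natrM; rewrite -natrM in near; apply: near_mono near; first by rewrite muln_gt0 !expn_gt0.
      apply: leq_trans (leq_mul NP (leqnn _)); rewrite -!expnD leq_exp2l //.
      by move: N8; clear; lia.
  have i0J : (i0 < J)%N by apply: ltn_trans iJ.
  have Pi0 : P i0.
    have hP : has P (iota 0 J) by rewrite has_find size_iota.
    by have := nth_find 0%N hP; rewrite -/i0 nth_iota.
  have [b0 bQ cab near] := Hab i0.
  have near' : `|th - a%:R / b%:R| <= ((2 ^ N i)%:R * (2 ^ (8 * ze))%:R)^-1.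
    rewrite -natrM; rewrite -natrM in near; apply: near_mono near; first by rewrite muln_gt0 !expn_gt0.
    apply: leq_trans (leq_pmull _ b0); rewrite -!expnD leq_exp2l //.
    by have := Nstep _ _ i0i iJ; clear; lia.
  case: (leqP (Bf (q i)) b) => hb.
    apply: (minor i a b) => //; apply: leq_trans (leq_mul (ltnW Pi0) (leqnn _)) _.
    by rewrite -expnD leq_exp2l //; have := N32 i iJ; clear; lia.
  have P1i : P1 i by rewrite /P1 i0i.
  have i1i : (i1 < i)%N.
    rewrite ltn_neqAle eq_sym ni1 leqNgt; apply/negP => h.
    by have := before_find 0%N h; rewrite nth_iota // add0n P1i.
  have i1J : (i1 < J)%N by apply: ltn_trans iJ.
  have /andP[_ Pi1] : P1 i1.
    have hP : has P1 (iota 0 J) by rewrite has_find size_iota.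
    by have := nth_find 0%N hP; rewrite -/i1 nth_iota.
  by apply: (major i a b) => //; apply: tower_dvd Pi1 i1i.
apply: le_trans (ler_sum_nat (fun i h => key i (proj2 (andP h)))).
rewrite !sumrB sumr_const_nat subn0.
have one j : \sum_(0 <= i < J) (i == j)%:R <= 1 :> R.
  rewrite -natr_sum lern1.
  rewrite (eq_bigr (fun i => if i == j then 1 else 0)%N); last by move=> i _; case: eqP.
  by rewrite -big_mkcond sum1_count count_uniq_mem ?iota_uniq // leq_b1.
have := one i0; have := one i1; move: (\sum_(_ <= _ < _) _) (\sum_(_ <= _ < _) _) => u v hu hv.
rewrite -[- eta *+ J]mulr_natl.
have : J%:R * eta <= J%:R * (2 * E)%:R^-1 by rewrite ler_wpM2l.
have -> : J%:R * (2 * E)%:R^-1 = 2 :> R by rewrite /J !natrM; field; rewrite pnatr_eq0 -lt0n.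
have -> : J%:R / E%:R = 4 :> R by rewrite /J !natrM; field; rewrite pnatr_eq0 -lt0n.
by rewrite mulrN; move: (J%:R * eta) hu hv; clear => x; lra.
Qed.

End Weights.

(** * Recurrence *)
Section Recurrence.
Variable R : realType.
Implicit Types (r x y u M L t p d n E : nat) (s : bool).

Lemma cos_orthogonality M x y u : (0 < M)%N -> (y <= M)%N ->
  \sum_(0 <= r < M) cos (2 * pi * (r%:R * (x%:R + u%:R - y%:R) / M%:R))
  = (if (M %| x + u + (M - y))%N then M%:R else 0) :> R.
Proof.
move=> M0 yM; have := @cos_sum_class R M (x + u + (M - y)) 0 M0; rewrite cos0 mulr1 => <-.
apply: eq_bigr => r _; rewrite addr0 -(cosD2pin _ r); congr cos.
by rewrite !natrD natrB //; field; rewrite pnatr_eq0 -lt0n.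
Qed.

Variables (M L : nat) (A : pred nat).
Hypothesis M2 : M = (2 * L)%N.
Hypothesis L0 : (0 < L)%N.
Let S := [seq x <- iota 0 L | A x].
Let card : R := (size S)%:R.

(* [energy r] is the squared modulus of the Fourier coefficient of [A] at
   [r / M]; the period [M = 2 L] excludes wrap-around. *)
Definition energy r : R := \sum_(x <- S) \sum_(y <- S)
  cos (2 * pi * (r%:R * x%:R / M%:R) - 2 * pi * (r%:R * y%:R / M%:R)).

Lemma energy_ge0 r : 0 <= energy r.
Proof.
have := quad_form S (fun=> 1) (fun x => 2 * pi * (r%:R * x%:R / M%:R)) (0 : R).
move/(le_trans (sqr_ge0 _)) => /le_trans; apply; rewrite le_eqVlt; apply/orP; left; apply/eqP.
by apply: eq_bigr => x _; apply: eq_bigr => y _; rewrite !mul1r.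
Qed.

Lemma energy0 : energy 0 = card ^+ 2.
Proof.
rewrite /energy (eq_bigr (fun=> card)) => [|x _].
  by rewrite big_const_seq count_predT iter_addr_0 expr2 mulr_natl.
rewrite (eq_bigr (fun=> 1)) => [|y _]; last by rewrite !mul0r mulr0 subrr cos0.
by rewrite big_const_seq count_predT iter_addr_0.
Qed.

Lemma mem_S x : x \in S -> (x < L)%N /\ A x.
Proof. by rewrite mem_filter mem_iota add0n => /andP[Ax /andP[_ xL]]. Qed.

(** By orthogonality the sum counts pairs of elements of [S] at difference [u]. *)
Lemma sum_energy_cos u : (u <= L)%N -> (forall x y, x \in S -> y \in S -> x <> (y + u)%N) ->
  \sum_(0 <= r < M) energy r * cos (2 * pi * (r%:R * u%:R / M%:R)) = 0.
Proof.
move=> uL Hu; have M0 : (0 < M)%N by rewrite M2 muln_gt0.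
have M0' : M%:R != 0 :> R by rewrite pnatr_eq0 -lt0n.
(* Averaging with [x] and [y] exchanged turns the product of two cosines into single ones, to which
   [cos_orthogonality] applies. *)
have E r : energy r * cos (2 * pi * (r%:R * u%:R / M%:R)) = 2^-1 *
    ((\sum_(x <- S) \sum_(y <- S) cos (2 * pi * (r%:R * (x%:R + u%:R - y%:R) / M%:R)))
     + \sum_(x <- S) \sum_(y <- S) cos (2 * pi * (r%:R * (x%:R + u%:R - y%:R) / M%:R))).
  rewrite [X in _ + X]exchange_big /= -big_split /= mulr_sumr /energy mulr_suml.
  apply: eq_bigr => x _; rewrite -big_split /= mulr_sumr mulr_suml; apply: eq_bigr => y _.
  set z := 2 * pi * (r%:R * u%:R / M%:R); set w := 2 * pi * (r%:R * x%:R / M%:R) - 2 * pi * (r%:R * y%:R / M%:R).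
  have -> : 2 * pi * (r%:R * (x%:R + u%:R - y%:R) / M%:R) = w + z by rewrite /w /z; field.
  have -> : 2 * pi * (r%:R * (y%:R + u%:R - x%:R) / M%:R) = - (w - z) by rewrite /w /z; field.
  by clearbody w z; rewrite cosN cosD cosB; field.
have Z : \sum_(0 <= r < M) \sum_(x <- S) \sum_(y <- S)
    cos (2 * pi * (r%:R * (x%:R + u%:R - y%:R) / M%:R)) = 0 :> R; last first.
  by rewrite (eq_bigr _ (fun r _ => E r)) -mulr_sumr big_split /= Z addr0 mulr0.
rewrite exchange_big /= big_seq big1 // => x xS.
rewrite exchange_big /= big_seq big1 // => y yS.
have [xL _] := mem_S xS; have [yL _] := mem_S yS.
rewrite cos_orthogonality //; last by rewrite M2; move: yL; clear; lia.
case: ifP => // /dvdnP[k Ek]; exfalso; apply: (Hu y x) => //.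
have k1 : k = 1%N by move: Ek; rewrite M2; move: xL yL uL; clear; nia.
by move: Ek; rewrite k1 M2; move: yL; clear; lia.
Qed.

(** Parseval's identity. *)
Lemma sum_energy : \sum_(0 <= r < M) energy r = M%:R * card.
Proof.
have M0 : (0 < M)%N by rewrite M2 muln_gt0.
rewrite /energy exchange_big /= (_ : M%:R * card = \sum_(x <- S) M%:R); last first.
  by rewrite big_const_seq count_predT iter_addr_0 mulr_natr.
rewrite big_seq [RHS]big_seq; apply: eq_bigr => x xS; have [xL _] := mem_S xS.
rewrite exchange_big /= (bigD1_seq x) //=; last by rewrite filter_uniq ?iota_uniq.
rewrite (eq_bigr (fun=> 1)) => [|r _]; last by rewrite subrr cos0.
rewrite sumr_const_nat subn0 big_seq_cond big1 ?addr0 // => y /andP[yS yx].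
have [yL _] := mem_S yS.
have yM : (y <= M)%N by rewrite M2; move: yL; clear; lia.
transitivity (\sum_(0 <= r < M) cos (2 * pi * (r%:R * (x%:R + 0%:R - y%:R) / M%:R)) : R).
  by apply: eq_bigr => r _; congr cos; field; rewrite pnatr_eq0 -lt0n.
rewrite cos_orthogonality // addn0.
case: ifP => // /dvdnP[k Ek]; exfalso; case/negP: yx; apply/eqP.
have k1 : k = 1%N by move: Ek; rewrite M2; move: xL yL; clear; nia.
by move: Ek; rewrite k1 M2; move: yL; clear; lia.
Qed.

End Recurrence.

(** The energies of [A] are paired with the normalized cosine sums [T]. Without differences
    [t * pshift s p] the pairing vanishes. On the other hand [T 0 = J] and [T >= - J / E], so adding
    [J / E] leaves at least the term [J * c ^ 2] of frequency 0, while Parseval evaluates the added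
    part. The bound [n] is uniform in [t], since dilation by [t] only multiplies the frequency. *)
Lemma shifted_prime_recurrence (R : realType) (E : nat) (s : bool) : (0 < E)%N ->
  exists n, forall (L t : nat) (A : pred nat), (0 < t)%N -> (t * n <= L)%N ->
  (forall x y p, (x < L)%N -> (y < L)%N -> A x -> A y -> prime p -> x <> (y + t * pshift s p)%N) ->
  (size [seq x <- iota 0 L | A x] * E <= 2 * L)%N.
Proof.
move=> E0; have [J [N [q [J0 M0 Nle H]]]] := tower_sum R s E0.
exists (2 ^ N 0 + 2)%N => L t A t0 tL HA; pose M := (2 * L)%N.
have L0 : (0 < L)%N by apply: leq_trans tL; rewrite muln_gt0 t0 addn2.
set S := [seq _ <- _ | _]; pose c : R := (size S)%:R.
have M0' : (0 < M)%N by rewrite muln_gt0.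
pose T r : R := \sum_(0 <= i < J) Psum s (q i) (N i) (t%:R * r%:R / M%:R) / Pmass R s (q i) (N i).
have T0 : T 0%N = J%:R.
  rewrite /T big_nat (eq_bigr (fun=> 1)); first by rewrite -big_nat sumr_const_nat subn0.
  move=> i /andP[_ iJ]; have -> : t%:R * 0%:R / M%:R = 0%:R / 1%:R :> R by rewrite mulr0 !mul0r.
  by rewrite Psum_div ?dvd1n // divff // gt_eqF // M0.
have G1 : \sum_(0 <= r < M) energy R M L A r * T r = 0.
  rewrite /T; under eq_bigr do rewrite mulr_sumr.
  rewrite exchange_big /= big_nat big1 // => i /andP[_ iJ].
  under eq_bigr do rewrite mulrA.
  rewrite -mulr_suml; apply/eqP; rewrite mulf_eq0; apply/orP; left; apply/eqP.
  rewrite /Psum; under eq_bigr do rewrite mulr_sumr.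
  rewrite (exchange_big_dep_nat (fun d => prime d && (q i %| pshift s d)%N)) //= big_nat_cond big1 // => d /andP[/andP[d0 dx] /andP[pd qd]].
  under eq_bigr do rewrite mulrCA.
  rewrite -mulr_sumr; apply/eqP; rewrite mulf_eq0; apply/orP; right; apply/eqP.
  rewrite -[RHS](@sum_energy_cos R M L A erefl L0 (t * pshift s d)).
  - apply: eq_big => [r|r _]; first by rewrite pd qd.
    by congr (_ * cos _); rewrite natrM; ring.
  - apply: leq_trans tL; rewrite leq_mul2l; apply/orP; right.
    have h : (2 ^ N i <= 2 ^ N 0)%N by rewrite leq_exp2l // Nle.
    by move: dx h; clear; rewrite /pshift; case: s => *; lia.
  - move=> x y; rewrite !mem_filter !mem_iota !add0n => /andP[Ax /andP[_ xL]] /andP[Ay /andP[_ yL]].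
    exact: HA.
have G2 : J%:R * c ^+ 2 <= \sum_(0 <= r < M) energy R M L A r * (T r + J%:R / E%:R).
  rewrite big_ltn // energy0 T0 -[leLHS]addr0; apply: lerD.
    by rewrite mulrC ler_wpM2l ?sqr_ge0 // lerDl divr_ge0.
  rewrite big_nat; apply: sumr_ge0 => r _; rewrite mulr_ge0 ?energy_ge0 // -lerBlDr sub0r.
  by apply: H; rewrite !divr_ge0 ?mulr_ge0.
have {G1} G2 : J%:R * c ^+ 2 <= M%:R * c * (J%:R / E%:R).
  apply: le_trans G2 _; under eq_bigr do rewrite mulrDr.
  by rewrite big_split /= G1 add0r -mulr_suml sum_energy.
case: (posnP (size S)) => [->|S0]; first by rewrite mul0n.
have c0 : 0 < c by rewrite ltr0n.
have E0' : 0 < E%:R :> R by rewrite ltr0n.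
have J0' : 0 < J%:R :> R by rewrite ltr0n.
rewrite -(ler_nat R) natrM -/c -/M -(ler_pM2r c0) -(ler_pM2l J0').
rewrite [M%:R * c * _]mulrA ler_pdivlMr // in G2.
have -> : J%:R * (c * E%:R * c) = J%:R * c ^+ 2 * E%:R by ring.
have -> : J%:R * (M%:R * c) = M%:R * c * J%:R by ring.
exact: G2.
Qed.

(** * The lower bound *)
Definition Dset (N : nat) : set nat :=
  (\bigcup_(t in [set t | 1 <= t <= N - 1]%N) dilate t primes_set)%classic.

Lemma DsetP N d : Dset N d <-> exists t p, [/\ (0 < t)%N, (t < N)%N, prime p & d = (t * p)%N].
Proof.
split.
  move=> [t /= /andP[t1 tN] [p /= pp <-]]; exists t, p; split => //.
  by move: t1 tN; clear; lia.
move=> [t [p [t0 tN pp ->]]]; exists t; first by rewrite /= t0; move: tN; clear; lia.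
by exists p.
Qed.

(** * Monochromatic chains and ranks *)

Section Chains.
Variables (C : eqType) (D : set nat) (chi : nat -> C).
Implicit Types (x y m k : nat).

(** A monochromatic chain of [m] terms, given by its last term [y]. The value [True] at [m = 0]
    keeps the maximum in [crank] from being over an empty set. *)
Fixpoint chain m y : Prop := if m is m'.+1 then
  if m' is 0%N then (0 < y)%N else exists x, [/\ (x < y)%N, D (y - x)%N, chi x = chi y & chain m' x]
  else True.

Lemma chain_seq m y : chain m.+1 y -> exists s : seq nat,
  [/\ diffsequence D m.+1 s, last 0%N s = y & forall z, z \in s -> chi z = chi y].
Proof.
elim: m y => [|m IHm] y.
  move=> /= y0; exists [:: y]; split => //; last by move=> z; rewrite inE => /eqP ->.
  by split => [||i]; [by [] | case | rewrite ltnS ltn0].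
move=> [x [xy Dxy cxy /IHm[s [[ss s0 sD] lx cs]]]]; exists (rcons s y); split.
- split; first by rewrite size_rcons ss.
    move=> i; rewrite ltnS leq_eqVlt nth_rcons ss => /orP[/eqP ->|im]; last by rewrite im; exact: s0.
    by rewrite ltnn eqxx; apply: leq_ltn_trans xy.
  move=> i; rewrite ltnS leq_eqVlt !nth_rcons ss => /orP[/eqP Ei|im].
    have im : i = m by case: Ei.
    have Ex : nth 0%N s m = x by rewrite -lx -nth_last ss.
    by rewrite im ltnSn ltnn eqxx Ex.
  by rewrite (ltnW im) im; exact: sD.
- by rewrite last_rcons.
- by move=> z; rewrite mem_rcons inE => /orP[/eqP ->|/cs ->].
Qed.

Variable k : nat.
Hypothesis no_chain : forall y, ~ chain k y.
Hypothesis k0 : (0 < k)%N.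

Definition crank y : nat := \max_(m < k.+1 | `[< chain m y >]) m.

Lemma crank_ge m y : chain m y -> (m < k)%N -> (m <= crank y)%N.
Proof.
move=> cm mk; have mk' : (m < k.+1)%N by exact: ltnW.
by apply: (@leq_bigmax_cond _ _ (fun m : 'I_k.+1 => val m) (Ordinal mk')); apply/asboolP.
Qed.

Lemma crank_chain y : chain (crank y) y.
Proof.
pose P := [pred i : 'I_k.+1 | `[< chain i y >]].
have P0 : (0 < #|P|)%N by apply/card_gt0P; exists ord0; rewrite inE; apply/asboolP.
have [i] := eq_bigmax_cond (fun i : 'I_k.+1 => val i) P0.
by rewrite inE => /asboolP ci Ei; rewrite (_ : crank y = i) // -Ei; apply: eq_bigl => j; rewrite inE.
Qed.

Lemma crank_lt y : (crank y < k)%N.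
Proof.
have h : (crank y <= k)%N by apply/bigmax_leqP => i _; exact: ltnSE (ltn_ord i).
rewrite ltn_neqAle h andbT; apply/eqP => E.
by have := crank_chain y; rewrite E; exact: no_chain.
Qed.

Lemma crank_edge x y : (0 < x)%N -> (x < y)%N -> D (y - x)%N -> chi x = chi y -> (crank x < crank y)%N.
Proof.
move=> x0 xy Dxy cxy.
have [k1|k1] : (k = 1%N \/ (1 < k)%N) by move: k0; clear; lia.
  by exfalso; apply: (@no_chain x); rewrite k1.
have r1 : (1 <= crank x)%N by apply: (@crank_ge 1).
have c1 : chain (crank x).+1 y.
  by move: r1 (crank_chain x); case: (crank x) => // m _ cm; exists x.
have [E|h] : ((crank x).+1 = k \/ (crank x).+1 < k)%N by have := crank_lt x; clear; lia.
  by exfalso; apply: (@no_chain y); rewrite -E.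
exact: crank_ge.
Qed.

End Chains.

Lemma pigeonhole (K : finType) (f : nat -> K) L : (0 < L)%N ->
  exists c, (L <= size [seq y <- iota 0 L | f y == c] * #|K|)%N.
Proof.
move=> L0; apply/existsP; apply: contraT; rewrite negb_exists => /forallP H.
have S : (\sum_(c : K) size [seq y <- iota 0 L | f y == c] = L)%N.
  rewrite -[RHS](size_iota 0) -[RHS]sum1_size; under eq_bigr do rewrite size_filter -sum1_count.
  rewrite (exchange_big_dep xpredT) //=; apply: eq_bigr => y _.
  by rewrite (eq_bigl (pred1 (f y))) ?big_pred1_eq // => c /=; rewrite eq_sym.
have : (L * #|K| <= \sum_(c : K) L.-1)%N.
  rewrite -{1}S big_distrl /=; apply: leq_sum => c _.
  by have := H c; rewrite -ltnNge; case: (L) L0.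
rewrite sum_nat_const mulnC leq_mul2l => /orP[/eqP K0|]; last by move: L0; clear; lia.
by have := fintype0 (f 0%N) K0.
Qed.

Section LowerBound.
Variable R : realType.

(** Take for [p] the least prime divisor of [N] and [t = N / p < N]. *)
Lemma Dset_N N : (2 <= N)%N -> Dset N N.
Proof.
move=> N2; apply/DsetP; exists (N %/ pdiv N)%N, (pdiv N).
have p1 : prime (pdiv N) by apply: pdiv_prime.
split => //; first by rewrite divn_gt0 ?prime_gt0 // pdiv_leq // ltnW.
  by rewrite ltn_Pdiv // ?prime_gt1 // ltnW.
by rewrite divnK // pdiv_dvd.
Qed.

(** The [N] integers after [w] have distinct colours, so all colours occur among them; that of [w]
    can only recur at [w + N]. *)
Lemma periodic_window N (chi : nat -> 'I_N) w : (0 < N)%N ->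
  (forall u t, (u = w \/ (w < u <= w + N)%N) -> (0 < t < N)%N -> chi u != chi (u + t)%N) ->
  chi (w + N)%N = chi w.
Proof.
move=> N0 H; pose f (i : 'I_N) := chi (w.+1 + i)%N.
have inj : injective f.
  move=> i j E; apply: val_inj; case: (ltngtP i j) => // h; exfalso.
    have := H (w.+1 + i)%N (j - i)%N; rewrite -addnA subnKC ?(ltnW h) // -/(f i) -/(f j) E eqxx.
    by move/(_ _ _)/Wrap => [||//]; [right|]; have := ltn_ord i; have := ltn_ord j; move: h; clear; lia.
  have := H (w.+1 + j)%N (i - j)%N; rewrite -addnA subnKC ?(ltnW h) // -/(f i) -/(f j) E eqxx.
  by move/(_ _ _)/Wrap => [||//]; [right|]; have := ltn_ord i; have := ltn_ord j; move: h; clear; lia.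
have [g gK fK] := injF_bij inj.
have E : chi w = f (g (chi w)) by rewrite fK.
have [h|h] : ((g (chi w)).+1 < N \/ (g (chi w)).+1 = N)%N by have := ltn_ord (g (chi w)); clear; lia.
  by have := H w (g (chi w)).+1 (or_introl erefl) h; rewrite -[(w + _)%N]addSnnS -/(f _) fK eqxx.
by rewrite [RHS]E /f addSnnS h.
Qed.

Lemma lower_bound N : (2 <= N)%N -> accessible N (Dset N).
Proof.
move=> N2 chi k k0; apply: contrapT => Hno.
have N0 : (0 < N)%N by apply: ltnW.
have no_chain y : ~ chain (Dset N) chi k y.
  case: k k0 Hno => // k _ Hno /chain_seq[s [ds _ cs]]; apply: Hno; exists s => // a b /= /cs -> /cs ->.
  by [].
pose rk := crank (Dset N) chi k.
have edge x y t p : (0 < x)%N -> (0 < t < N)%N -> prime p -> y = (x + t * p)%N -> chi x = chi y -> (rk x < rk y)%N.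
  move=> x0 /andP[t0 tN] pp -> cxy; apply: crank_edge => //.
    by rewrite -[X in (X < _)%N]addn0 ltn_add2l muln_gt0 t0 prime_gt0.
  by rewrite addKn; apply/DsetP; exists t, p.
have [L0 HL0] : exists L0, forall a, (0 < a)%N -> exists o t, [/\ (o < L0)%N, (0 < t < N)%N & chi (a + o)%N = chi (a + o + t)%N].
  (* Room for [k] steps of length [N], and for the window of length [N] after the last of them. *)
  apply: contrapT => HW; pose L1 := (k * N + N + 1)%N.
  have [a a0 Ha] : exists2 a, (0 < a)%N & forall o t, (o < L1)%N -> (0 < t < N)%N -> chi (a + o)%N != chi (a + o + t)%N.
    apply: contrapT => Hn; apply: HW; exists L1 => a a0; apply: contrapT => Hn2; apply: Hn.
    exists a => // o t ol tN; apply/eqP => E; apply: Hn2; by exists o, t.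
  have per i : (i < k)%N -> chi (a + i * N + N)%N = chi (a + i * N)%N.
    move=> ik; apply: periodic_window => // u t hu tN.
    have au : (a <= u)%N by case: hu => [->|/andP[h1 _]]; [exact: leq_addr | move: h1; clear; lia].
    rewrite -(subnKC au); apply: Ha => //.
    have h : ((i.+1) * N <= k * N)%N by rewrite leq_mul2r ik orbT.
    rewrite mulSn in h; case: hu => [->|/andP[h1 h2]]; rewrite /L1; first by move: h; clear; lia.
    by move: h h1 h2; clear; lia.
  suff ch i : (i < k)%N -> chain (Dset N) chi i.+1 (a + i * N)%N.
    by case: k k0 no_chain ch {Hno rk edge per L1 Ha} => // k _ nc ch; exact: (nc _ (ch k (ltnSn k))).
  elim: i => [|i IHi] ik; first by rewrite /= mul0n addn0.
  have ik' : (i < k)%N by apply: ltnW.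
  exists (a + i * N)%N; split; last exact: IHi.
  - by rewrite ltn_add2l ltn_mul2r N0 ltnSn.
  - by rewrite subnDl -mulnBl subSnn mul1n; exact: Dset_N.
  - by rewrite -(per i ik') mulSn -addnA [(N + _)%N]addnC.
(* [y] is described by the place of a pair [w, w + t] of equal colour near it,
   the colour, and the ranks of the two elements. *)
pose K := ('I_L0 * 'I_N * 'I_N * 'I_k * 'I_k)%type.
have rkk y : (rk y < k)%N by exact: crank_lt.
have [f Hf] : exists f : nat -> K, forall y, let: (o, t, c, r1, r2) := f y in
   [/\ (0 < t)%N, chi (y.+1 + o)%N = c, chi (y.+1 + o + t)%N = c, rk (y.+1 + o)%N = r1 & rk (y.+1 + o + t)%N = r2].
  suff H y : exists z : K, let: (o, t, c, r1, r2) := z in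
     [/\ (0 < t)%N, chi (y.+1 + o)%N = c, chi (y.+1 + o + t)%N = c, rk (y.+1 + o)%N = r1 & rk (y.+1 + o + t)%N = r2].
    by have [f Hf] := boolp.choice H; exists f.
  have [o [t [oL /andP[t0 tN] E]]] := HL0 y.+1 isT.
  exists (Ordinal oL, Ordinal tN, chi (y.+1 + o)%N, Ordinal (rkk (y.+1 + o)%N), Ordinal (rkk (y.+1 + o + t)%N)).
  by split.
(* The largest class has at least [L / cK] elements below [L], so with this [E] it violates the
   density bound of the recurrence theorem. *)
pose cK := #|{: K}|; pose E := (2 * cK + 1)%N; have E0 : (0 < E)%N by rewrite /E addn1.
have [n1 H1] := shifted_prime_recurrence R true E0.
have [n2 H2] := shifted_prime_recurrence R false E0.
pose L := (N * (n1 + n2) + 1)%N; have L0' : (0 < L)%N by rewrite /L addn1.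
have [c Hc] : exists c : K, (L <= size [seq y <- iota 0 L | f y == c] * cK)%N := pigeonhole f L0'.
case Ec : c => [[[[o t] cc] r1] r2].
have cE y : f y = c -> [/\ (0 < t)%N, chi (y.+1 + o)%N = cc, chi (y.+1 + o + t)%N = cc,
    rk (y.+1 + o)%N = r1 & rk (y.+1 + o + t)%N = r2] by move=> fy; have := Hf y; rewrite fy Ec.
have big : ~~ (size [seq y <- iota 0 L | f y == c] * E <= 2 * L)%N.
  rewrite -ltnNge /E; move: Hc L0'; move: (size _) (cK) => S a; move: (L) => l; clear; nia.
have tN : (t < N)%N by exact: ltn_ord.
have [y0 fy0] : exists y, f y = c.
  move: big; case Es : [seq y <- iota 0 L | f y == c] => [|y s]; first by rewrite mul0n.
  by exists y; have : y \in [seq y <- iota 0 L | f y == c]; [rewrite Es mem_head | rewrite mem_filter => /andP[/eqP]].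
have t0 : (0 < t)%N by case: (cE y0 fy0).
have tL n : (n <= n1 + n2)%N -> (t * n <= L)%N.
  by move=> h; apply: leq_trans (leq_mul (ltnW tN) h) _; rewrite /L leq_addr.
have step s n : (forall (L t : nat) (A : pred nat), (0 < t)%N -> (t * n <= L)%N ->
  (forall x y p, (x < L)%N -> (y < L)%N -> A x -> A y -> prime p -> x <> (y + t * pshift s p)%N) ->
  (size [seq x <- iota 0 L | A x] * E <= 2 * L)%N) -> (n <= n1 + n2)%N ->
  exists x y p, [/\ f x = c, f y = c, prime p & x = (y + t * pshift s p)%N].
  move=> H hn; apply: contrapT => Hno'; move/negP: big; apply.
  apply: (H L t (fun y => f y == c)) => //; first exact: tL.
  by move=> x y p _ _ /eqP fx /eqP fy pp Exy; apply: Hno'; exists x, y, p.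
have [x [y [p [fx fy pp Exy]]]] := step true n1 H1 (leq_addr _ _).
have [x' [y' [p' [fx' fy' pp' Exy']]]] := step false n2 H2 (leq_addl _ _).
have [_ cx1 cx2 rx1 rx2] := cE x fx; have [_ cy1 cy2 ry1 ry2] := cE y fy.
have [_ cx1' cx2' rx1' rx2'] := cE x' fx'; have [_ cy1' cy2' ry1' ry2'] := cE y' fy'.
have tt : (0 < t < N)%N by rewrite t0.
have e1 : (r1 < r2)%N.
  rewrite -ry1 -rx2; apply: (edge _ _ t p) => //; last by rewrite cy1 cx2.
  by rewrite Exy /=; have := prime_gt0 pp; case: (p) => //= p0 _; rewrite mulnS; clear; lia.
have e2 : (r2 < r1)%N.
  rewrite -ry2' -rx1'; apply: (edge _ _ t p') => //; last by rewrite cy2' cx1'.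
  by rewrite Exy' /= mulnS; clear; lia.
by move: e1 e2; clear; lia.
Qed.

End LowerBound.

(** * The upper bound *)
Section UpperBound.
Variable N : nat.
Hypothesis N2 : (2 <= N)%N.
Let H := (N ^ 2)%N.
Let B := (2 * N * H)%N.
Let F := (B`!)%N.
Let M := (F * F)%N.
Implicit Types (x y d t p e u v i : nat).

(* In each period of length [M] there are [N] windows of length [H], the [j]-th
   one marking its elements congruent to [j] mod [N]. A multiple of [N] in [D]
   is below [H], so an unmarked chain within a residue class cannot jump over
   a window. Distinct marked residues differ by some [e] with [N <= e < B], and
   [M] is so divisible that [k * M +- e] is never [t * p] with [t < N]. *)
Definition special x : bool :=
  [&& (x %% M < B)%N, ~~ odd (x %% M %/ H) & (x %% M %% N == x %% M %/ (2 * H))%N].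

Lemma N_gt0 : (0 < N)%N. Proof. exact: ltnW. Qed.
Lemma H_gt0 : (0 < H)%N. Proof. by rewrite expn_gt0 N_gt0. Qed.
Lemma N_lt_H : (N < H)%N. Proof. by rewrite /H -mulnn ltn_Pmull // N_gt0. Qed.
Lemma H_lt_B : (H < B)%N.
Proof. by rewrite /B ltn_Pmull ?H_gt0 //; move: N2; clear; lia. Qed.
Lemma B_le_F : (B <= F)%N.
Proof. by rewrite /F; case: (B) => // b; rewrite factS leq_pmulr // fact_gt0. Qed.
Lemma dvd_F e : (0 < e <= B)%N -> (e %| F)%N.
Proof. exact: dvdn_fact. Qed.
Lemma F_gt2 : (2 < F)%N.
Proof.
by apply: leq_trans B_le_F; apply: leq_trans (ltnW H_lt_B); apply: leq_ltn_trans N_lt_H.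
Qed.
Lemma M_gt0 : (0 < M)%N. Proof. by rewrite muln_gt0 fact_gt0. Qed.
Lemma B_le_M : (B <= M)%N.
Proof. by apply: leq_trans B_le_F _; rewrite leq_pmulr // fact_gt0. Qed.
Lemma N_dvd_M : (N %| M)%N.
Proof.
by rewrite dvdn_mulr // dvd_F // N_gt0; apply: ltnW; apply: ltn_trans N_lt_H H_lt_B.
Qed.

(** If [p] did not divide [N], then [N] would divide [t < N]; hence [p <= N]. *)
Lemma Dset_multiple d : Dset N d -> (N %| d)%N -> (d < H)%N.
Proof.
move=> /DsetP[t [p [t0 tN pp ->]]] Nd; case: (boolP (p %| N)%N) => pN.
  apply: leq_ltn_trans (leq_mul (leqnn _) (dvdn_leq N_gt0 pN)) _.
  by rewrite /H -mulnn ltn_pmul2r // N_gt0.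
have cNp : coprime N p by rewrite coprime_sym prime_coprime.
by move: Nd; rewrite Gauss_dvdl // => /(dvdn_leq t0); rewrite leqNgt tN.
Qed.

(** The factor [u] would divide [p], hence equal [p], and then [t = e]. *)
Lemma no_prime_factor t p e u : (0 < t)%N -> (t < e)%N -> prime p -> (1 < u)%N -> coprime u t ->
  (t * p)%N <> (e * u)%N.
Proof.
move=> t0 te pp u1 cut E.
have : (u %| p)%N by rewrite -(Gauss_dvdr _ cut) E dvdn_mull.
have u1' : u != 1%N by rewrite gtn_eqF.
move=> /(prime_nt_dvdP pp u1') Eu; move/eqP: E; rewrite Eu eqn_pmul2r ?prime_gt0 // => /eqP E.
by move: te; rewrite E ltnn.
Qed.

(** Two marked residues of one window are congruent modulo [N]; different windows are separated by
    gaps of length [H > N]. *)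
Lemma special_far x y : special x -> special y -> (x %% M < y %% M)%N -> (N <= y %% M - x %% M)%N.
Proof.
move=> /and3P[xB ox /eqP ex] /and3P[yB oy /eqP ey]; move: xB ox ex yB oy ey.
move: (x %% M)%N (y %% M)%N => a b aB oa ea bB ob eb ab.
have half c : ~~ odd (c %/ H) -> (c %/ H = 2 * (c %/ (2 * H)))%N.
  move=> oc; rewrite [(2 * H)%N]mulnC divnMA mulnC; have := odd_double_half (c %/ H).
  by rewrite (negPf oc) add0n divn2 -muln2.
have := half a oa; have := half b ob.
case: (ltngtP (a %/ (2 * H)) (b %/ (2 * H))) => [h|h|h].
- move=> Eb Ea; have bH : (b %/ H * H <= b)%N by exact: leq_divM.
  have aH : (a < (a %/ H).+1 * H)%N by rewrite ltn_ceil // H_gt0.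
  have := N_lt_H; rewrite Eb in bH; rewrite Ea in aH; move: h bH aH.
  by move: (a %/ (2 * H))%N (b %/ (2 * H))%N (H) => u v z; clear; nia.
- by move=> _ _; have := leq_div2r (2 * H) (ltnW ab); rewrite leqNgt h.
move=> _ _; apply: dvdn_leq; first by rewrite subn_gt0.
by rewrite -eqn_mod_dvd ?(ltnW ab) // ea eb h.
Qed.

(** For a step across periods, [k * M +- e = e * (v * F +- 1)], and [v * F +- 1] is coprime to [t]
    since [t] divides [F]. Of the two factors of [M = F * F], one provides the divisor [e] and the
    other remains in [v * F]. When the residues agree, [p] itself would be a multiple of [F], which
    is even and greater than 2. *)
Lemma special_step x y : (x < y)%N -> special x -> special y -> Dset N (y - x)%N -> (y %/ M = x %/ M)%N.
Proof.
move=> xy sx sy Dd; apply/eqP; apply: contraT => ne; exfalso.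
have lt : (x %/ M < y %/ M)%N by rewrite ltn_neqAle eq_sym ne leq_div2r // ltnW.
have /DsetP[t [p [t0 tN pp Ed]]] := Dd.
pose k := (y %/ M - x %/ M)%N; have k0 : (0 < k)%N by rewrite subn_gt0.
have Ek : (y %/ M = x %/ M + k)%N by rewrite subnKC // ltnW.
have Ey : y = (x %/ M * M + k * M + y %% M)%N by rewrite -mulnDl -Ek -divn_eq.
have Ex : x = (x %/ M * M + x %% M)%N by rewrite -divn_eq.
have [xB yB] : (x %% M < B)%N /\ (y %% M < B)%N by case/and3P: sx => -> _ _; case/and3P: sy.
have tF : (t %| F)%N.
  by apply: dvd_F; rewrite t0; apply: ltnW; apply: ltn_trans tN _; apply: ltn_trans N_lt_H H_lt_B.
have F2 := F_gt2.
have big e : (0 < e)%N -> (e < B)%N -> exists v, [/\ (0 < v)%N & (k * M = e * (v * F))%N].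
  move=> e0 eB; have /dvdnP[f Ef] := dvd_F (introT andP (conj e0 (ltnW eB))).
  exists (k * f)%N; split; last by rewrite /M {1}Ef; clear; ring.
  rewrite muln_gt0 k0 lt0n; apply/eqP => f0.
  by have := F_gt2; rewrite Ef f0.
have cop v : (0 < v)%N -> coprime (v * F).+1 t /\ coprime (v * F).-1 t.
  move=> v0; have tv : (t %| v * F)%N by rewrite dvdn_mull.
  split; apply: coprime_dvdr tv _; first exact: coprimeSn.
  by apply: coprimePn; rewrite muln_gt0 v0 fact_gt0.
case: (ltngtP (x %% M) (y %% M)) => h.
- have eN := special_far sx sy h; set e := (y %% M - x %% M)%N in eN.
  have e0 : (0 < e)%N by rewrite subn_gt0.
  have [v [v0 Ev]] := big e e0 (leq_ltn_trans (leq_subr _ _) yB).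
  apply: (@no_prime_factor t p e (v * F).+1) => //; first exact: leq_trans tN eN.
  - by rewrite ltnS muln_gt0 v0 fact_gt0.
  - by case: (cop v v0).
  - by rewrite -Ed mulnS -Ev Ey {2}Ex /e; move: h; clear; lia.
- have eN := special_far sy sx h; set e := (x %% M - y %% M)%N in eN.
  have e0 : (0 < e)%N by rewrite subn_gt0.
  have [v [v0 Ev]] := big e e0 (leq_ltn_trans (leq_subr _ _) xB).
  have vF : (2 < v * F)%N by apply: leq_trans F2 _; rewrite leq_pmull.
  apply: (@no_prime_factor t p e (v * F).-1) => //; first exact: leq_trans tN eN.
  - by move: vF; clear; lia.
  - by case: (cop v v0).
  - rewrite -Ed -subn1 mulnBr muln1 -Ev.
    have : (e <= k * M)%N by rewrite Ev leq_pmulr // (ltn_trans _ vF).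
    by rewrite {1}Ey {2}Ex /e; move: h; clear; lia.
have Ed2 : (t * p = k * M)%N by rewrite -Ed Ey {2}Ex h; clear; lia.
have /dvdnP[f Ef] := tF.
have Ep : (p = k * f * F)%N.
  by apply/eqP; rewrite -(eqn_pmul2l t0) Ed2 /M {1}Ef; apply/eqP; clear; ring.
have Fp : (F %| p)%N by rewrite Ep dvdn_mull.
have F1 : F != 1%N by move: F2; clear; lia.
have EF := prime_nt_dvdP pp F1 Fp.
have : (2 %| p)%N by rewrite -EF; apply: dvd_F => /=; apply: leq_trans N2 (ltnW (ltn_trans N_lt_H H_lt_B)).
by rewrite dvdn_prime2 // => /eqP E2; move: F2; rewrite EF -E2.
Qed.

Lemma special_block i b z : (i < N)%N -> (b %% M = 2 * i * H)%N -> (b <= z)%N -> (z < b + H)%N ->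
  (z %% N = i)%N -> special z.
Proof.
move=> iN Eb bz zb zi.
have le1 : (2 * i * H + H <= B)%N.
  by rewrite /B -mulSnr leq_mul2r; apply/orP; right; move: iN; clear; lia.
have Ez : (z %% M = 2 * i * H + (z - b))%N.
  rewrite -{1}(subnKC bz) -modnDml Eb modn_small //.
  by apply: leq_trans B_le_M; apply: leq_trans le1; rewrite ltn_add2l; move: bz zb; clear; lia.
have zH : (z - b < H)%N by move: bz zb; clear; lia.
have q1 : (z %% M %/ H = 2 * i)%N by rewrite Ez divnMDl ?H_gt0 // divn_small // addn0.
apply/and3P; split.
- by rewrite Ez; apply: leq_trans le1; rewrite ltn_add2l.
- by rewrite q1 oddM.
- by rewrite modn_dvdm ?N_dvd_M // zi mulnC divnMA q1 mulnC mulnK.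
Qed.

Lemma next_residue x r : (r < M)%N -> exists b, [/\ (x <= b)%N, (b < x + M)%N & (b %% M = r)%N].
Proof.
move=> rM; have M0 := M_gt0; have Ex := divn_eq x M; have xM := ltn_pmod x M0.
case: (leqP (x %% M) r) => h.
  exists (x %/ M * M + r)%N; rewrite modnMDl modn_small //; split => //.
    by rewrite {1}Ex leq_add2l.
  by rewrite {2}Ex -addnA ltn_add2l; apply: ltn_addl.
exists ((x %/ M).+1 * M + r)%N; rewrite modnMDl modn_small //; split => //.
  by rewrite {1}Ex mulSn; move: xM; clear; lia.
by rewrite {2}Ex mulSn; move: h; clear; lia.
Qed.

Lemma upper_bound s : (N < s)%N -> ~ accessible s (Dset N).
Proof.
case: s => // s Ns acc; pose col x := (if special x then N else x %% N)%N.
have colN x : (col x < s.+1)%N.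
  rewrite /col; case: ifP => _; first exact: Ns.
  by apply: ltn_trans Ns; rewrite ltn_mod N_gt0.
pose chi x : 'I_s.+1 := Ordinal (colN x).
(* Over [M + B] steps a marked chain would have to leave its period; an unmarked one reaches, within
   [M] steps, the window of its residue class. *)
have [k0 k1] : (0 < M + B + 2)%N /\ True by rewrite addn2.
have [xs [sz pos inc] mono] := acc chi (M + B + 2)%N k0.
pose x i := nth 0%N xs i; set k := (M + B + 2)%N in sz pos inc.
have same i j : (i < k)%N -> (j < k)%N -> col (x i) = col (x j).
  move=> ik jk; have : chi (x i) = chi (x j) by apply: mono => /=; rewrite mem_nth // sz.
  by move=> /(congr1 val).
have grow i : (i < k)%N -> (x 0%N + i <= x i)%N.
  elim: i => [|i IHi] ik; first by rewrite addn0.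
  have [h _] := inc i ik; rewrite addnS; apply: leq_ltn_trans h; apply: IHi; exact: ltnW.
have kB : (M + B < k)%N by rewrite /k addn2 ltnS leqnSn.
case: (boolP (special (x 0%N))) => s0.
  have sp i : (i < k)%N -> special (x i).
    move=> ik; have := same _ _ ik k0; rewrite /col s0; case: ifP => // _ E.
    by have := ltn_pmod (x i) N_gt0; rewrite E ltnn.
  have quo i : (i < k)%N -> (x i %/ M = x 0%N %/ M)%N.
    elim: i => // i IHi ik; have ik' := ltnW ik; rewrite -(IHi ik').
    by have [h Dh] := inc i ik; apply: special_step => //; exact: sp.
  have := grow _ kB; have := quo _ kB; have /and3P[h _ _] := sp _ kB.
  rewrite [in X in _ -> X](divn_eq (x (M + B)%N) M) [in X in _ -> X](divn_eq (x 0%N) M) => ->.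
  by move: h; clear; lia.
have sp i : (i < k)%N -> ~~ special (x i).
  move=> ik; apply/negP => si; have := same _ _ ik k0; rewrite /col si (negPf s0) => E.
  by have := ltn_pmod (x 0%N) N_gt0; rewrite -E ltnn.
have res i : (i < k)%N -> (x i %% N = x 0%N %% N)%N.
  by move=> ik; have := same _ _ ik k0; rewrite /col (negPf s0) (negPf (sp i ik)).
set r := (x 0%N %% N)%N in res; have rN : (r < N)%N by rewrite ltn_mod N_gt0.
have rM : (2 * r * H < M)%N.
  by apply: leq_trans B_le_M; rewrite /B ltn_mul2r H_gt0 /= ltn_mul2l.
have [b [xb bx Eb]] := next_residue (x 0%N) rM.
have ex : exists i, (i < k)%N && (b <= x i)%N.
  exists M; have Mk : (M < k)%N by apply: leq_ltn_trans kB; exact: leq_addr.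
  by rewrite Mk; apply: ltnW; apply: leq_trans bx _; exact: grow.
(* The first term not before the start [b] of the window: the step leading to it is below [H], so it
   lands inside and is marked. *)
case: (ex_minnP ex) => n /andP[nk bn] minn.
move/negP: (sp n nk); apply; apply: (special_block rN Eb bn); last exact: res.
case: n nk bn minn => [|n] nk bn minn.
  by apply: leq_ltn_trans xb _; rewrite -[X in (X < _)%N]addn0 ltn_add2l H_gt0.
have [h Dh] := inc n nk; have nk' := ltnW nk.
have lb : (x n < b)%N.
  by rewrite ltnNge; apply/negP => hb; have := minn n; rewrite nk' hb ltnn => /(_ isT).
have dN : (N %| x n.+1 - x n)%N.
  by rewrite -eqn_mod_dvd ?(ltnW h) // res // res.
have := Dset_multiple Dh dN; move: lb h; rewrite -/(x n) -/(x n.+1); clear; lia.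
Qed.

End UpperBound.

Local Open Scope classical_set_scope.
Local Open Scope nat_scope.

Theorem theorem1 (N : nat) (hN : 2 <= N) :
  doa (\bigcup_(t in [set t | 1 <= t <= N - 1]) dilate t primes_set) = Some N.
Proof.
(* The analytic part is done over an arbitrary model of the reals; a concrete one is supplied
   here. *)
have lower : accessible N (Dset N) by exact: (lower_bound Rstruct.RbaseSymbolsImpl_R__canonical__reals_Real).
have upper s : N < s -> ~ accessible s (Dset N) by exact: upper_bound.
have N0 : 0 < N by exact: ltnW.
rewrite -/(Dset N) /doa; case: asboolP => [all_r|_]; first by case: (upper N.+1 _ (all_r _ _)).
congr Some; case: xgetP => [r _ [r0 acc_r max_r]|none].
  apply/eqP; rewrite eqn_leq (max_r N) // andbT leqNgt.
  by apply/negP => /upper; apply.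
case: (none N); split => // s _ acc_s; rewrite leqNgt.
by apply/negP => /upper; apply.
Qed.
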